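(* Let $n=2$, $p=3$ and $u\in\mathbb{Z}_3^\times$. The conjugacy classes of maximal finite subgroups $F$ of $\mathbb{G}_2(u)$ are represented by $$SD_{16}\qquad\text{and}\qquad\begin{cases}C_3\rtimes Q_8&\text{if } u\equiv 1\bmod 3,\\ C_3\rtimes D_8&\text{if } u\equiv -1\bmod 3.\end{cases}$$
   Context: $\mathbb{D}_2$ is the central division algebra over $\mathbb{Q}_3$ of Hasse invariant $1/2$ and $\mathbb{G}_2(u)=\mathbb{D}_2^\times/\langle 3u\rangle$. $C_3$ is the cyclic group of order $3$, $SD_{16}$ the semidihedral group of order $16$, $Q_8$ the quaternion group of order $8$, $D_8$ the dihedral group of order $8$; $\rtimes$ denotes a semidirect product with normal factor on the left. The statement means that there are exactly two conjugacy classes of maximal finite subgroups, one for each group listed in the relevant case. *)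

(* Defs.v *)
From HB Require Import structures.
From mathcomp Require Import all_boot all_order all_algebra.
From mathcomp Require Import all_fingroup all_solvable all_field.
From mathcomp Require Import boolp classical_sets cardinality.

Set Implicit Arguments.
Unset Strict Implicit.
Unset Printing Implicit Defensive.

Import GRing.Theory.
Local Open Scope ring_scope.

Record prime_nat := PrimeNat { prime_val :> nat; prime_valP : prime prime_val }.

Definition prime3 : prime_nat := @PrimeNat 3 isT.

(* Z_p is the inverse limit of the Z/p^n; the n-th component is represented by
   its remainder in [0, p^n[, so that 0%N is the only possible 0-th component. *)
Record padic_int (p : prime_nat) := PadicInt {
  pcoord :> nat -> nat;
  pcoordP : forall n, pcoord n = (pcoord n.+1 %% p ^ n)%N }.

Section PadicInt.
Variable p : prime_nat.
Local Notation Zp := (padic_int p).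
Implicit Types x y z : Zp.

HB.instance Definition _ := gen_eqMixin Zp.
HB.instance Definition _ := gen_choiceMixin Zp.

Lemma padic_int_eq x y : (forall n, x n = y n) -> x = y.
Proof.
case: x y => [x xP] [y yP] /= /funext eq_xy.
by case: _ / eq_xy yP => yP; congr PadicInt; exact: Prop_irrelevance.
Qed.

Lemma pmod_dvd m n k : (m <= n)%N -> ((k %% p ^ n) %% p ^ m = k %% p ^ m)%N.
Proof. by move=> le_mn; rewrite modn_dvdm // dvdn_exp2l. Qed.

Lemma pcoord_mod x n : (x n %% p ^ n = x n)%N.
Proof. by rewrite pcoordP modn_mod. Qed.

Lemma pcoord_le x m n : (m <= n)%N -> x m = (x n %% p ^ m)%N.
Proof.
move=> le_mn; rewrite -(subnKC le_mn); elim: (n - m)%N => [|k IHk].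
  by rewrite addn0 pcoord_mod.
by rewrite IHk addnS (pcoordP x (m + k)) pmod_dvd // leq_addr.
Qed.

Fact padic_nat_subproof k n : (k %% p ^ n = (k %% p ^ n.+1) %% p ^ n)%N.
Proof. by rewrite pmod_dvd. Qed.
Definition padic_nat k : Zp := PadicInt (padic_nat_subproof k).

Fact padic_add_subproof x y n :
  ((x n + y n) %% p ^ n = ((x n.+1 + y n.+1) %% p ^ n.+1) %% p ^ n)%N.
Proof. by rewrite pmod_dvd // (pcoordP x) (pcoordP y) modnDm. Qed.
Definition padic_add x y : Zp := PadicInt (padic_add_subproof x y).

Fact padic_mul_subproof x y n :
  ((x n * y n) %% p ^ n = ((x n.+1 * y n.+1) %% p ^ n.+1) %% p ^ n)%N.
Proof. by rewrite pmod_dvd // (pcoordP x) (pcoordP y) modnMm. Qed.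
Definition padic_mul x y : Zp := PadicInt (padic_mul_subproof x y).

(* - x is computed as (p^n - 1) x in Z/p^n. *)
Fact padic_opp_subproof x n :
  (((p ^ n).-1 * x n) %% p ^ n
     = (((p ^ n.+1).-1 * x n.+1) %% p ^ n.+1) %% p ^ n)%N.
Proof.
have pX_gt0 m : (0 < p ^ m)%N by rewrite expn_gt0 prime_gt0 // prime_valP.
rewrite pmod_dvd // (pcoordP x) modnMmr; apply/eqP.
rewrite -(eqn_modDr (x n.+1)) !(addnC _ (x n.+1)) -!mulSn !prednK //.
by rewrite expnS -mulnA mulnCA !modnMr.
Qed.
Definition padic_opp x : Zp := PadicInt (padic_opp_subproof x).

Fact padic_addA : associative padic_add.
Proof.
by move=> x y z; apply: padic_int_eq => n /=; rewrite modnDml modnDmr addnA.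
Qed.

Fact padic_addC : commutative padic_add.
Proof. by move=> x y; apply: padic_int_eq => n /=; rewrite addnC. Qed.

Fact padic_add0 : left_id (padic_nat 0) padic_add.
Proof.
by move=> x; apply: padic_int_eq => n /=; rewrite mod0n add0n pcoord_mod.
Qed.

Fact padic_addN : left_inverse (padic_nat 0) padic_opp padic_add.
Proof.
move=> x; apply: padic_int_eq => n /=.
rewrite modnDml addnC -mulSn prednK ?expn_gt0 ?prime_gt0 ?prime_valP //.
by rewrite modnMr mod0n.
Qed.

HB.instance Definition _ :=
  GRing.isZmodule.Build Zp padic_addA padic_addC padic_add0 padic_addN.

Fact padic_mulA : associative padic_mul.
Proof.
by move=> x y z; apply: padic_int_eq => n /=; rewrite modnMml modnMmr mulnA.
Qed.

Fact padic_mulC : commutative padic_mul.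
Proof. by move=> x y; apply: padic_int_eq => n /=; rewrite mulnC. Qed.

Fact padic_mul1 : left_id (padic_nat 1) padic_mul.
Proof.
by move=> x; apply: padic_int_eq => n /=; rewrite modnMml mul1n pcoord_mod.
Qed.

Fact padic_mulDl : left_distributive padic_mul padic_add.
Proof.
by move=> x y z; apply: padic_int_eq => n /=; rewrite modnMml modnDm mulnDl.
Qed.

Fact padic_1neq0 : padic_nat 1 != padic_nat 0.
Proof.
apply/eqP => /(congr1 (fun x : Zp => x 1)) /=.
by rewrite mod0n modn_small // expn1 prime_gt1 // prime_valP.
Qed.

HB.instance Definition _ := GRing.Zmodule_isComNzRing.Build Zp
  padic_mulA padic_mulC padic_mul1 padic_mulDl padic_1neq0.

Definition padic_unit : {pred Zp} := fun x => `[< exists y, y * x = 1 >].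

Definition padic_inv x : Zp :=
  if pselect (exists y, y * x = 1) is left ex then sval (cid ex) else x.

Fact padic_mulVx : {in padic_unit, left_inverse 1 padic_inv *%R}.
Proof.
by move=> x /asboolP ex; rewrite /padic_inv; case: pselect => // ?; case: cid.
Qed.

Fact padic_unitPl x y : y * x = 1 -> padic_unit x.
Proof. by move=> yx1; apply/asboolP; exists y. Qed.

Fact padic_inv_out : {in [predC padic_unit], padic_inv =1 id}.
Proof.
by move=> x /asboolPn nex; rewrite /padic_inv; case: pselect.
Qed.

HB.instance Definition _ := GRing.ComNzRing_hasMulInverse.Build Zp
  padic_mulVx padic_unitPl padic_inv_out.

Lemma pcoord_neq0 x : x != 0 ->
  exists n, forall m, (n <= m)%N -> ~~ (p ^ n %| x m)%N.
Proof.
move=> x_neq0; have [n xn] : exists n, x n != 0%N.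
  apply/not_existsP => x0; case/eqP: x_neq0; apply: padic_int_eq => n /=.
  by rewrite mod0n; apply/eqP/negPn/negP/x0.
by exists n => m le_nm; rewrite /dvdn -pcoord_le.
Qed.

Fact padic_int_integral : GRing.integral_domain_axiom Zp.
Proof.
move=> x y xy0; apply/norP => -[/pcoord_neq0[m xm] /pcoord_neq0[n yn]].
have := congr1 (fun z : Zp => z (m + n)%N) xy0; rewrite /= mod0n => /eqP.
have {xm} := xm _ (leq_addr n m); have {yn} := yn _ (leq_addl m n).
set a := x _; set b := y _ => yn xm; have p_pr := prime_valP p.
have [a_gt0 b_gt0] : (0 < a)%N /\ (0 < b)%N.
  by rewrite !lt0n; split; [apply: contraNneq xm | apply: contraNneq yn] => ->.
move: xm yn; rewrite -[_ == _]/(_ %| _)%N !pfactor_dvdn ?muln_gt0 ?a_gt0 //.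
by rewrite lognM // -!ltnNge => lt_a lt_b; rewrite leqNgt -addnS leq_add // ltnW.
Qed.

HB.instance Definition _ :=
  GRing.ComUnitRing_isIntegral.Build Zp padic_int_integral.

Lemma pcoord_nat k n : (k%:R : Zp) n = (k %% p ^ n)%N.
Proof.
elim: k => [//|k IHk]; rewrite -addn1 natrD /= IHk.
by rewrite modnDm.
Qed.

Lemma padic_int_p_neq0 : (p : nat)%:R != 0 :> Zp.
Proof.
apply/eqP => /(congr1 (fun x : Zp => x 2)); rewrite pcoord_nat /= mod0n.
have p_gt1 := prime_gt1 (prime_valP p).
rewrite modn_small; last by rewrite -[X in (X < _)%N]expn1 ltn_exp2l.
by apply/eqP; rewrite -lt0n ltnW.
Qed.

Definition padic_eqmod x y : Prop := exists z, x - y = (p : nat)%:R * z.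

End PadicInt.

Notation padic p := {fraction (padic_int p)}.

(* x has p-adic valuation k; no k is related to x = 0. *)
Definition has_padic_val (p : prime_nat) (x : padic p) (k : int) : Prop :=
  exists2 e : padic_int p,
    e \is a GRing.unit & x = tofrac e * ((p : nat)%:R : padic p) ^ k.

Lemma padic_p_neq0 (p : prime_nat) : (p : nat)%:R != 0 :> padic p.
Proof. by rewrite -(rmorph_nat (@tofrac _)) tofrac_eq0 padic_int_p_neq0. Qed.

Definition central_division (K : fieldType) (D : falgType K) : Prop :=
  ('Z({:D}) = 1)%VS /\ forall x : D, x != 0 -> x \is a GRing.unit.

Definition algebra_norm (K : fieldType) (D : falgType K) (x : D) : K :=
  \det (passmx.mxof (vbasis {:D}) (vbasis {:D}) (amull x)).

(* D has dimension n^2, w generates an unramified subfield of degree n, and x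
   induces its Frobenius automorphism.  The invariant is the class modulo 1 of
   the valuation of x, where the valuation of D extending the normalized one of
   Q_p is v_p(N(x)) / n^2, N being the norm of the left regular
   representation. *)
Definition has_hasse_invariant (p : prime_nat) (D : falgType (padic p))
    (h : rat) : Prop :=
  exists (n : nat) (w x : D) (k : int),
    [/\ (0 < n)%N, \dim {:D} = (n ^ 2)%N,
        (p ^ n).-1.-primitive_root w,
        x \is a GRing.unit /\ x * w * x^-1 = w ^+ p &
        has_padic_val (algebra_norm x) k /\
          k%:~R / (n ^ 2)%:R - h \is a Num.int].

Record units (R : unitRingType) :=
  Units { unit_val : R; _ : unit_val \is a GRing.unit }.

Section Units.
Variable R : unitRingType.

HB.instance Definition _ := [isSub for @unit_val R].
HB.instance Definition _ := [Choice of units R by <:].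

Lemma unit_valP (x : units R) : unit_val x \is a GRing.unit.
Proof. exact: (valP x). Qed.

Fact units_mul_subproof (x y : units R) : unit_val x * unit_val y \is a GRing.unit.
Proof. by rewrite unitrMl unit_valP. Qed.
Definition units_mul x y : units R := Units (units_mul_subproof x y).

Definition units_one : units R := Units (unitr1 R).

Fact units_inv_subproof (x : units R) : (unit_val x)^-1 \is a GRing.unit.
Proof. by rewrite unitrV unit_valP. Qed.
Definition units_inv x : units R := Units (units_inv_subproof x).

Fact units_mulA : associative units_mul.
Proof. by move=> x y z; apply: val_inj; rewrite /= mulrA. Qed.

Fact units_mul1 : left_id units_one units_mul.
Proof. by move=> x; apply: val_inj; rewrite /= mul1r. Qed.

Fact units_mulr1 : right_id units_one units_mul.
Proof. by move=> x; apply: val_inj; rewrite /= mulr1. Qed.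

Fact units_mulV : left_inverse units_one units_inv units_mul.
Proof. by move=> x; apply: val_inj; rewrite /= mulVr // unit_valP. Qed.

Fact units_mulrV : right_inverse units_one units_inv units_mul.
Proof. by move=> x; apply: val_inj; rewrite /= divrr // unit_valP. Qed.

HB.instance Definition _ := isGroup.Build (units R)
  units_mulA units_mul1 units_mulr1 units_mulV units_mulrV.

End Units.

Local Open Scope group_scope.

Definition is_subgroup (G : groupType) (H : set G) : Prop :=
  [/\ H 1, forall x y, H x -> H y -> H (x * y) & forall x, H x -> H x^-1].

Record normal_subgroup (G : groupType) := NormalSubgroup {
  nsub : set G;
  nsub_subgroup : is_subgroup nsub;
  nsub_normal : forall x g, nsub x -> nsub (x ^ g) }.

Section Quotient.
Variables (G : groupType) (N : normal_subgroup G).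
Implicit Types x y z : G.

Definition coset_eq : rel G := fun x y => `[< nsub N (x^-1 * y) >].

Fact coset_eq_refl : reflexive coset_eq.
Proof.
by move=> x; apply/asboolP; rewrite mulVg; case: (nsub_subgroup N).
Qed.

Fact coset_eq_sym : symmetric coset_eq.
Proof.
have [_ _ NV] := nsub_subgroup N.
by move=> x y; apply/asboolP/asboolP => /NV; rewrite invgM invgK.
Qed.

Fact coset_eq_trans : transitive coset_eq.
Proof.
have [_ NM _] := nsub_subgroup N.
move=> y x z /asboolP Nxy /asboolP Nyz; apply/asboolP.
by have := NM _ _ Nxy Nyz; rewrite mulgA mulgK.
Qed.

Definition coset_equiv :=
  EquivRel coset_eq coset_eq_refl coset_eq_sym coset_eq_trans.
Canonical coset_equiv.

Definition quotient_group := {eq_quot coset_equiv}%qT.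
HB.instance Definition _ := Choice.on quotient_group.
HB.instance Definition _ := Quotient.on quotient_group.

Definition quot_pi x : quotient_group := (\pi_quotient_group x)%qT.

Lemma quot_piP x y : quot_pi x = quot_pi y <-> nsub N (x^-1 * y).
Proof.
by split => [/eqmodP/asboolP // | Nxy]; apply/eqmodP/asboolP.
Qed.

(* fingroup shadows the repr of generic_quotient. *)
Definition qrepr (a : quotient_group) : G := generic_quotient.repr a.

Definition quot_mul (a b : quotient_group) := quot_pi (qrepr a * qrepr b).
Definition quot_inv (a : quotient_group) := quot_pi (qrepr a)^-1.

Lemma quot_reprK (a : quotient_group) : quot_pi (qrepr a) = a.
Proof. exact: reprK. Qed.

Lemma quot_repr_pi x : nsub N (x^-1 * qrepr (quot_pi x)).
Proof. by apply/quot_piP; rewrite quot_reprK. Qed.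

Lemma quot_mul_pi x y : quot_mul (quot_pi x) (quot_pi y) = quot_pi (x * y).
Proof.
have [_ NM _] := nsub_subgroup N; apply/esym/quot_piP.
have := NM _ _ (nsub_normal y (quot_repr_pi x)) (quot_repr_pi y).
by rewrite conjgE invgM !mulgA mulgK.
Qed.

Fact quot_mulA : associative quot_mul.
Proof.
move=> a b c; rewrite -(quot_reprK a) -(quot_reprK b) -(quot_reprK c).
by rewrite !quot_mul_pi mulgA.
Qed.

Fact quot_mul1 : left_id (quot_pi 1) quot_mul.
Proof. by move=> a; rewrite -(quot_reprK a) quot_mul_pi mul1g. Qed.

Fact quot_mulg1 : right_id (quot_pi 1) quot_mul.
Proof. by move=> a; rewrite -(quot_reprK a) quot_mul_pi mulg1. Qed.

Fact quot_mulV : left_inverse (quot_pi 1) quot_inv quot_mul.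
Proof. by move=> a; rewrite -{2}(quot_reprK a) quot_mul_pi mulVg. Qed.

Fact quot_mulgV : right_inverse (quot_pi 1) quot_inv quot_mul.
Proof. by move=> a; rewrite -{1}(quot_reprK a) quot_mul_pi mulgV. Qed.

HB.instance Definition _ := isGroup.Build quotient_group
  quot_mulA quot_mul1 quot_mulg1 quot_mulV quot_mulgV.

End Quotient.

Section CentralCycle.
Variables (G : groupType) (c : G).
Hypothesis c_central : forall x, commute x c.

Definition cyclic_set : set G :=
  [set x | exists n : nat, x = c ^+ n \/ x = c ^- n]%classic.

Fact cyclic_set_subgroup : is_subgroup cyclic_set.
Proof.
have cB m n : cyclic_set (c ^+ m * c ^- n).
  have [le_nm|/ltnW le_mn] := leqP n m.
    by exists (m - n)%N; left; rewrite -{1}(subnK le_nm) expgnDr mulgK.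
  exists (n - m)%N; right.
  by rewrite -{1}(subnK le_mn) expgnDr invgM mulgA mulgV mul1g.
have cC m n : c ^- n * c ^+ m = c ^+ m * c ^- n.
  by apply: (mulgI (c ^+ n)); rewrite mulgA mulgV mul1g mulgA -expgnDr addnC expgnDr mulgK.
split; first by exists 0; left.
  move=> _ _ [m [] ->] [n [] ->].
  - by exists (m + n)%N; left; rewrite expgnDr.
  - exact: cB.
  - by rewrite cC; exact: cB.
  - by exists (n + m)%N; right; rewrite expgnDr invgM.
by move=> _ [n [] ->]; exists n; [right | left; rewrite invgK].
Qed.

Fact cyclic_set_normal x g : cyclic_set x -> cyclic_set (x ^ g).
Proof.
have cX n : (c ^+ n) ^ g = c ^+ n.
  by rewrite conjXg conjgE -c_central mulgA mulVg mul1g.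
by move=> [n [] ->]; exists n; [left | right]; rewrite ?conjVg cX.
Qed.

Definition central_cycle : normal_subgroup G :=
  NormalSubgroup cyclic_set_subgroup cyclic_set_normal.

End CentralCycle.

Section UnitsModPU.
Variables (p : prime_nat) (D : falgType (padic p)) (u : units (padic_int p)).

Definition pu_scalar : padic p := tofrac ((p : nat)%:R * unit_val u)%R.

Fact pu_subproof : (pu_scalar%:A : D) \is a GRing.unit.
Proof.
rewrite scaler_unit ?unitr1 // unitfE tofrac_eq0 mulf_neq0 ?padic_int_p_neq0 //.
by apply: contraTneq (unit_valP u) => ->; rewrite unitr0.
Qed.
Definition pu : units D := Units pu_subproof.

Fact pu_central x : commute x pu.
Proof. by apply: val_inj; rewrite /= mulr_algl mulr_algr. Qed.

Definition units_mod_pu : groupType :=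
  quotient_group (central_cycle pu_central).

End UnitsModPU.

Section FiniteSubgroups.
Variable G : groupType.
Implicit Types F H : set G.

Definition finite_subgroup F : Prop := is_subgroup F /\ finite_set F.

Definition maximal_finite_subgroup F : Prop :=
  finite_subgroup F /\
  forall H, finite_subgroup H -> (F `<=` H)%classic -> H = F.

Definition conjugate_subgroups F H : Prop :=
  exists g, H = [set x ^ g | x in F]%classic.

Definition isomorphic_to (gT : finGroupType) F : Prop :=
  exists f : gT -> G,
    [/\ {morph f : x y / x * y}, injective f & range f = F].

(* The complement is required to act non-trivially, since the group would
   otherwise be written as a direct product. *)
Definition isomorphic_to_C3_sdprod (hT : finGroupType) F : Prop :=
  exists (gT : finGroupType) (K H : {group gT}),
    [/\ K ><| H = [set: gT],
        K \isog [set: 'Z_3], H \isog [set: hT], ~~ (H \subset 'C(K)) &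
        isomorphic_to gT F].

End FiniteSubgroups.

(* Exactly two conjugacy classes of maximal finite subgroups, with one
   representative satisfying P and the other one satisfying Q. *)
Definition max_finite_classes (G : groupType) (P Q : set G -> Prop) : Prop :=
  exists F1 F2 : set G,
    [/\ maximal_finite_subgroup F1 /\ maximal_finite_subgroup F2,
        P F1, Q F2, ~ conjugate_subgroups F1 F2 &
        forall F, maximal_finite_subgroup F ->
          conjugate_subgroups F1 F \/ conjugate_subgroups F2 F].

(* Main.v *)
Require Import Defs.
From HB Require Import structures.
From mathcomp Require Import all_boot all_order all_algebra.
From mathcomp Require Import all_fingroup all_solvable all_field.
From mathcomp Require Import boolp classical_sets cardinality.
From mathcomp Require Import zify ring.

Set Implicit Arguments.
Unset Strict Implicit.
Unset Printing Implicit Defensive.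

Import Order.TTheory GRing.Theory Num.Theory.
Local Open Scope ring_scope.

(** The invariant is given through a cyclic presentation of unspecified degree $n$, so $D$ has to be
    recognised as a quaternion algebra. The invariant forces $n=2m$. If $m>1$, then [w] and $y^2/3$,
    for a suitable scalar multiple [y] of the given element [x], present a cyclic algebra whose
    structure constant is a unit; modulo 3 it is a matrix algebra, whose rank-one idempotent lifts
    to $D$ ([idempotent_mod_p]). That is absurd in a division ring ([no_split]), so $n=2$
    ([cyclic_degree_two]). As units of $\mathbb{Z}_3$ are sums of two squares, $D$ has a basis
    $1,i,S,iS$ with $i^2=-1$, $Si=-iS$ and $S^2=s=-3c^2$ for any prescribed unit $c$
    ([quaternion_frame_exists]). Taking $c^2=\pm u$ makes $\kappa=3u$ equal to $-s$ or $s$.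

    Let $\mathcal{O}$ be the $\mathbb{Z}_3$-span of this basis and $\mathfrak{m}=\mathcal{O}S$. Then
    $\mathcal{O}/\mathfrak{m}=\mathbb{F}_9$ and $\mathfrak{m}^2=3\mathcal{O}$; the group
    $1+3\mathcal{O}$ is torsion-free, and a torsion element of $1+\mathfrak{m}$ has cube 1. A finite
    subgroup of the quotient lifts to a subgroup of $D^\times$ that contains $\kappa$ and is torsion
    modulo $\kappa$ ([saturated]); each of its elements is a power of $\kappa$ times either a unit
    of $\mathcal{O}$ or a unit times $S$ ([order_unit_rep]).

    If the lift has no element of order 3, its units have exponent 8 and commute. Skolem-Noether and
    Hilbert 90 for $\mathbb{Q}_3(i)$ conjugate the lift into the group generated by $\kappa$,
    $w=(1+i)/\sqrt{-2}$ and $S$ ([sd16_case]). Otherwise an element of order 3 is conjugate to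
    $\zeta=(-1+S/c)/2$. A trace argument shows that $\zeta$ and $\zeta^2$ are then the only elements
    of order 3 ([sat_cube_root]), so every element commutes or anticommutes with $S$, and Hilbert 90
    for $\mathbb{Q}_3(S)$ conjugates the lift into the group generated by $\kappa$, $\zeta$, $i$ and
    $S$ ([ramified_case]).

    In the quotient the first group becomes $SD_{16}$. In the second, of order 24, $i$ inverts
    $\zeta$ while $S$ centralises it, and the class of $S^2$ is that of $-1=i^2$ when $\kappa=-s$
    (complement $Q_8$) and trivial when $\kappa=s$ (complement $D_8$). Neither 16 nor 24 divides the
    other, so both groups are maximal, they are not conjugate, and no further class occurs
    ([max_finite_classes_of_cover]). *)

Section FiniteGroups.
Local Open Scope group_scope.

(** * Finite subgroups of an arbitrary group as finite group types *)

Section FiniteSubgroupType.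
Variables (G : groupType) (F : set G).
Hypothesis FP : finite_subgroup F.

Let enumF : seq G := sval (cid ((finite_seqP F).1 FP.2)).
Let mem_enumF x : (x \in enumF) <-> F x.
Proof.
have E : F = [set` enumF]%classic := svalP (cid ((finite_seqP F).1 FP.2)).
have Ex : F x = [set` enumF]%classic x by rewrite -E.
by rewrite Ex.
Qed.

Definition fsub_type : Type := seq_sub enumF.
HB.instance Definition _ := Finite.on fsub_type.

Fact fsub_one_subproof : 1 \in enumF.
Proof. by apply/mem_enumF; case: FP => -[]. Qed.
Fact fsub_mul_subproof (x y : fsub_type) : ssval x * ssval y \in enumF.
Proof. by apply/mem_enumF; case: FP => -[_ FM _] _; apply: FM; apply/mem_enumF/ssvalP. Qed.
Fact fsub_inv_subproof (x : fsub_type) : (ssval x)^-1 \in enumF.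
Proof. by apply/mem_enumF; case: FP => -[_ _ FV] _; apply: FV; apply/mem_enumF/ssvalP. Qed.

Definition fsub_one : fsub_type := SeqSub fsub_one_subproof.
Definition fsub_mul x y : fsub_type := SeqSub (fsub_mul_subproof x y).
Definition fsub_inv x : fsub_type := SeqSub (fsub_inv_subproof x).

Fact fsub_mulA : associative fsub_mul.
Proof. by move=> x y z; apply: val_inj; exact: mulgA. Qed.
Fact fsub_mul1 : left_id fsub_one fsub_mul.
Proof. by move=> x; apply: val_inj; exact: mul1g. Qed.
Fact fsub_mulV : left_inverse fsub_one fsub_inv fsub_mul.
Proof. by move=> x; apply: val_inj; exact: mulVg. Qed.

HB.instance Definition _ := Finite_isGroup.Build fsub_type fsub_mulA fsub_mul1 fsub_mulV.

(** Carrying the group law over to a [finGroupType] makes presentations and Lagrange's theorem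
    available for subgroups of an infinite group. *)
Lemma finite_subgroup_fingroup : exists gT : finGroupType, isomorphic_to gT F.
Proof.
exists fsub_type, (fun x : fsub_type => ssval x); split=> //; first exact: val_inj.
apply/seteqP; split=> [_ [x _ <-]|x Fx]; first exact/mem_enumF/ssvalP.
by exists (SeqSub ((mem_enumF x).2 Fx)).
Qed.

End FiniteSubgroupType.

Section GroupMorphisms.
Variables (gT : finGroupType) (G : groupType) (f : gT -> G).
Hypothesis fM : {morph f : x y / x * y}.

Lemma gmorph1 : f 1 = 1.
Proof. by apply: (mulgI (f 1)); rewrite -fM !mulg1. Qed.

Lemma gmorphX x n : f (x ^+ n) = f x ^+ n.
Proof. by elim: n => [|n IHn]; rewrite ?expg0 ?gmorph1 // !expgS fM IHn. Qed.

Lemma gmorphV x : f x^-1 = (f x)^-1.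
Proof. by apply: (mulgI (f x)); rewrite -fM !mulgV gmorph1. Qed.

End GroupMorphisms.

Lemma isomorphic_to_isog (gT hT : finGroupType) (G : groupType) (F : set G) :
  [set: hT] \isog [set: gT] -> isomorphic_to gT F -> isomorphic_to hT F.
Proof.
case/isogP => h hI hT_im [f [fM fI fF]]; exists (f \o h); split.
- by move=> x y /=; rewrite morphM ?inE // fM.
- by move=> x y /fI; apply: (injmP hI); rewrite inE.
rewrite -fF; apply/seteqP; split=> [_ [x _ <-]|_ [x _ <-]]; first by exists (h x).
have : x \in h @* [set: hT] by rewrite hT_im inE.
by case/morphimP => y _ _ ->; exists y.
Qed.

(** * Recognition of $SD_{16}$, $D_8$, $Q_8$ and of semidirect products by relations *)

Section TwoGenerators.
Variables (gT : finGroupType) (x y : gT).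
Let H := <[x]> <*> <[y]>.

(** Since [y] does not centralise [x], it lies outside $\langle x\rangle$, which is thus a proper
    subgroup, of index at least 2. This lower bound makes the presentations below faithful. *)
Lemma card_two_generators : x ^ y != x -> (2 * #[x] <= #|H|)%N.
Proof.
move=> xy; have xH : <[x]> \proper H.
  rewrite properE joing_subl /=; apply: contra xy => Hx.
  have : y \in <[x]> by apply: (fintype.subsetP Hx); rewrite mem_gen // inE cycle_id orbT.
  by case/cycleP => k ->; rewrite conjgE commuteX // mulKg.
have /dvdnP[k kE] := cardSg (proper_sub xH).
have := proper_card xH; rewrite /H kE -orderE; have := order_gt0 x.
by case: k {kE} => [|[|k]] // _; rewrite ?mul0n ?mul1n ?ltnn // leq_mul2r orbT.
Qed.

Lemma order_prime_power n : x ^+ (2 ^ n.+1) = 1 -> x ^+ (2 ^ n) != 1 -> #[x] = (2 ^ n.+1)%N.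
Proof.
move=> x1 x0; have : (#[x] %| 2 ^ n.+1)%N by rewrite order_dvdn x1.
case/(dvdn_pfactor _ _ (isT : prime 2)) => m; rewrite leq_eqVlt => /orP[/eqP -> //|mn xm].
by case/eqP: x0; apply/eqP; rewrite -order_dvdn xm dvdn_exp2l.
Qed.

(** The relations make [H] a quotient of ['SD_16], and its at least $2\cdot 8$ elements leave no
    room for a kernel. The dihedral and quaternion cases follow the same pattern. *)
Lemma semidihedral16_isog : x ^+ 8 = 1 -> x ^+ 4 != 1 -> y ^+ 2 = 1 -> x ^ y = x ^+ 3 ->
  H \isog [set: 'SD_16].
Proof.
move=> x8 x4 y2 xy; have ox : #[x] = 8 by apply: (@order_prime_power 2).
have H16 : (16 <= #|H|)%N.
  have := card_two_generators; rewrite ox; apply.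
  rewrite xy; apply: contra x4 => /eqP; rewrite expgS => /(canRL (mulKg _)).
  by rewrite mulVg => x2; rewrite (expgM x 2 2) x2 expg1n.
have /= SDc := @card_semidihedral 4 isT; have /= SDg := @Grp_semidihedral 4 isT.
rewrite isogEcard (_ : #|_| = 16) // H16 andbT.
rewrite (SDg _ H); apply/existsP; exists (x, y) => /=.
by rewrite x8 y2 xy !eqxx.
Qed.

Lemma dihedral8_isog : x ^+ 4 = 1 -> x ^+ 2 != 1 -> y ^+ 2 = 1 -> x ^ y = x^-1 ->
  H \isog [set: 'D_8].
Proof.
move=> x4 x2 y2 xy; have ox : #[x] = 4 by apply: (@order_prime_power 1).
have H8 : (8 <= #|H|)%N.
  have := card_two_generators; rewrite ox; apply.
  by rewrite xy; apply: contra x2 => /eqP xV; rewrite expgS expg1 -{1}xV mulVg.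
rewrite isogEcard (_ : #|_| = 8) ?H8 ?andbT; last exact: (@card_2dihedral 3).
rewrite (@Grp_2dihedral 3 isT _ H); apply/existsP; exists (x, y) => /=.
by rewrite x4 y2 xy !eqxx.
Qed.

Lemma quaternion8_isog : x ^+ 4 = 1 -> x ^+ 2 != 1 -> y ^+ 2 = x ^+ 2 -> x ^ y = x^-1 ->
  H \isog [set: 'Q_8].
Proof.
move=> x4 x2 y2 xy; have ox : #[x] = 4 by apply: (@order_prime_power 1).
have H8 : (8 <= #|H|)%N.
  have := card_two_generators; rewrite ox; apply.
  by rewrite xy; apply: contra x2 => /eqP xV; rewrite expgS expg1 -{1}xV mulVg.
rewrite isogEcard (_ : #|_| = 8) ?H8 ?andbT; last exact: (@card_quaternion 3).
rewrite (@Grp_quaternion 3 isT _ H); apply/existsP; exists (x, y) => /=.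
by rewrite x4 y2 xy !eqxx.
Qed.

End TwoGenerators.

(** $\langle z\rangle$ is normalised because [x] inverts [z] and [y] centralises it, and it meets
    [H] trivially because 3 and 8 are coprime. The action is nontrivial because $z^2\neq z$. *)
Lemma C3_sdprod (gT : finGroupType) (z x y : gT) (H : {group gT}) :
    H :=: <[x]> <*> <[y]> -> #|H| = 8 ->
    z ^+ 3 = 1 -> z != 1 -> x * z = z ^+ 2 * x -> commute y z ->
    (forall t, exists k l e, t = z ^+ k * x ^+ l * y ^+ e) ->
  exists K : {group gT}, [/\ K ><| H = [set: gT], K \isog [set: 'Z_3],
    ~~ (H \subset 'C(K)) & #|gT| = 24].
Proof.
move=> HE H8 z3 z1 xz yz gen; have oz : #[z] = 3.
  have : (#[z] %| 3)%N by rewrite order_dvdn z3.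
  by case/primeP: (isT : prime 3) => _ pr /pr; rewrite order_eq1 (negPf z1) => /eqP.
have zz : z ^+ 2 != z by apply: contra z1 => /eqP E; rewrite -(mulKg z z) -expg2 E mulVg.
have Hz : H \subset 'N(<[z]>).
  rewrite HE join_subG !cycle_subG; apply/andP; split; last first.
    by rewrite (fintype.subsetP (cent_sub _)) // cent_cycle; apply/cent1P.
  by rewrite -cycle_subG -cycleV norms_cycle conjgE invgK mulgA xz mulgK mem_cycle.
have tiKH : <[z]> :&: H = 1 by apply: coprime_TIg; rewrite -orderE oz H8.
have xH : x \in H by rewrite HE mem_gen // inE cycle_id.
have yH : y \in H by rewrite HE mem_gen // inE cycle_id orbT.
have KH : <[z]> ><| H = [set: gT].
  rewrite sdprodE //; apply/eqP; rewrite finset.eqEsubset finset.subsetT; apply/fintype.subsetP => t _.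
  have [k [l [e ->]]] := gen t; rewrite -mulgA; apply: mem_mulg; first exact: mem_cycle.
  by rewrite groupM // groupX.
exists <[z]>%G; split=> //.
- rewrite isog_cyclic_card ?cycle_cyclic // cardsT card_ord -orderE oz andbT.
  by apply/cyclicP; exists Zp1; exact: Zp_cycle.
- apply: contra zz => /fintype.subsetP/(_ x xH)/centP/(_ z (cycle_id z)).
  by rewrite /commute xz => /(mulIg _) ->.
by rewrite -cardsT -(sdprod_card KH) -orderE oz H8.
Qed.

(** * Inclusion, conjugacy and maximality of finite subgroups *)

Section FiniteSubgroups.
Variable G : groupType.
Implicit Types (F H A B : set G) (g : G).

(** By the pigeonhole principle two powers of [x] coincide, so that the inverse of [x] is itself a
    power of [x]. *)
Lemma finite_submonoid_subgroup F : finite_set F -> F 1 ->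
  (forall x y, F x -> F y -> F (x * y)) -> is_subgroup F.
Proof.
move=> /finite_seqP[s sE] F1 FM; split=> // x Fx.
have Fs y : F y <-> y \in s by rewrite sE.
have FX n : F (x ^+ n) by elim: n => [|n IHn]; rewrite ?expg0 // expgS; exact: FM.
have /(uniqPn 1)[k [l [lt_kl lt_l eq_kl]]] : ~~ uniq [seq x ^+ k | k <- iota 0 (size s).+1].
  apply/negP => /uniq_leq_size => /(_ s); rewrite size_map size_iota ltnn => H.
  by suff: false by []; apply: H => y /mapP[k _ ->]; exact/Fs.
move: lt_l eq_kl; rewrite size_map size_iota => lt_l.
rewrite !(nth_map 0%N) ?size_iota ?nth_iota ?(ltn_trans lt_kl) // !add0n => eq_kl.
suff -> : x^-1 = x ^+ (l - k).-1 by [].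
apply: (mulgI (x ^+ k.+1)); rewrite -expgnDr expgSr mulgK eq_kl; congr (x ^+ _).
lia.
Qed.

Lemma isomorphic_to_finite (gT : finGroupType) F : isomorphic_to gT F -> finite_subgroup F.
Proof.
case=> f [fM fI <-]; have fin : finite_set (range f) by apply/finite_image/finite_finset.
split=> //; apply: finite_submonoid_subgroup => //; first by exists 1; rewrite ?(gmorph1 fM).
by move=> _ _ [x _ <-] [y _ <-]; exists (x * y).
Qed.

Definition conj_set F g : set G := [set x ^ g | x in F]%classic.

Lemma isomorphic_to_conj (gT : finGroupType) F g :
  isomorphic_to gT F -> isomorphic_to gT (conj_set F g).
Proof.
case=> f [fM fI <-]; exists (fun x => f x ^ g); split.
- by move=> x y; rewrite fM conjMg.
- by move=> x y /conjg_inj/fI.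
by apply/seteqP; split=> [_ [x _ <-]|_ [_ [x _ <-] <-]]; [exists (f x) => //; exists x | exists x].
Qed.

Lemma isomorphic_to_sub (gT hT : finGroupType) A B :
  isomorphic_to gT A -> isomorphic_to hT B -> (A `<=` B)%classic ->
  (#|gT| %| #|hT|)%N /\ (#|hT| = #|gT| -> A = B).
Proof.
case=> f [fM fI <-] [h [hM hI <-]] AB.
have preim x : exists y, h y = f x.
  by have [|y _ yE] := AB (f x); [exists x | exists y].
pose phi x := sval (cid (preim x)); have phiE x : h (phi x) = f x := svalP (cid (preim x)).
have phiM : {in [set: gT] &, {morph phi : x y / x * y}}.
  by move=> x y _ _; apply: hI; rewrite hM !phiE fM.
have phiI : injective phi by move=> x y /(congr1 h); rewrite !phiE => /fI.
have card_im : #|Morphism phiM @* [set: gT]| = #|gT|.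
  by rewrite card_injm ?cardsT //; apply/injmP => x y _ _; exact: phiI.
split; first by rewrite -card_im -(cardsT hT); apply: cardSg; exact: finset.subsetT.
move=> card_eq; apply/seteqP; split=> // _ [y _ <-].
have : y \in Morphism phiM @* [set: gT].
  suff -> : Morphism phiM @* [set: gT] = [set: hT] by rewrite inE.
  by apply/eqP; rewrite eqEcard finset.subsetT card_im cardsT card_eq leqnn.
by case/morphimP => x _ _ /= ->; exists x => //; rewrite phiE.
Qed.

(** A finite $H\supseteq A$ lies in a conjugate of [A] or of [B]. The second would make the order of
    [A] divide that of [B]; in the first the orders agree, so $H=A$. Hence [A] is maximal, likewise
    [B], and a maximal subgroup equals the conjugate that covers it. *)
Lemma max_finite_classes_of_cover (gT hT : finGroupType) (P Q : set G -> Prop) A B :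
    isomorphic_to gT A -> isomorphic_to hT B -> P A -> Q B ->
    ~~ (#|gT| %| #|hT|)%N -> ~~ (#|hT| %| #|gT|)%N ->
    (forall F, finite_subgroup F ->
       exists g, (F `<=` conj_set A g)%classic \/ (F `<=` conj_set B g)%classic) ->
  max_finite_classes P Q.
Proof.
move=> isoA isoB PA QB ndvdAB ndvdBA cover.
exists A, B; split=> //.
- split; split; [exact: isomorphic_to_finite isoA| |exact: isomorphic_to_finite isoB|].
  + move=> H finH AH; have [kT isoH] := finite_subgroup_fingroup finH.
    have [dvdA eqA] := isomorphic_to_sub isoA isoH AH.
    have [g [HA|HB]] := cover H finH.
      have [dvdH _] := isomorphic_to_sub isoH (isomorphic_to_conj g isoA) HA.
      by apply/esym/eqA/eqP; rewrite eqn_dvd dvdH dvdA.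
    have [dvdH _] := isomorphic_to_sub isoH (isomorphic_to_conj g isoB) HB.
    by case/negP: ndvdAB; exact: dvdn_trans dvdA dvdH.
  + move=> H finH BH; have [kT isoH] := finite_subgroup_fingroup finH.
    have [dvdB eqB] := isomorphic_to_sub isoB isoH BH.
    have [g [HA|HB]] := cover H finH.
      have [dvdH _] := isomorphic_to_sub isoH (isomorphic_to_conj g isoA) HA.
      by case/negP: ndvdBA; exact: dvdn_trans dvdB dvdH.
    have [dvdH _] := isomorphic_to_sub isoH (isomorphic_to_conj g isoB) HB.
    by apply/esym/eqB/eqP; rewrite eqn_dvd dvdH dvdB.
- case=> g BE; have [|dvdAB _] := isomorphic_to_sub (isomorphic_to_conj g isoA) isoB.
    by rewrite BE.
  by rewrite dvdAB in ndvdAB.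
move=> F [finF maxF]; have [g [FA|FB]] := cover F finF; [left|right]; exists g; apply/esym.
  by apply: maxF => //; exact: isomorphic_to_finite (isomorphic_to_conj g isoA).
by apply: maxF => //; exact: isomorphic_to_finite (isomorphic_to_conj g isoB).
Qed.

End FiniteSubgroups.

(** * Subgroups described by normal forms of words *)

Section Generators.
Variable G : groupType.
Implicit Types (X Y Z I T : G).

Lemma expg_modn X n k : X ^+ n = 1 -> X ^+ (k %% n) = X ^+ k.
Proof.
by move=> Xn; rewrite [in RHS](divn_eq k n) expgnDr mulnC expgM Xn expg1n mul1g.
Qed.

Lemma expg_swap X Y r e l : Y * X = X ^+ r * Y -> Y ^+ e * X ^+ l = X ^+ (r ^ e * l) * Y ^+ e.
Proof.
move=> YX; have YXl m : Y * X ^+ m = X ^+ (r * m) * Y.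
  elim: m => [|m IHm]; first by rewrite muln0 !expg0 mulg1 mul1g.
  by rewrite expgS mulgA YX -mulgA IHm mulgA -expgnDr mulnS.
elim: e l => [|e IHe] l; first by rewrite expn0 mul1n !expg0 mulg1 mul1g.
by rewrite expgSr -mulgA YXl mulgA IHe -mulgA -expgSr expnSr mulnA.
Qed.

Definition words2 X Y : set G := [set a | exists k l, a = X ^+ k * Y ^+ l]%classic.
Definition words3 Z X Y : set G := [set a | exists j k l, a = Z ^+ j * X ^+ k * Y ^+ l]%classic.

Lemma words3_finite Z X Y m n p : (0 < m)%N -> (0 < n)%N -> (0 < p)%N ->
  Z ^+ m = 1 -> X ^+ n = 1 -> Y ^+ p = 1 -> finite_set (words3 Z X Y).
Proof.
move=> m0 n0 p0 Zm Xn Yp.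
pose f (t : 'I_m * 'I_n * 'I_p) := Z ^+ t.1.1 * X ^+ t.1.2 * Y ^+ t.2.
suff -> : words3 Z X Y = range f by apply/finite_image/finite_finset.
apply/seteqP; split=> [_ [j [k [l ->]]]|_ [t _ <-]]; last by exists t.1.1, t.1.2, t.2.
exists (Ordinal (ltn_pmod j m0), Ordinal (ltn_pmod k n0), Ordinal (ltn_pmod l p0)) => //.
by rewrite /f /= !expg_modn.
Qed.

Lemma words2E X Y : words2 X Y = words3 1 X Y.
Proof.
apply/seteqP; split=> [_ [k [l ->]]|_ [j [k [l ->]]]].
  by exists 0, k, l; rewrite mul1g.
by exists k, l; rewrite expg1n mul1g.
Qed.

(** The relation $YX=X^3Y$ brings any product of words back to normal form, so the words form a
    finite submonoid, hence a subgroup generated by [X] and [Y]. *)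
Lemma semidihedral16_subgroup X Y : X ^+ 8 = 1 -> X ^+ 4 <> 1 -> Y ^+ 2 = 1 ->
  Y * X = X ^+ 3 * Y -> isomorphic_to (semidihedral_gtype 16) (words2 X Y).
Proof.
move=> X8 X4 Y2 YX; have fin : finite_set (words2 X Y).
  by rewrite words2E; apply: (@words3_finite _ _ _ 1%N 8 2).
have WX : words2 X Y X by exists 1%N, 0; rewrite mulg1.
have WY : words2 X Y Y by exists 0, 1%N; rewrite mul1g.
have [|gT isoW] := @finite_subgroup_fingroup G (words2 X Y).
  split=> //; apply: finite_submonoid_subgroup => //; first by exists 0, 0; rewrite mulg1.
  move=> _ _ [k [l ->]] [k' [l' ->]]; exists (k + 3 ^ l * k')%N, (l + l')%N.
  by rewrite mulgA -(mulgA (X ^+ k)) (expg_swap _ _ YX) mulgA -expgnDr -mulgA -expgnDr.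
apply: (isomorphic_to_isog _ isoW); case: isoW => f [fM fI fW].
have [x _ fx] : range f X by rewrite fW.
have [y _ fy] : range f Y by rewrite fW.
have genT : <[x]> <*> <[y]> = [set: gT].
  apply/eqP; rewrite finset.eqEsubset finset.subsetT; apply/fintype.subsetP => t _.
  have [k [l]] : words2 X Y (f t) by rewrite -fW; exists t.
  rewrite -fx -fy -!(gmorphX fM) -fM => /fI ->.
  by rewrite groupM // groupX // mem_gen // inE cycle_id ?orbT.
suff: <[x]> <*> <[y]> \isog [set: 'SD_16] by rewrite genT isog_sym.
have fE := (gmorphX fM, gmorph1 fM, fM, fx, fy).
have y2 : y ^+ 2 = 1 by apply: fI; rewrite !fE.
have x8 : x ^+ 8 = 1 by apply: fI; rewrite !fE.
apply: semidihedral16_isog => //.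
  by apply/eqP => /(congr1 f); rewrite !fE.
apply: (mulgI y); rewrite mulKVg; apply: fI; rewrite !fE.
by have := expg_swap 1 3 YX; rewrite expg1 => ->; rewrite -(expg_modn (3 ^ 1 * 3) X8).
Qed.

(** The exponent [b] treats both complements at once: $Y^2=X^{2b}$ is the quaternion relation for
    $b=1$ and the dihedral one for $b=0$. *)
Lemma C3_sdprod_subgroup (hT : finGroupType) Z X Y b :
    (forall (gT : finGroupType) (x y : gT), x ^+ 4 = 1 -> x ^+ 2 != 1 ->
       y ^+ 2 = x ^+ (2 * b) -> x ^ y = x^-1 -> <[x]> <*> <[y]> \isog [set: hT]) ->
    #|hT| = 8 -> Z ^+ 3 = 1 -> Z <> 1 -> X ^+ 4 = 1 -> X ^+ 2 <> 1 -> Y ^+ 2 = X ^+ (2 * b) ->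
    X * Z = Z ^+ 2 * X -> Y * X = X ^+ 3 * Y -> commute Y Z ->
  isomorphic_to_C3_sdprod hT (words3 Z X Y) /\
  exists2 gT : finGroupType, #|gT| = 24 & isomorphic_to gT (words3 Z X Y).
Proof.
move=> H_isog hT8 Z3 Z1 X4 X2 Y2 XZ YX YZ; have Y4 : Y ^+ 4 = 1.
  by rewrite (expgM Y 2 2) Y2 -expgM (_ : 2 * b * 2 = 4 * b)%N ?expgM ?X4 ?expg1n; last by lia.
have fin : finite_set (words3 Z X Y) by apply: (@words3_finite _ _ _ 3 4 4).
have WZ : words3 Z X Y Z by exists 1%N, 0, 0; rewrite !mulg1.
have WX : words3 Z X Y X by exists 0, 1%N, 0; rewrite mulg1 mul1g.
have WY : words3 Z X Y Y by exists 0, 0, 1%N; rewrite !mul1g.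
have [|gT isoW] := @finite_subgroup_fingroup G (words3 Z X Y).
  split=> //; apply: finite_submonoid_subgroup => //; first by exists 0, 0, 0; rewrite !mulg1.
  move=> _ _ [j [k [l ->]]] [j' [k' [l' ->]]].
  exists (j + 2 ^ k * j')%N, (k + 3 ^ l * k')%N, (l + l')%N.
  have YlZ : commute (Y ^+ l) (Z ^+ j') by exact: commuteX2.
  transitivity (Z ^+ j * (X ^+ k * Z ^+ j') * (Y ^+ l * X ^+ k') * Y ^+ l').
    by rewrite -!mulgA (mulgA (Y ^+ l) (Z ^+ j')) YlZ -!mulgA.
  by rewrite (expg_swap _ _ XZ) (expg_swap _ _ YX) !expgnDr !mulgA.
have [f [fM fI fW]] := isoW.
have [z _ fz] : range f Z by rewrite fW.
have [x _ fx] : range f X by rewrite fW.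
have [y _ fy] : range f Y by rewrite fW.
have fE := (gmorphX fM, gmorph1 fM, fM, fz, fx, fy).
have neq t t' : f t <> f t' -> t != t' by move=> ne; apply/eqP => tt; apply: ne; rewrite tt.
have iso8 : <[x]> <*> <[y]> \isog [set: hT].
  apply: (H_isog _ x y).
  - by apply: fI; rewrite !fE.
  - by apply: neq; rewrite !fE.
  - by apply: fI; rewrite !fE.
  apply: (mulgI y); rewrite mulKVg; apply: (mulIg x); rewrite mulgKV -mulgA.
  by apply: fI; rewrite !fE YX mulgA -expgS X4 mul1g.
have [|||||||K [KH KZ3 HK card_gT]] := @C3_sdprod gT z x y (<[x]> <*> <[y]>)%G.
- by [].
- by rewrite (card_isog iso8) cardsT.
- by apply: fI; rewrite !fE.
- by apply: neq; rewrite !fE.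
- by apply: fI; rewrite !fE.
- by apply: fI; rewrite !fE.
- move=> t; have [j [k [l]]] : words3 Z X Y (f t) by rewrite -fW; exists t.
  rewrite -fx -fy -fz -!(gmorphX fM) -!fM => /fI ->; by exists j, k, l.
split; last by exists gT.
by exists gT, K, (<[x]> <*> <[y]>)%G; split.
Qed.

End Generators.

End FiniteGroups.

(** * The ring $\mathbb{Z}_p$: divisibility, completeness, units *)

Section PadicInt.
Variable p : prime_nat.
Local Notation Zp := (padic_int p).
Implicit Types x y z : Zp.

Lemma pcoordD x y n : (x + y) n = ((x n + y n) %% p ^ n)%N.
Proof. by []. Qed.

Lemma pcoordM x y n : (x * y) n = ((x n * y n) %% p ^ n)%N.
Proof. by []. Qed.

Lemma pcoord0 n : (0 : Zp) n = 0%N.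
Proof. exact: mod0n. Qed.

Lemma pcoord_lt x n : (x n < p ^ n)%N.
Proof.
by rewrite -(pcoord_mod x) ltn_mod expn_gt0 prime_gt0 // prime_valP.
Qed.

Lemma pcoord_eq0P x n : x n = 0%N <-> exists z, x = (p : nat)%:R ^+ n * z.
Proof.
have p_gt0 m : (0 < p ^ m)%N by rewrite expn_gt0 prime_gt0 // prime_valP.
split=> [xn0|[z ->]]; last first.
  by rewrite -natrX pcoordM pcoord_nat modnn mul0n mod0n.
have dvd_x k : (p ^ n %| x (n + k))%N.
  by rewrite /dvdn -pcoord_le ?leq_addr // xn0.
(* The quotient is read off $n$ places further: its $k$-th coordinate is the $(n+k)$-th one of [x]
   divided by $p^n$. *)
have zP k : (x (n + k) %/ p ^ n = x (n + k.+1) %/ p ^ n %% p ^ k)%N.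
  have [q xq] := dvdnP (dvd_x k.+1).
  rewrite addnS pcoordP -addnS xq mulnK // expnD [(q * _)%N]mulnC.
  by rewrite -muln_modr mulnC mulnK.
exists (PadicInt zP); apply: padic_int_eq => k.
have [le_kn|lt_nk] := leqP k n.
  rewrite -natrX pcoordM pcoord_nat (pcoord_le x le_kn) xn0 mod0n.
  have -> : (p ^ n %% p ^ k = 0)%N by apply/eqP; exact: dvdn_exp2l.
  by rewrite mul0n mod0n.
rewrite -natrX pcoordM pcoord_nat modnMml /=.
by rewrite mulnC divnK ?dvd_x // -pcoord_le // leq_addl.
Qed.

Lemma padic_int_sep x : (forall n, exists z, x = (p : nat)%:R ^+ n * z) -> x = 0.
Proof.
by move=> x0; apply: padic_int_eq => n; rewrite pcoord0; apply/pcoord_eq0P.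
Qed.

(** The limit is the diagonal: from index $n$ on, the $n$-th coordinate of the sequence no longer
    changes. *)
Lemma padic_int_complete (a : nat -> Zp) :
    (forall n, exists z, a n.+1 - a n = (p : nat)%:R ^+ n * z) ->
  exists l, forall n, exists z, l - a n = (p : nat)%:R ^+ n * z.
Proof.
move=> aP; have aE n : a n.+1 n = a n n.
  have [z /eqP] := aP n; rewrite subr_eq addrC => /eqP ->.
  rewrite pcoordD -natrX pcoordM pcoord_nat modnn mul0n mod0n addn0.
  exact: pcoord_mod.
have lP n : (a n n = a n.+1 n.+1 %% p ^ n)%N by rewrite -pcoordP aE.
exists (PadicInt lP) => n; apply/pcoord_eq0P.
have /(congr1 (fun x : Zp => x n)) := subrr (a n).
by rewrite pcoord0 !pcoordD.
Qed.

(** Multiplication by an integer [c] inverse to [x] modulo $p$ leads to $1-q$ with $p\mid q$, whose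
    inverse is the limit of the geometric sums. *)
Lemma padic_int_unit x : x 1%N != 0%N -> x \is a GRing.unit.
Proof.
have p_pr := prime_valP p => x1.
have [c cx] : exists c : nat, ((c * x 1%N) %% p = 1)%N.
  have x1_gt0 : (0 < x 1%N)%N by rewrite lt0n.
  have co : coprime p (x 1%N).
    rewrite prime_coprime //; apply: contraL (pcoord_lt x 1) => p_x.
    by rewrite expn1 -leqNgt dvdn_leq.
  have [k l klE _] := egcdnP p x1_gt0; exists k.
  move: co; rewrite /coprime gcdnC => /eqP co.
  by rewrite klE co modnMDl modn_small // prime_gt1.
suff [y yE] : exists y, y * (c%:R * x) = 1.
  by apply: (@padic_unitPl _ _ (y * c%:R)); rewrite -mulrA.
have [t cxE] : exists t, c%:R * x = 1 - (p : nat)%:R * t.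
  have : (1 - c%:R * x) 1%N = 0%N.
    have cx1 : (c%:R * x) 1%N = (1 : Zp) 1%N.
      by rewrite pcoordM pcoord_nat expn1 modnMml cx /= expn1 modn_small ?prime_gt1.
    by rewrite pcoordD -cx1 -pcoordD subrr pcoord0.
  move=> /pcoord_eq0P[t tE]; exists t.
  by rewrite expr1 in tE; rewrite -tE opprB addrC subrK.
set q := (p : nat)%:R * t in cxE.
have geomP n : exists z, \sum_(i < n.+1) q ^+ i - \sum_(i < n) q ^+ i
    = (p : nat)%:R ^+ n * z.
  by exists (t ^+ n); rewrite big_ord_recr /= addrAC subrr add0r exprMn.
have [l lP] := padic_int_complete geomP.
exists l; rewrite cxE; apply/eqP; rewrite -subr_eq0; apply/eqP.
apply: padic_int_sep => n; have [z zE] := lP n.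
exists (z * (1 - q) - t ^+ n).
have := subrX1 q n; have := zE; move: (\sum_(i < n) _) => g lE gE.
rewrite exprMn in gE; rewrite (_ : l = g + (p : nat)%:R ^+ n * z); last first.
  by rewrite -lE addrC subrK.
rewrite (_ : _ - 1 = (p : nat)%:R ^+ n * z * (1 - q) - (q - 1) * g - 1).
  by rewrite -gE; ring.
by ring.
Qed.

End PadicInt.

(** * The field $\mathbb{Q}_p$: integers, maximal ideal, valuation *)

Lemma tofrac_ratio (R : idomainType) (x : {fraction R}) :
  exists a b : R, b != 0 /\ x = tofrac a / tofrac b.
Proof.
elim/quotW: x => r; exists (frac r).1, (frac r).2; split; first exact: denom_ratioP.
apply: (mulIf (x := tofrac (frac r).2)); first by rewrite tofrac_eq0 denom_ratioP.
rewrite divfK ?tofrac_eq0 ?denom_ratioP //.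
rewrite -[LHS]/(FracField.mul _ _) !piE; apply/eqmodP.
by rewrite /= FracField.equivfE !numden_Ratio ?mulr1 ?oner_neq0 ?denom_ratioP 1?mulrC.
Qed.

Section PadicField.
Variable p : prime_nat.
Local Notation Zp := (padic_int p).
Local Notation Qp := (padic p).
Local Notation P := ((p : nat)%:R).

Definition pint : {pred Qp} := fun x => `[< exists z : Zp, x = tofrac z >].

Lemma pintP x : reflect (exists z : Zp, x = tofrac z) (x \in pint).
Proof. exact: asboolP. Qed.

Lemma pint_tofrac z : tofrac z \in pint.
Proof. by apply/pintP; exists z. Qed.

Fact pint_subring : subring_closed pint.
Proof.
split; first by apply/pintP; exists 1; rewrite rmorph1.
  by move=> _ _ /pintP[a ->] /pintP[b ->]; rewrite -rmorphB pint_tofrac.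
by move=> _ _ /pintP[a ->] /pintP[b ->]; rewrite -rmorphM pint_tofrac.
Qed.
HB.instance Definition _ := GRing.isSubringClosed.Build Qp pint pint_subring.

(** The maximal ideal $p\mathbb{Z}_p$; membership of a difference expresses congruence modulo
    $p$. *)
Definition pnil : {pred Qp} := fun x => x / P \in pint.

Lemma pnilE x : (x \in pnil) = (x / P \in pint).
Proof. by []. Qed.

Fact pnil_zmod : zmod_closed pnil.
Proof.
by split=> [|x y]; rewrite !pnilE ?mul0r ?mulrBl; [exact: rpred0 | exact: rpredB].
Qed.
HB.instance Definition _ := GRing.isZmodClosed.Build Qp pnil pnil_zmod.

Lemma pnilMl x y : x \in pint -> y \in pnil -> x * y \in pnil.
Proof. by rewrite !pnilE -mulrA; exact: rpredM. Qed.

Lemma pnilMr x y : x \in pnil -> y \in pint -> x * y \in pnil.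
Proof. by rewrite mulrC => ? ?; exact: pnilMl. Qed.

Lemma pnil_p : P \in pnil.
Proof. by rewrite pnilE divff ?padic_p_neq0 ?rpred1. Qed.

Lemma pnilP x : reflect (exists2 y, y \in pint & x = P * y) (x \in pnil).
Proof.
apply: (iffP idP) => [xP|[y yP ->]]; last exact: pnilMr pnil_p yP.
by exists (x / P); rewrite // mulrC divfK ?padic_p_neq0.
Qed.

Lemma pnilW x : x \in pnil -> x \in pint.
Proof. by case/pnilP => y yP ->; rewrite rpredM ?rpred_nat. Qed.

Lemma pcoord1_pnil (z : Zp) : (tofrac z \in pnil) = (z 1%N == 0%N).
Proof.
apply/pnilP/eqP => [[_ /pintP[t ->] /eqP]|/pcoord_eq0P[t ->]].
  rewrite -(rmorph_nat (@tofrac _)) -rmorphM tofrac_eq => /eqP ->.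
  by apply/pcoord_eq0P; exists t; rewrite expr1.
by exists (tofrac t); rewrite ?pint_tofrac // expr1 rmorphM rmorph_nat.
Qed.

Lemma pnil1 : (1 \in pnil) = false.
Proof.
rewrite -(rmorph1 (@tofrac _)) pcoord1_pnil /= expn1 modn_small //.
exact/prime_gt1/prime_valP.
Qed.

Lemma pint_unit x : x \in pint -> x \notin pnil ->
  exists2 e : Zp, e \is a GRing.unit & x = tofrac e.
Proof.
case/pintP => z ->; rewrite pcoord1_pnil => z1; exists z => //.
exact: padic_int_unit.
Qed.

Lemma pint_inv x : x \in pint -> x \notin pnil -> x^-1 \in pint.
Proof.
by move=> xP /(pint_unit xP)[e eU ->]; rewrite -(rmorphV (@tofrac _) eU) pint_tofrac.
Qed.

Lemma tofrac_unit (e : Zp) : e \is a GRing.unit -> tofrac e \notin pnil.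
Proof.
move=> eU; apply: contraFN pnil1 => eP.
have e0 : tofrac e != 0 :> Qp by rewrite tofrac_eq0; apply: contraTneq eU => ->; rewrite unitr0.
by rewrite -(divff e0) -(rmorphV (@tofrac _) eU) pnilMr ?pint_tofrac.
Qed.

Lemma pnil_mul x y : x \in pint -> y \in pint -> x * y \in pnil ->
  x \in pnil \/ y \in pnil.
Proof.
move=> xP yP xyP; have [|xN] := boolP (x \in pnil); first by left.
right; have x0 : x != 0 by apply: contraNneq xN => ->; exact: rpred0.
by rewrite -(mulKf x0 y); exact: pnilMl (pint_inv _ _) xyP.
Qed.

(* Every nonzero p-adic integer is a unit times a power of p *)
Lemma padic_int_val (z : Zp) : z != 0 ->
  exists e k, e \is a GRing.unit /\ z = e * P ^+ k.
Proof.
move=> z0; have [n /(_ n (leqnn _)) zn] := pcoord_neq0 z0.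
have zn0 : z n != 0%N by apply: contraNneq zn => ->; exact: dvdn0.
have ex : exists n, z n != 0%N by exists n.
case: (ex_minnP ex) => -[|k]; first by rewrite pcoordP modn1.
move=> zk kmin; have /pcoord_eq0P[e zE] : z k = 0%N.
  by apply/eqP/negPn/negP => /kmin; rewrite ltnn.
exists e, k; split; last by rewrite mulrC.
apply: padic_int_unit; apply: contraNneq zk => /pcoord_eq0P[t eE].
by apply/eqP/pcoord_eq0P; exists t; rewrite zE eE mulrA expr1 -exprSr.
Qed.

Lemma padic_val_exists (x : Qp) : x != 0 -> exists k, has_padic_val x k.
Proof.
have [a [b [b0 ->]]] := tofrac_ratio x => x0.
have a0 : a != 0 by apply: contraNneq x0 => ->; rewrite rmorph0 mul0r.
have [e [k [eU aE]]] := padic_int_val a0.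
have [f [l [fU bE]]] := padic_int_val b0.
exists (k%:Z - l%:Z); exists (e * f^-1); first by rewrite unitrM eU unitrV.
rewrite expfzDr ?padic_p_neq0 // -exprnP aE bE !rmorphM !rmorphXn.
rewrite (rmorphV (@tofrac _) fU) -invr_expz -exprnP !(rmorph_nat (@tofrac _)).
by rewrite invfM mulrACA.
Qed.

Lemma padic_val_uniq (x : Qp) k l :
  has_padic_val x k -> has_padic_val x l -> k = l.
Proof.
have aux (e f : Zp) (m n : int) : e \is a GRing.unit -> f \is a GRing.unit ->
    tofrac e * P ^ m = tofrac f * P ^ n -> (m <= n)%R -> m = n.
  move=> eU fU E; rewrite -subr_ge0; case D: (n - m) => [[|j]|j] // _.
    by apply/esym/eqP; rewrite -subr_eq0 D.
  have : tofrac e = tofrac f * P ^+ j.+1.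
    apply: (mulIf (expfz_neq0 m (padic_p_neq0 p))); rewrite E -mulrA.
    by rewrite exprnP -expfzDr ?padic_p_neq0 // -D subrK.
  move/eqP => eE; have := tofrac_unit eU; rewrite (eqP eE) exprS mulrCA.
  by rewrite pnilMr ?pnil_p // rpredM ?rpredX ?rpred_nat ?pint_tofrac.
move=> [e eU ->] [f fU E].
have [kl|lk] := lerP k l; first exact: aux eU fU E kl.
by apply/esym/(aux _ _ _ _ fU eU (esym E)); exact: ltW.
Qed.

Lemma padic_valM (x y : Qp) k l :
  has_padic_val x k -> has_padic_val y l -> has_padic_val (x * y) (k + l).
Proof.
move=> [e eU ->] [f fU ->]; exists (e * f); first by rewrite unitrM eU.
by rewrite rmorphM expfzDr ?padic_p_neq0 // mulrACA.
Qed.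

Lemma padic_valX (x : Qp) k n :
  has_padic_val x k -> has_padic_val (x ^+ n) (k *+ n).
Proof.
move=> xk; elim: n => [|n IHn]; last by rewrite exprS mulrS; exact: padic_valM.
by exists 1; rewrite ?unitr1 // mulr0n expr0z rmorph1 mulr1.
Qed.

End PadicField.
Arguments pint {p}.
Arguments pnil {p}.

(* Hensel: 1 + 2 s = 0 modulo 3, so that s + (s^2 - c) is a better
   approximation than s of the square root of c. *)
Lemma padic3_sqrt (c : padic_int prime3) (d : padic_int prime3) :
  c = 1 + 3%:R * d -> exists s t, s ^+ 2 = c /\ s = 1 + 3%:R * t.
Proof.
move=> cE; pose next (s : padic_int prime3) := s + (s ^+ 2 - c).
have nextP n : exists z t, (iter n next 1) ^+ 2 - c = 3%:R ^+ n.+1 * z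
    /\ iter n next 1 = 1 + 3%:R * t.
  elim: n => [|n [z [t [zE tE]]]].
    by exists (- d), 0; split; rewrite /= ?cE; ring.
  rewrite iterS; set s := iter n next 1 in zE tE *; rewrite /next zE.
  exists (z * (1 + 2 * t + 3%:R ^+ n * z)), (t + 3%:R ^+ n * z); split.
    rewrite (_ : _ - c = s ^+ 2 - c + 3%:R ^+ n.+1 * z * (2 * s + 3%:R ^+ n.+1 * z)).
      by rewrite zE tE !exprS; ring.
    by ring.
  by rewrite tE exprS; ring.
have conv n : exists z, iter n.+1 next 1 - iter n next 1 = (prime3 : nat)%:R ^+ n * z.
  have [z [t [zE _]]] := nextP n; exists (3%:R * z).
  by rewrite iterS /next addrAC subrr add0r zE exprS /=; ring.
have [l lP] := padic_int_complete conv; exists l.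
have [z1 z1E] := lP 1%N; have [z2 [t [_ tE]]] := nextP 1%N.
exists (t + z1); split; last first.
  by rewrite mulrDr addrA -tE -[3%:R * z1]z1E addrC subrK.
apply/eqP; rewrite -subr_eq0; apply/eqP; apply: padic_int_sep => n.
have [z zE] := lP n; have [y [r [yE _]]] := nextP n.
set s := iter n next 1 in zE yE.
exists (3%:R * y + z * (2 * s + 3%:R ^+ n * z)).
have lsE : l - s = 3%:R ^+ n * z by [].
rewrite (_ : l = s + 3%:R ^+ n * z); last by rewrite -lsE addrC subrK.
rewrite (_ : _ - c = s ^+ 2 - c + 3%:R ^+ n * z * (2 * s + 3%:R ^+ n * z)); last by ring.
by rewrite yE exprS /=; ring.
Qed.

(** * Lattices in an algebra over $\mathbb{Q}_p$ and lifting of idempotents *)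

Section Lattice.
Variables (p : prime_nat) (D : falgType (padic p)) (I : finType) (g : I -> D).
Local Notation Zp := (padic_int p).
Local Notation Qp := (padic p).
Local Notation P := ((p : nat)%:R : padic p).
Implicit Types x y : D.

Definition zspan x : Prop :=
  exists c : I -> Zp, x = \sum_i tofrac (c i) *: g i.

Definition pspan k x : Prop := exists2 y, zspan y & x = P ^+ k *: y.

Lemma zspan_gen i : zspan (g i).
Proof.
exists (fun j => (j == i)%:R); rewrite (bigD1 i) //= eqxx rmorph1 scale1r.
by rewrite big1 ?addr0 // => j /negPf ->; rewrite rmorph0 scale0r.
Qed.

Lemma zspanD x y : zspan x -> zspan y -> zspan (x + y).
Proof.
move=> [c ->] [d ->]; exists (fun i => c i + d i); rewrite -big_split /=.
by apply: eq_bigr => i _; rewrite rmorphD scalerDl.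
Qed.

Lemma zspanZ (z : Qp) x : z \in pint -> zspan x -> zspan (z *: x).
Proof.
move=> /pintP[t ->] [c ->]; exists (fun i => t * c i); rewrite scaler_sumr.
by apply: eq_bigr => i _; rewrite rmorphM scalerA.
Qed.

Lemma zspanMn x n : zspan x -> zspan (x *+ n).
Proof. by rewrite -scaler_nat; apply: zspanZ; rewrite rpred_nat. Qed.

Lemma zspan0 : zspan 0.
Proof. by exists (fun=> 0); rewrite big1 // => i _; rewrite rmorph0 scale0r. Qed.

Lemma zspanN x : zspan x -> zspan (- x).
Proof. by rewrite -scaleN1r; apply: zspanZ; rewrite rpredN rpred1. Qed.

Lemma zspan_sum (J : Type) (s : seq J) (Q : pred J) (F : J -> D) :
  (forall j, Q j -> zspan (F j)) -> zspan (\sum_(j <- s | Q j) F j).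
Proof.
by move=> FP; elim/big_ind: _ => //; [exact: zspan0 | exact: zspanD].
Qed.

Lemma pspanD k x y : pspan k x -> pspan k y -> pspan k (x + y).
Proof.
by move=> [x' x'P ->] [y' y'P ->]; exists (x' + y'); rewrite ?scalerDr //; exact: zspanD.
Qed.

Lemma pspanN k x : pspan k x -> pspan k (- x).
Proof. by move=> [x' x'P ->]; exists (- x'); rewrite ?scalerN //; exact: zspanN. Qed.

Lemma pspanB k x y : pspan k x -> pspan k y -> pspan k (x - y).
Proof. by move=> xP yP; apply: pspanD => //; exact: pspanN. Qed.

Lemma pspan0 k : pspan k 0.
Proof. by exists 0; rewrite ?scaler0 //; exact: zspan0. Qed.

Lemma pspanW k x : pspan k x -> zspan x.
Proof. by move=> [y yP ->]; apply: zspanZ => //; rewrite rpredX ?rpred_nat. Qed.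

Lemma pspan_sum k (J : Type) (s : seq J) (Q : pred J) (F : J -> D) :
  (forall j, Q j -> pspan k (F j)) -> pspan k (\sum_(j <- s | Q j) F j).
Proof.
by move=> FP; elim/big_ind: _ => //; [exact: pspan0 | exact: pspanD].
Qed.

Lemma common_denominator (J : finType) (a : J -> Qp) :
  exists2 q : Zp, q != 0 & forall j, tofrac q * a j \in pint.
Proof.
have /choice[nd ndP] j : exists nd : Zp * Zp, nd.2 != 0 /\ a j = tofrac nd.1 / tofrac nd.2.
  by have [n [d [d0 aE]]] := tofrac_ratio (a j); exists (n, d).
exists (\prod_j (nd j).2); first by apply/prodf_neq0 => j _; case: (ndP j).
move=> j; have [d0 ->] := ndP j; rewrite (bigD1 j) //= rmorphM mulrC mulrA.
by rewrite divfK ?tofrac_eq0 // rpredM ?pint_tofrac.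
Qed.

(** A common denominator bounds the coordinates of the lattice in a basis of [D], so those of [x]
    become integers divisible by every power of $p$. *)
Lemma zspan_sep x : (forall k, pspan k x) -> x = 0.
Proof.
move=> xP; rewrite [x](coord_vbasis (memvf x)) big1 // => j _.
set f := coord (vbasis fullv) j.
have [q q0 qP] := common_denominator (fun i => f (g i)).
have fP y : zspan y -> tofrac q * f y \in pint.
  move=> [c ->]; rewrite /f linear_sum mulr_sumr rpred_sum // => i _.
  by rewrite linearZ /= mulrCA rpredM ?pint_tofrac.
suff /eqP : tofrac q * f x = 0.
  by rewrite mulf_eq0 tofrac_eq0 (negPf q0) => /eqP ->; rewrite scale0r.
have /pintP[z zE] := fP x (pspanW (xP 0)); rewrite zE; apply/eqP.
rewrite tofrac_eq0; apply/eqP/padic_int_sep => k.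
have [y /fP/pintP[t tE] xE] := xP k; exists t; apply/eqP.
by rewrite -tofrac_eq rmorphM rmorphXn rmorph_nat -zE /= -tE xE /f linearZ /= mulrCA.
Qed.

(** Coefficients of the successive differences are chosen once and for all; their partial sums
    converge in $\mathbb{Z}_p$. *)
Lemma zspan_complete (e : nat -> D) :
    zspan (e 0) -> (forall k, pspan k (e k.+1 - e k)) ->
  exists2 l, zspan l & forall k, pspan k (l - e k).
Proof.
move=> [c0 e0] eP.
have /choice[d dP] k : exists d : I -> Zp,
    e k.+1 - e k = P ^+ k *: \sum_i tofrac (d i) *: g i.
  by have [y [d ->] ->] := eP k; exists d.
pose a i k := c0 i + \sum_(j < k) (p : nat)%:R ^+ j * d j i.
have eE k : e k = \sum_i tofrac (a i k) *: g i.
  elim: k => [|k IHk]; first by rewrite e0; apply: eq_bigr => i _; rewrite /a big_ord0 addr0.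
  rewrite -(subrK (e k) (e k.+1)) dP IHk scaler_sumr -big_split /=.
  apply: eq_bigr => i _; rewrite scalerA -scalerDl /a big_ord_recr /= addrA.
  by rewrite [X in X *: _ = _]addrC [in RHS]rmorphD [in RHS]rmorphM rmorphXn rmorph_nat.
have /choice[l lP] i : exists l, forall k, exists z, l - a i k = (p : nat)%:R ^+ k * z.
  apply: padic_int_complete => k; exists (d k i).
  by rewrite /a big_ord_recr /= addrA [LHS]addrC addKr.
exists (\sum_i tofrac (l i) *: g i); first by exists l.
move=> k; have /choice[z zP] i := lP i k.
exists (\sum_i tofrac (z i) *: g i); first by exists z.
rewrite eE -sumrB scaler_sumr; apply: eq_bigr => i _.
by rewrite -scalerBl -rmorphB zP rmorphM rmorphXn rmorph_nat scalerA.
Qed.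

Hypothesis zspan1 : zspan 1.
Hypothesis zspanM : forall x y, zspan x -> zspan y -> zspan (x * y).

Lemma pspanMl k x y : zspan x -> pspan k y -> pspan k (x * y).
Proof. by move=> xP [z zP ->]; exists (x * z); [exact: zspanM | rewrite scalerAr]. Qed.

Lemma pspanMr k x y : pspan k x -> zspan y -> pspan k (x * y).
Proof. by move=> [z zP ->] yP; exists (z * y); [exact: zspanM | rewrite scalerAl]. Qed.

Lemma zspanX x n : zspan x -> zspan (x ^+ n).
Proof. by move=> xP; elim: n => [|n IHn] //; rewrite exprS; exact: zspanM. Qed.

Lemma pspan1_one : ~ pspan 1 1.
Proof.
move=> [y yP]; rewrite expr1 => E1; have /eqP : (1 : D) = 0.
  apply: zspan_sep => k; exists (y ^+ k); first exact: zspanX.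
  by rewrite -exprZn -E1 expr1n.
by rewrite oner_eq0.
Qed.

Hypothesis D_div : forall x, x != 0 -> x \is a GRing.unit.

(* The iteration e |-> 3 e^2 - 2 e^3 lifts an idempotent modulo p to an
   idempotent, and 0 and 1 are the only idempotents of a division ring. *)
Lemma idempotent_mod_p a :
  zspan a -> pspan 1 (a * a - a) -> pspan 1 a \/ pspan 1 (a - 1).
Proof.
move=> aP a2P; pose next x := x ^+ 2 *+ 3 - x ^+ 3 *+ 2.
have nextB x : next x - x = - (x * x - x) * (x *+ 2 - 1).
  (* The identity involves powers of [x] only, so it is proved by [ring] for the indeterminate of a
     polynomial ring and evaluated at [x]. *)
  pose X : {poly Qp} := 'X.
  have := erefl (horner_alg x (- (X * X - X) * (X *+ 2 - 1))).
  rewrite {1}(_ : - (X * X - X) * (X *+ 2 - 1) = X ^+ 2 *+ 3 - X ^+ 3 *+ 2 - X).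
    by rewrite !(rmorphB, rmorphMn, rmorphM, rmorphN, rmorph1, rmorphXn) /= !horner_algX.
  by ring.
have nextI x : next x * next x - next x =
    (x * x - x) * (x * x - x) * ((x * x - x) *+ 4 - 3%:R).
  pose X : {poly Qp} := 'X; pose E := X ^+ 2 *+ 3 - X ^+ 3 *+ 2.
  have := erefl (horner_alg x (E * E - E)).
  rewrite {2}(_ : E * E - E = (X * X - X) * (X * X - X) *
      ((X * X - X) *+ 4 - 3%:R)); last by rewrite /E; ring.
  by rewrite !(rmorphB, rmorphMn, rmorphM, rmorphN, rmorph1, rmorphXn) /= !horner_algX.
have nextP x k : zspan x -> pspan k.+1 (x * x - x) ->
    [/\ zspan (next x), pspan k.+1 (next x - x) & pspan k.+2 (next x * next x - next x)].
  move=> xP xxP; split.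
  - by apply: zspanD; [|apply: zspanN]; apply: zspanMn; exact: zspanX.
  - rewrite nextB; apply: pspanMr; first exact: pspanN.
    by apply: zspanD; [exact: zspanMn | exact: zspanN].
  rewrite nextI; apply: pspanMr; last first.
    by apply: zspanD; [apply: zspanMn; exact: pspanW xxP | apply/zspanN/zspanMn].
  have [y yP ->] := xxP; exists (P ^+ k *: (y * y)).
    by apply: zspanZ; [rewrite rpredX ?rpred_nat | exact: zspanM].
  by rewrite -scalerAl -scalerAr !scalerA -!exprD !addSn addnS.
have itP k : zspan (iter k next a) /\
    pspan k.+1 (iter k next a * iter k next a - iter k next a).
  elim: k => [|k [IH1 IH2]]; first by split.
  by have [] := nextP _ _ IH1 IH2.
have itB k : pspan k.+1 (iter k.+1 next a - iter k next a).
  by have [IH1 IH2] := itP k; have [] := nextP _ _ IH1 IH2.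
have stepP k : pspan k (iter k.+1 next a - iter k next a).
  have [y yP ->] := itB k; exists (P *: y); last by rewrite scalerA -exprSr.
  by apply: zspanZ; rewrite ?rpred_nat.
have [l lP llim] := zspan_complete (proj1 (itP 0)) stepP.
have ll0 : l * l - l = 0.
  apply: zspan_sep => k; have [y yP lE] := llim k; have [xP x2P] := itP k.
  set x := iter k next a in lE xP x2P.
  have -> : l = x + P ^+ k *: y by rewrite -lE addrC subrK.
  have -> : (x + P ^+ k *: y) * (x + P ^+ k *: y) - (x + P ^+ k *: y)
     = (x * x - x) + P ^+ k *: (x * y + y * x + P ^+ k *: (y * y) - y).
    rewrite mulrDl !mulrDr !scalerDr scalerN -!scalerAl -!scalerAr opprD.
    by rewrite !addrA; congr (_ - _); rewrite -!addrA [- x + _]addrC !addrA.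
  apply: pspanD.
    have [z zP ->] := x2P; exists (P *: z); last by rewrite scalerA -exprSr.
    by apply: zspanZ; rewrite ?rpred_nat.
  exists (x * y + y * x + P ^+ k *: (y * y) - y) => //.
  apply: zspanD; last exact: zspanN.
  apply: zspanD; first by apply: zspanD; exact: zspanM.
  by apply: zspanZ; [rewrite rpredX ?rpred_nat | exact: zspanM].
have laP : pspan 1 (a - l).
  rewrite (_ : a - l = - ((l - iter 1 next a) + (iter 1 next a - a))).
    by apply: pspanN; apply: pspanD; [exact: llim | exact: itB].
  by rewrite addrA subrK opprB.
have [l0|l0] := eqVneq l 0; first by left; rewrite l0 subr0 in laP.
right; have <- // : l = 1; apply: (mulrI (D_div l0)).
by rewrite mulr1; apply/eqP; rewrite -subr_eq0 ll0.
Qed.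

End Lattice.

(** * The norm of the regular representation *)

Section AlgebraNorm.
Variables (K : fieldType) (D : falgType K).
Implicit Types x y : D.

Lemma algebra_normM x y : algebra_norm (x * y) = algebra_norm x * algebra_norm y.
Proof.
rewrite /algebra_norm; have -> : amull (x * y) = (amull x \o amull y)%VF.
  by apply/lfunP => z; rewrite comp_lfunE !lfunE /= mulrA.
by rewrite (passmx.mxof_comp _ _ (vbasisP fullv)) det_mulmx mulrC.
Qed.

Lemma algebra_norm_scalar (c : K) : algebra_norm (c%:A : D) = c ^+ \dim {:D}.
Proof.
have cE : amull (c%:A : D) = c *: \1%VF.
  by apply/lfunP => z; rewrite scale_lfunE id_lfunE lfunE /= mulr_algl.
have mxofZ (f : 'End(D)) : passmx.mxof (vbasis {:D}) (vbasis {:D}) (c *: f)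
    = c *: passmx.mxof (vbasis {:D}) (vbasis {:D}) f.
  have lin := passmx.mxof_linear (vbasis {:D}) (vbasis {:D}).
  have mxof0 := lin (-1) f f; rewrite scaleN1r addNr scaleN1r addNr in mxof0.
  by have := lin c f 0; rewrite addr0 mxof0 addr0.
rewrite /algebra_norm cE mxofZ.
by rewrite passmx.mxof1 ?(basis_free (vbasisP _)) // detZ det1 mulr1.
Qed.

Lemma algebra_normX x n : algebra_norm (x ^+ n) = algebra_norm x ^+ n.
Proof.
elim: n => [|n IHn]; last by rewrite !exprS algebra_normM IHn.
by rewrite !expr0; have := algebra_norm_scalar 1; rewrite scale1r expr1n.
Qed.

End AlgebraNorm.

Lemma commrZ (K : fieldType) (D : algType K) (x y : D) (c : K) :
  GRing.comm x y -> GRing.comm x (c *: y).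
Proof. by rewrite /GRing.comm => xy; rewrite -scalerAr -scalerAl xy. Qed.

Lemma sum_unity_root (R : unitRingType) (z : R) n :
  z - 1 \is a GRing.unit -> z ^+ n = 1 -> \sum_(k < n) z ^+ k = 0.
Proof.
by move=> zU zn; apply: (mulrI zU); rewrite mulr0 -subrX1 zn subrr.
Qed.

(** * Cyclic algebras: a basis $w^ix^j$ and the centraliser of the generators *)

Section CyclicAlgebra.
Variables (K : fieldType) (D : falgType K) (q n : nat) (w x : D).
Let M := (q ^ n).-1.
Hypotheses (q_gt1 : (1 < q)%N) (n_gt0 : (0 < n)%N).
Hypothesis D_div : forall d : D, d != 0 -> d \is a GRing.unit.
Hypothesis M_neq0 : M%:R != 0 :> K.
Hypothesis D_dim : \dim {:D} = (n ^ 2)%N.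
Hypotheses (w_prim : M.-primitive_root w) (xU : x \is a GRing.unit).
Hypothesis xw : x * w = w ^+ q * x.

Let M_gt0 : (0 < M)%N := prim_order_gt0 w_prim.

Lemma div_mulr_eq0 (a b : D) : a * b = 0 -> a = 0 \/ b = 0.
Proof.
have [->|a0] := eqVneq a 0; first by left.
by move=> ab0; right; apply: (mulrI (D_div a0)); rewrite mulr0.
Qed.

Lemma cyc_conj j k : x ^+ j * w ^+ k = w ^+ (k * q ^ j) * x ^+ j.
Proof.
have x1 m : x * w ^+ m = w ^+ (m * q) * x.
  elim: m => [|m IHm]; first by rewrite mul0n !expr0 mulr1 mul1r.
  by rewrite exprSr mulrA IHm -mulrA xw mulrA -exprD mulSnr.
elim: j k => [|j IHj] k; first by rewrite expn0 muln1 !expr0 mulr1 mul1r.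
by rewrite exprS -mulrA IHj mulrA x1 -mulrA -exprS -mulnA -expnSr.
Qed.

Lemma cyc_exp_inj i j : (i < n)%N -> (j < n)%N -> w ^+ (q ^ i) = w ^+ (q ^ j) -> i = j.
Proof.
clear M_neq0 D_dim xw xU; move=> i_n j_n /eqP; rewrite (eq_prim_root_expr w_prim).
have small k : (1 < n)%N -> (k < n)%N -> (q ^ k < M)%N.
  rewrite /M => n1 kn; have : (q ^ k <= q ^ n.-1)%N by rewrite leq_exp2l //; lia.
  have : (q ^ 1 <= q ^ n.-1)%N by rewrite leq_exp2l //; lia.
  by have -> : (q ^ n = q * q ^ n.-1)%N; [rewrite -expnS prednK | nia].
have [n1|n1] := leqP n 1; first by move: i_n j_n; lia.
by rewrite !modn_small ?small // => /eqP; exact: expnI.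
Qed.

Lemma w_unit : w \is a GRing.unit.
Proof.
apply: D_div; apply/eqP => w0; have /eqP := prim_expr_order w_prim.
by rewrite w0 expr0n gtn_eqF // eq_sym oner_eq0.
Qed.

(** Orthogonality of characters: the $k$-th term inserts $(w^{e_j-e_{j_0}})^k$ in the $j$-th
    summand, and the powers of a nontrivial $M$-th root of unity sum to 0. *)
Lemma sum_conj (a : nat -> D) (m : nat) (e : nat -> nat) (y : nat -> D) j0 :
    (forall j, (j < m)%N -> GRing.comm (a j) w) ->
    (forall j, (j < m)%N -> y j * w = w ^+ e j * y j) ->
    (forall j, (j < m)%N -> j != j0 -> w ^+ e j != w ^+ e j0) -> (j0 < m)%N ->
  \sum_(k < M) w ^- (k * e j0) * (\sum_(j < m) a j * y j) * w ^+ k = (a j0 * y j0) *+ M.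
Proof.
move=> aw yw wI j0m; have wU := w_unit.
have ywX j k : (j < m)%N -> y j * w ^+ k = w ^+ (e j * k) * y j.
  move=> jm; elim: k => [|k IHk]; first by rewrite muln0 !expr0 mulr1 mul1r.
  by rewrite exprSr mulrA IHk -mulrA yw // mulrA -exprD mulnSr.
have term k j : (j < m)%N ->
    w ^- (k * e j0) * (a j * y j) * w ^+ k = a j * (w ^+ e j / w ^+ e j0) ^+ k * y j.
  move=> jm; have com b : GRing.comm (a j) (w ^- b) by apply/commrV/commrX/aw.
  rewrite mulrA -com -2!mulrA ywX // !mulrA; congr (_ * _); rewrite -!mulrA; congr (_ * _).
  rewrite exprMn_comm; last by apply/commrV/commrX/commr_sym/commrX.
  by rewrite exprVn -!exprM mulnC; apply/commr_sym/commrV/commrX/commr_sym/commrX.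
under eq_bigr => k _.
  rewrite mulr_sumr mulr_suml; under eq_bigr => j _ do rewrite (term k j (ltn_ord j)).
  over.
rewrite exchange_big (bigD1 (Ordinal j0m)) //= [X in _ + X]big1 ?addr0 => [|j jj0].
  rewrite divrr ?unitrX // (eq_bigr (fun=> a j0 * y j0)).
    by rewrite sumr_const card_ord.
  by move=> k _; rewrite expr1n mulr1.
rewrite -mulr_suml -mulr_sumr sum_unity_root ?mulr0 ?mul0r //.
  apply: D_div; rewrite subr_eq0 -(inj_eq (mulIr (unitrX (e j0) wU))) divrK ?unitrX //.
  by rewrite mul1r wI.
rewrite exprMn_comm; last by apply/commrV/commrX/commr_sym/commrX.
by rewrite exprVn -!exprM !(mulnC _ M) !exprM (prim_expr_order w_prim) !expr1n invr1 mulr1.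
Qed.

(** [sum_conj] separates the powers of [x] and leaves $\sum_i a_{ij}w^i=0$ for each $j$. Conjugation
    by powers of [x] gives this polynomial of degree less than $n$ the $n$ distinct commuting roots
    $w^{q^k}$, so it vanishes. *)
Lemma cyc_indep (a : 'M[K]_n) :
  \sum_j (\sum_i a i j *: w ^+ i) * x ^+ j = 0 -> a = 0.
Proof.
pose l j := \sum_i (if insub j is Some j' then a i j' else 0) *: w ^+ i.
have lE (j : 'I_n) : l j = \sum_i a i j *: w ^+ i by rewrite /l valK.
have lw j : GRing.comm (l j) w.
  by apply/commr_sym/commr_sum => i _; apply: commrZ; exact: commrX.
move=> a0; have l0 (j : 'I_n) : l j = 0.
  have yw i : (i < n)%N -> x ^+ i * w = w ^+ (q ^ i) * x ^+ i.
    by move=> _; have := cyc_conj i 1; rewrite mul1n expr1.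
  have wI i : (i < n)%N -> i != j -> w ^+ (q ^ i) != w ^+ (q ^ j).
    by move=> i_n; apply: contraNneq => /cyc_exp_inj->.
  have := sum_conj (fun i _ => lw i) yw wI (ltn_ord j).
  rewrite (eq_bigr (fun=> 0)) => [|k _]; last first.
    rewrite (_ : \sum_(i < n) _ = 0) ?mulr0 ?mul0r // -[RHS]a0.
    by apply: eq_bigr => i _; rewrite lE.
  rewrite big1 //.
  move/esym/eqP; rewrite -scaler_nat scaler_eq0 (negPf M_neq0) /= => /eqP.
  by case/div_mulr_eq0 => // xj0; move: (unitrX j xU); rewrite xj0 unitr0.
apply/matrixP => i j; rewrite mxE.
pose P := \poly_(i < n) ((if insub i is Some i' then a i' j else 0)%:A : D).
suff P0 : P = 0.
  have := coef_poly n (fun i => (if insub i is Some i' then a i' j else 0)%:A : D) i.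
  rewrite -/P P0 coef0 ltn_ord valK => /esym/eqP.
  by rewrite scaler_eq0 oner_eq0 orbF => /eqP.
apply/eqP/negPn/negP => P0; pose rs := [seq w ^+ (q ^ k) | k <- iota 0 n].
have := @max_ring_poly_roots D P rs P0; rewrite size_map size_iota ltnNge size_poly.
have -> : all (root P) rs.
  apply/allP => _ /mapP[k kn ->]; rewrite rootE horner_poly.
  have /(congr1 (fun d => x ^+ k * d)) := l0 j; rewrite mulr0 lE mulr_sumr.
  rewrite (eq_bigr (fun i : 'I_n => ((if insub (val i) is Some i' then a i' j else 0)%:A *
     w ^+ (q ^ k) ^+ i) * x ^+ k)); last first.
    by move=> i' _; rewrite -scalerAr cyc_conj valK mulr_algl -scalerAl mulnC exprM.
  rewrite -mulr_suml => /div_mulr_eq0[->//|xk0].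
  by move: (unitrX k xU); rewrite xk0 unitr0.
have -> // : uniq_roots rs.
have : all (fun k => (k < n)%N) (iota 0 n) by apply/allP => k; rewrite mem_iota.
have := iota_uniq 0 n; rewrite /rs; elim: (iota 0 n) => //= k s IHs /andP[ks s_uniq].
case/andP => kn sn; rewrite IHs // andbT; apply/allP => _ /mapP[m ms ->].
rewrite /diff_roots -!exprD addnC eqxx D_div // subr_eq0.
by apply: contraNneq ks => /cyc_exp_inj <- //; exact: (allP sn).
by move=> /(_ isT isT).
Qed.

(** The $n^2$ independent products $w^ix^j$ span [D] by dimension, so what commutes with [w] and [x]
    is central. *)
Lemma cyc_commute_scalar (c : D) : ('Z({:D}) = 1)%VS ->
  GRing.comm c w -> GRing.comm c x -> exists k : K, c = k%:A.
Proof.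
move=> ZD cw cx.
pose f (a : 'M[K]_n) := \sum_j (\sum_i a i j *: w ^+ i) * x ^+ j.
have f_lin : linear f.
  move=> k a b; rewrite /f scaler_sumr -big_split; apply: eq_bigr => j _ /=.
  rewrite scalerAl -mulrDl scaler_sumr -big_split /=; congr (_ * _).
  by apply: eq_bigr => i _; rewrite !mxE scalerA -scalerDl.
pose fL : {linear 'M[K]_n -> D} :=
  HB.pack f (GRing.isLinear.Build K 'M[K]_n D *:%R f f_lin).
have ker0 : lker (linfun fL) == 0%VS.
  apply/lker0P => a b; rewrite !lfunE => /eqP; rewrite -subr_eq0 -linearB.
  by move/eqP/cyc_indep/eqP; rewrite subr_eq0 => /eqP.
have full : limg (linfun fL) = fullv.
  apply/eqP; rewrite eqEdim subvf limg_dim_eq ?(eqP ker0) ?capv0 //=.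
  by rewrite D_dim dimvf dim_matrix -mulnn.
have : c \in 'Z({:D})%VS.
  rewrite memv_cap memvf; apply/centvP => d _.
  have : d \in limg (linfun fL) by rewrite full memvf.
  move=> /memv_imgP[a _ ->]; rewrite lfunE /= /f.
  apply: commr_sum => j _; apply: commrM; last exact: commrX.
  by apply: commr_sum => i _; apply: commrZ; exact: commrX.
by rewrite ZD => /vlineP[k ->]; exists k.
Qed.

End CyclicAlgebra.

(** * Congruences modulo $p$ in a lattice closed under products *)

Section Congruence.
Variables (p : prime_nat) (D : falgType (padic p)) (I : finType) (g : I -> D).
Hypothesis zspan1 : zspan g 1.
Hypothesis zspanM : forall x y, zspan g x -> zspan g y -> zspan g (x * y).
Implicit Types x y : D.

Definition eqp x y := pspan g 1 (x - y).

Lemma eqp_refl x : eqp x x.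
Proof. by rewrite /eqp subrr; exact: pspan0. Qed.

Lemma eqp_sym x y : eqp x y -> eqp y x.
Proof. by move=> xy; rewrite /eqp -opprB; exact: pspanN. Qed.

Lemma eqp_trans y x z : eqp x y -> eqp y z -> eqp x z.
Proof. by move=> xy yz; rewrite /eqp -(subrKA y); exact: pspanD. Qed.

Lemma eqpM x x' y y' : zspan g x' -> zspan g y ->
  eqp x x' -> eqp y y' -> eqp (x * y) (x' * y').
Proof.
move=> x'P yP xx' yy'; rewrite /eqp -(subrKA (x' * y)) -mulrBl -mulrBr.
by apply: pspanD; [exact: pspanMr | exact: pspanMl].
Qed.

Lemma eqpMl x y y' : zspan g x -> eqp y y' -> eqp (x * y) (x * y').
Proof. by move=> xP yy'; rewrite /eqp -mulrBr; exact: pspanMl. Qed.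

Lemma eqpMr x x' y : zspan g y -> eqp x x' -> eqp (x * y) (x' * y).
Proof. by move=> xP yy'; rewrite /eqp -mulrBl; exact: pspanMr. Qed.

Lemma eqp_sum (J : finType) (F G : J -> D) :
  (forall j, eqp (F j) (G j)) -> eqp (\sum_j F j) (\sum_j G j).
Proof. by move=> FG; rewrite /eqp -sumrB; apply: pspan_sum => j _; exact: FG. Qed.

Lemma eqp_sum0 (J : finType) (F : J -> D) :
  (forall j, eqp (F j) 0) -> eqp (\sum_j F j) 0.
Proof.
by move=> F0; rewrite /eqp subr0; apply: pspan_sum => j _; have := F0 j; rewrite /eqp subr0.
Qed.

Lemma eqpX x y n : zspan g x -> zspan g y -> eqp x y -> eqp (x ^+ n) (y ^+ n).
Proof.
move=> xP yP xy; elim: n => [|n IHn]; first exact: eqp_refl.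
by rewrite !exprS; apply: eqpM => //; exact: zspanX.
Qed.

End Congruence.

(** Additivity of the Frobenius map modulo 3; it needs commuting terms, and the mixed terms of the
    binomial carry a factor 3. *)
Lemma cube_sum_mod3 (D : falgType (padic prime3)) (I : finType) (g : I -> D)
    m (a : nat -> D) :
    zspan g 1 -> (forall x y, zspan g x -> zspan g y -> zspan g (x * y)) ->
    (forall j, zspan g (a j)) -> (forall i j, GRing.comm (a i) (a j)) ->
  eqp g ((\sum_(j < m) a j) ^+ 3) (\sum_(j < m) a j ^+ 3).
Proof.
move=> zspan1 zspanM aP aC; elim: m => [|m IHm]; first by rewrite !big_ord0 expr0n; exact: eqp_refl.
rewrite !big_ord_recr /=; set s := \sum__ _ in IHm *.
have sP : zspan g s by apply: zspan_sum => j _; exact: aP.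
have sC : GRing.comm s (a m) by apply/commr_sym/commr_sum => j _; exact: aC.
have -> : (s + a m) ^+ 3 = s ^+ 3 + a m ^+ 3 + 3%:R *: (s ^+ 2 * a m + s * a m ^+ 2).
  rewrite exprDn_comm // !big_ord_recl big_ord0 /= /bump /= !subnS !subn0 /=.
  rewrite !expr0 !expr1 mulr1 mul1r addr0 -[in RHS]addrA scaler_nat mulrnDl.
  congr (_ + _); rewrite [RHS]addrC !mulrSr !mulr0n !add0r -!addrA.
  by rewrite -[(1 + (1 + (1 + 0)))%N]/3%N.
have cancel (A B C S : D) : A + B + C - (S + B) = A - S + C.
  by rewrite [S + B]addrC opprD addrA (addrAC A B C) addrK addrAC.
rewrite /eqp cancel; apply: pspanD => //.
exists (s ^+ 2 * a m + s * a m ^+ 2); last by rewrite expr1.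
by apply: zspanD; apply: (zspanM) => //; apply: zspanX.
Qed.



(** * A cyclic algebra of degree $m>1$ with unit constant is not a division algebra *)

Section NoSplit.
Variables (D : falgType (padic prime3)) (m : nat) (w y : D) (b : padic prime3).
Let M := (9 ^ m).-1.
Hypothesis D_div : forall d : D, d != 0 -> d \is a GRing.unit.
Hypotheses (w_prim : M.-primitive_root w) (m_gt1 : (1 < m)%N).
Hypotheses (yw : y * w = w ^+ 9 * y) (ym : y ^+ m = b%:A).
Hypotheses (bP : b \in pint) (b1 : b - 1 \in pnil).

(** As $b\equiv 1$, this order behaves modulo 3 like the $\mathbb{F}_9$-endomorphisms of
    $\mathbb{F}_{9^m}$: [w] acts by multiplication by a generator and [y] as $a\mapsto a^9$. *)
Let g (ij : 'I_M * 'I_m) : D := w ^+ ij.1 * y ^+ ij.2.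

Let M_gt0 : (0 < M)%N := prim_order_gt0 w_prim.
Let m_gt0 : (0 < m)%N := ltnW m_gt1.

Let conj j k : y ^+ j * w ^+ k = w ^+ (k * 9 ^ j) * y ^+ j.
Proof. exact: cyc_conj. Qed.

Let gen i j : zspan g (w ^+ i * y ^+ j).
Proof.
rewrite -(prim_expr_mod w_prim) (divn_eq j m) exprD mulnC exprM ym exprZn expr1n.
rewrite mulrA mulr_algr -scalerAl; apply: zspanZ; first exact: rpredX.
exact: (zspan_gen g (Ordinal (ltn_pmod i M_gt0), Ordinal (ltn_pmod j m_gt0))).
Qed.

Let zspan1 : zspan g 1.
Proof. by have := gen 0 0; rewrite !expr0 mulr1. Qed.

Let zspanW k : zspan g (w ^+ k).
Proof. by have := gen k 0; rewrite expr0 mulr1. Qed.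

Let zspanY k : zspan g (y ^+ k).
Proof. by have := gen 0 k; rewrite expr0 mul1r. Qed.

Let zspanM d e : zspan g d -> zspan g e -> zspan g (d * e).
Proof.
move=> [c ->] [c' ->]; rewrite mulr_suml; apply: zspan_sum => i _.
rewrite mulr_sumr; apply: zspan_sum => j _; rewrite -scalerAl -scalerAr.
apply: zspanZ; first exact: pint_tofrac.
apply: zspanZ; first exact: pint_tofrac.
rewrite /g -mulrA [y ^+ _ * _]mulrA conj !mulrA -exprD -mulrA -exprD; exact: gen.
Qed.

(** In that model [Phi] is the trace from $\mathbb{F}_{9^m}$ to $\mathbb{F}_9$ as an endomorphism,
    and [t k] is multiplication by the trace of $w^k$. *)
Let Phi := \sum_(j < m) y ^+ j.
Let t k := \sum_(j < m) w ^+ (k * 9 ^ j).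

Let PhiP : zspan g Phi.
Proof. by apply: zspan_sum => j _; exact: zspanY. Qed.

Let tP k : zspan g (t k).
Proof. by apply: zspan_sum => j _; exact: zspanW. Qed.

Let w9m k : w ^+ (k * 9 ^ m) = w ^+ k.
Proof.
have -> : (9 ^ m = M.+1)%N by rewrite prednK // expn_gt0.
by rewrite mulnSr exprD mulnC exprM (prim_expr_order w_prim) expr1n mul1r.
Qed.

Let t_shift k : t (k * 9) = t k.
Proof.
have shift (F : nat -> D) l : F l = F 0%N -> \sum_(j < l) F j.+1 = \sum_(j < l) F j.
  case: l => [|l] F0; first by rewrite !big_ord0.
  by rewrite big_ord_recr [RHS]big_ord_recl /= F0 addrC.
rewrite /t; have := shift (fun j => w ^+ (k * 9 ^ j)) m; rewrite w9m expn0 muln1 => /(_ erefl) <-.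
by apply: eq_bigr => j _; rewrite -mulnA -expnS.
Qed.

Let p_nil d : zspan g d -> eqp g (3%:R *: d) 0.
Proof. by move=> dP; rewrite /eqp subr0; exists d. Qed.

(** $M=9^m-1$ is $-1$ modulo 3. *)
Let cancelM d : zspan g d -> eqp g (d *+ M) 0 -> eqp g d 0.
Proof.
move=> dP; rewrite /eqp !subr0 => dM.
have -> : d = d *+ (9 ^ m) - d *+ M.
  rewrite -mulrnBr ?leq_pred // -{1}[d]mulr1n; congr (_ *+ _).
  by rewrite /M -subn1 subKn ?expn_gt0.
apply: pspanB => //; exists ((3 * 9 ^ m.-1)%N%:R *: d).
  by apply: zspanZ; rewrite ?rpred_nat.
rewrite scalerA expr1 -natrM scaler_nat; congr (_ *+ _).
by rewrite -{1}(prednK m_gt0) expnS mulnA.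
Qed.

Let one_neq0 : ~ eqp g 1 0.
Proof. by rewrite /eqp subr0; exact: pspan1_one. Qed.

(** Traces lie in $\mathbb{F}_9$: cubing twice shifts the summands of [t k] cyclically. *)
Lemma t9 k : eqp g (t k ^+ 9) (t k).
Proof.
have cube l : eqp g (t l ^+ 3) (t (l * 3)).
  rewrite (_ : t (l * 3) = \sum_(j < m) (w ^+ (l * 9 ^ j)) ^+ 3).
    by apply: (@cube_sum_mod3 _ _ g m (fun j => w ^+ (l * 9 ^ j))) => // i j; apply/commrX/commr_sym/commrX.
  by apply: eq_bigr => j _; rewrite -exprM; congr (_ ^+ _); lia.
rewrite (_ : 9 = 3 * 3)%N // exprM; apply: eqp_trans (_ : eqp g _ (t (k * 3) ^+ 3)) _.
  by apply: (eqpX zspan1 zspanM) => //; exact: zspanX.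
by apply: eqp_trans (cube _) _; rewrite -mulnA t_shift; exact: eqp_refl.
Qed.

Lemma yPhi : eqp g (y * Phi) Phi.
Proof.
rewrite /eqp -{2}[Phi]mul1r -mulrBl -subrX1 ym.
rewrite (_ : _ - 1 = (b - 1)%:A); last by rewrite scalerBl scale1r.
have [c cP ->] := pnilP _ b1; exists (c *: 1); first exact: zspanZ.
by rewrite scalerA expr1.
Qed.

Lemma yXPhi j : eqp g (y ^+ j * Phi) Phi.
Proof.
elim: j => [|j IHj]; first by rewrite expr0 mul1r; exact: eqp_refl.
rewrite exprS -mulrA; apply: eqp_trans yPhi; apply: (eqpMl zspanM) IHj => //.
by have := zspanY 1; rewrite expr1.
Qed.

Lemma PhiwPhi k : eqp g (Phi * w ^+ k * Phi) (t k * Phi).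
Proof.
rewrite /Phi -/Phi !mulr_suml; apply: eqp_sum => j.
by rewrite conj -mulrA; apply: (eqpMl zspanM); [exact: zspanW | exact: yXPhi].
Qed.

Lemma t_comm_y k : GRing.comm (t k) y.
Proof.
apply/esym; rewrite -[in RHS]t_shift /t mulr_sumr mulr_suml; apply: eq_bigr => j _.
by have := conj 1 (k * 9 ^ j); rewrite !expr1 => ->; congr (_ ^+ _ * _); lia.
Qed.

Lemma t_comm_Phi k : GRing.comm (t k) Phi.
Proof. by apply: commr_sum => j _; apply/commrX/t_comm_y. Qed.

Lemma t_comm_w k l : GRing.comm (t k) (w ^+ l).
Proof. by apply/commr_sym/commr_sum => j _; apply/commrX/commr_sym/commrX. Qed.

(** [sum_conj] keeps only the summand $y^0=1$ of [Phi]. *)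
Lemma sum_w_Phi_w : \sum_(k < M) w ^- k * Phi * w ^+ k = 1 *+ M.
Proof.
have yX j : (j < m)%N -> y ^+ j * w = w ^+ (9 ^ j) * y ^+ j.
  by move=> _; have := conj j 1; rewrite mul1n expr1.
have wI j : (j < m)%N -> j != 0%N -> w ^+ (9 ^ j) != w ^+ (9 ^ 0).
  move=> jm; apply: contraNneq.
  by move/(cyc_exp_inj (isT : 1 < 9)%N m_gt0 w_prim jm m_gt0) ->.
have c1 j : (j < m)%N -> GRing.comm ((fun=> 1) j : D) w.
  by move=> _; apply/commr_sym/commr1.
have := sum_conj D_div w_prim c1 yX wI m_gt0.
rewrite expr0 mulr1 => <-; apply: eq_bigr => k _.
by rewrite expn0 muln1; congr (_ * _ * _); apply: eq_bigr => j _; rewrite mul1r.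
Qed.

Let wV k : w ^- k = w ^+ (k * M.-1).
Proof.
have wU : w \is a GRing.unit := w_unit D_div w_prim.
apply: (mulIr (unitrX k wU)); rewrite mulVr ?unitrX // -exprD addnC -mulnS prednK //.
by rewrite mulnC exprM (prim_expr_order w_prim) expr1n.
Qed.

Let Mone_neq0 : ~ eqp g (1 *+ M) 0.
Proof. by move/(cancelM zspan1)/one_neq0. Qed.

Lemma Phi_neq0 : ~ eqp g Phi 0.
Proof.
move=> Phi0; apply: Mone_neq0; rewrite -sum_w_Phi_w.
apply: eqp_sum0 => k; rewrite -(mul0r (w ^+ k)) -(mulr0 (w ^- k)).
by apply: (eqpMr zspanM) => //; apply: (eqpMl zspanM) => //; rewrite wV.
Qed.

(** The trace form is not zero: $M\Phi=\sum_k w^{-k}(\Phi w^k\Phi)$ and $\Phi w^k\Phi\equiv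
    t_k\Phi$, so vanishing of all the $t_k$ would kill $\Phi$. *)
Lemma t_neq0 : exists k, ~ eqp g (t k) 0.
Proof.
apply/existsNP => t0; apply: Phi_neq0; apply: cancelM => //.
rewrite -[Phi]mul1r -mulrnAl -sum_w_Phi_w mulr_suml.
apply: eqp_sum0 => k.
rewrite -!mulrA -(mulr0 (w ^- k)); apply: (eqpMl zspanM); first by rewrite wV.
rewrite mulrA; apply: eqp_trans (PhiwPhi k) _.
by rewrite -(mul0r Phi); exact: (eqpMr zspanM PhiP (t0 k)).
Qed.

(** If $y\equiv 1$, then $yw=w^9y$ gives $w^8\equiv 1$. But $m>1$ makes $w^8$ a nontrivial $M$-th
    root of unity, whose powers sum to 0, whereas the sum is congruent to $M\not\equiv 0$. *)
Lemma y_neq1 : ~ eqp g y 1.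
Proof.
move=> y1; have wP := zspanW 1; rewrite expr1 in wP.
have wU : w \is a GRing.unit := w_unit D_div w_prim.
have w9 : eqp g (w ^+ 9) w.
  apply: eqp_trans (_ : eqp g _ (w ^+ 9 * y)) _.
    by rewrite -{1}[w ^+ 9]mulr1; apply: (eqpMl zspanM) => //; exact: eqp_sym.
  by rewrite -yw -{2}[w]mul1r; exact: (eqpMr zspanM).
have w8 : eqp g (w ^+ 8) 1.
  have -> : w ^+ 8 = w^-1 * w ^+ 9 by rewrite exprS mulKr.
  rewrite -(mulVr wU); apply: (eqpMl zspanM) => //.
  by have := wV 1; rewrite expr1 => ->.
have v0 : \sum_(k < M) w ^+ 8 ^+ k = 0.
  apply: sum_unity_root; last by rewrite exprAC (prim_expr_order w_prim) expr1n.
  apply: D_div; rewrite subr_eq0 -(prim_order_dvd w_prim); apply/negP => /dvdn_leq.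
  have : (9 ^ 2 <= 9 ^ m)%N by rewrite leq_exp2l.
  rewrite /M; lia.
apply: Mone_neq0; apply: eqp_sym; rewrite -[X in eqp g X _]v0.
rewrite (_ : 1 *+ M = \sum_(k < M) 1); last by rewrite sumr_const card_ord.
apply: eqp_sum => k; rewrite -(expr1n _ k); exact: (eqpX zspan1 zspanM).
Qed.

(** For a nonzero trace $t$ the idempotent $t^8$ is congruent to 1, and $e=t^7w^k\Phi$ is a rank-one
    idempotent modulo 3. Lifting leaves $e\equiv 0$, which contradicts $\Phi\not\equiv 0$ since
    $\Phi e\equiv\Phi$, or $e\equiv 1$, which gives $y\equiv ey\equiv e\equiv 1$. *)
Theorem no_split : False.
Proof.
have [k tk0] := t_neq0.
have t8P : zspan g (t k ^+ 8) by exact: zspanX.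
have t7P : zspan g (t k ^+ 7) by exact: zspanX.
have t8I : pspan g 1 (t k ^+ 8 * t k ^+ 8 - t k ^+ 8).
  rewrite -exprD -[(8 + 8)%N]/(9 + 7)%N exprD (exprS _ 7).
  exact: (eqpMr zspanM t7P (t9 k)).
have t81 : eqp g (t k ^+ 8) 1.
  case: (idempotent_mod_p zspan1 zspanM D_div t8P t8I) => // t80.
  case: tk0; apply: eqp_trans (eqp_sym (t9 k)) _.
  by rewrite exprS -(mulr0 (t k)); apply: (eqpMl zspanM) => //; rewrite /eqp subr0.
have PwP : eqp g (t k ^+ 7 * (Phi * w ^+ k * Phi)) Phi.
  apply: eqp_trans (eqpMl zspanM t7P (PhiwPhi k)) _.
  by rewrite mulrA -exprSr -{2}[Phi]mul1r; exact: (eqpMr zspanM).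
have t7Phi : GRing.comm (t k ^+ 7) Phi by apply/commr_sym/commrX/commr_sym/t_comm_Phi.
have t7w : GRing.comm (t k ^+ 7) (w ^+ k) by apply/commr_sym/commrX/commr_sym/t_comm_w.
pose e := t k ^+ 7 * w ^+ k * Phi.
have twP : zspan g (t k ^+ 7 * w ^+ k) by exact: zspanM.
have eP : zspan g e by exact: zspanM.
have ee : eqp g (e * e) e.
  have -> : e * e = t k ^+ 7 * w ^+ k * (t k ^+ 7 * (Phi * w ^+ k * Phi)).
    rewrite /e.
    move: (t k ^+ 7) (w ^+ k) t7Phi => a c aPhi; rewrite !mulrA.
    by rewrite -(mulrA _ Phi a) -aPhi !mulrA.
  exact: (eqpMl zspanM).
case: (idempotent_mod_p zspan1 zspanM D_div eP ee) => [e0|e1].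
  apply: Phi_neq0; apply: eqp_trans (eqp_sym PwP) _.
  rewrite (_ : _ * _ = Phi * e); last first.
    by rewrite /e; move: (t k ^+ 7) (w ^+ k) t7Phi => a c aPhi; rewrite !mulrA aPhi.
  by rewrite -(mulr0 Phi); apply: (eqpMl zspanM) => //; rewrite /eqp subr0.
apply: y_neq1; have yP := zspanY 1; rewrite expr1 in yP.
have yPhiC : GRing.comm y Phi by apply: commr_sum => j _; apply: commrX.
apply: eqp_trans (_ : eqp g _ (e * y)) _.
  by rewrite -{1}[y]mul1r; apply: (eqpMr zspanM) => //; exact: eqp_sym.
apply: eqp_trans e1; rewrite /e -mulrA -yPhiC.
by apply: (eqpMl zspanM) => //; exact: yPhi.
Qed.

End NoSplit.

(** * Quaternion coordinates, conjugates and Skolem-Noether *)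

Section Quaternion.
Variables (K : fieldType) (D : falgType K) (i S : D) (s : K).
Hypotheses (ii : i * i = - 1) (SS : S * S = s%:A) (Si : S * i = - (i * S)).
Hypotheses (two_neq0 : 2%:R != 0 :> K) (D_dim : \dim {:D} = 4%N).
Hypothesis D_div : forall d : D, d != 0 -> d \is a GRing.unit.
Hypothesis s_neq0 : s != 0.

Definition quatern (a b c d : K) : D := a *: 1 + b *: i + c *: S + d *: (i * S).

Lemma quatD a b c d a' b' c' d' :
  quatern a b c d + quatern a' b' c' d' = quatern (a + a') (b + b') (c + c') (d + d').
Proof. rewrite /quatern !scalerDl [LHS]addrACA [X in X + _ = _]addrACA.
by rewrite [X in X + _ + _ = _]addrACA. Qed.

Lemma quatZ k a b c d : k *: quatern a b c d = quatern (k * a) (k * b) (k * c) (k * d).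
Proof. by rewrite /quatern !scalerDr !scalerA. Qed.

Lemma mulr_i_quat a b c d : i * quatern a b c d = quatern (- b) a (- d) c.
Proof.
rewrite /quatern !mulrDr -!scalerAr mulr1 ii mulrA ii mulN1r !scalerN !scaleNr.
by rewrite [a *: i + _]addrC -!addrA; congr (_ + (_ + _)); rewrite addrC.
Qed.

Lemma mulr_S_quat a b c d : S * quatern a b c d = quatern (s * c) (- s * d) a (- b).
Proof.
rewrite /quatern !mulrDr -!scalerAr mulr1 Si SS (mulrA S) Si mulNr -mulrA SS.
rewrite mulr_algr !scalerN !scalerA !mulNr !scaleNr ![s * _]mulrC.
by rewrite [LHS]addrC -!addrA [RHS]addrCA; congr (_ + _); rewrite addrA addrC.
Qed.

Lemma quatM a b c d a' b' c' d' : quatern a b c d * quatern a' b' c' d' =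
  quatern (a * a' - b * b' + s * (c * c' + d * d'))
       (a * b' + b * a' + s * (d * c' - c * d'))
       (a * c' + c * a' + d * b' - b * d')
       (a * d' + d * a' + b * c' - c * b').
Proof.
rewrite [X in X * _ = _]/quatern !mulrDl -!scalerAl mul1r -mulrA.
rewrite mulr_S_quat !mulr_i_quat !quatZ !quatD; congr quatern; ring.
Qed.

Lemma quat_scalar k : k%:A = quatern k 0 0 0.
Proof. by rewrite /quatern !scale0r !addr0. Qed.

Lemma quat_1 : 1 = quatern 1 0 0 0.
Proof. by rewrite -quat_scalar scale1r. Qed.

Lemma quat_i : i = quatern 0 1 0 0.
Proof. by rewrite /quatern !scale0r scale1r add0r !addr0. Qed.

Lemma quat_S : S = quatern 0 0 1 0.
Proof. by rewrite /quatern !scale0r scale1r !add0r addr0. Qed.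

Lemma quatN a b c d : - quatern a b c d = quatern (- a) (- b) (- c) (- d).
Proof. by rewrite -scaleN1r quatZ !mulN1r. Qed.

Lemma quat_eq0 a b c d : quatern a b c d = 0 -> [/\ a = 0, b = 0, c = 0 & d = 0].
Proof.
move=> q0; have S0 : S != 0.
  by apply: contraNneq s_neq0 => S0; move/eqP: SS; rewrite S0 mul0r eq_sym scaler_eq0 oner_eq0 orbF.
(* $q-iqi$ doubles the part of [q] in $K(i)$ and kills the rest; below, $q+s^{-1}SqS$ does the same
   for the scalar part. *)
have half k l m n : quatern k l m n = 0 -> quatern k l 0 0 = 0.
  move=> h; have: 2%:R *: quatern k l 0 0 = 0.
    transitivity (quatern k l m n - i * (quatern k l m n * i)); last by rewrite h mul0r mulr0 subr0.
    rewrite quat_i !quatM quatZ quatN quatD; congr quatern; ring.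
  by move/eqP; rewrite scaler_eq0 (negPf two_neq0) /= => /eqP.
have ab k l m n : quatern k l m n = 0 -> k = 0 /\ l = 0.
  move=> /half h; have: 2%:R *: quatern k 0 0 0 = 0.
    transitivity (s^-1 *: (S * (quatern k l 0 0 * S)) + quatern k l 0 0).
      rewrite quat_S !quatM !quatZ quatD; congr quatern; field => //.
    by rewrite h mul0r mulr0 scaler0 addr0.
  move/eqP; rewrite scaler_eq0 (negPf two_neq0) /= -quat_scalar scaler_eq0 oner_eq0 orbF.
  move=> /eqP k0; split=> //; move: h; rewrite k0 /quatern !scale0r add0r !addr0 => /eqP.
  rewrite scaler_eq0 => /orP[/eqP //|/eqP i0]; move/eqP: ii.
  by rewrite i0 mul0r eq_sym oppr_eq0 oner_eq0.
have [a0 b0] := ab _ _ _ _ q0.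
have : quatern a b c d * S = 0 by rewrite q0 mul0r.
rewrite quat_S quatM => /ab[sc sd]; split=> //; apply: (mulfI s_neq0); rewrite mulr0.
  by rewrite -sc; ring.
by rewrite -sd; ring.
Qed.

Lemma quat_inj a b c d a' b' c' d' : quatern a b c d = quatern a' b' c' d' ->
  [/\ a = a', b = b', c = c' & d = d'].
Proof.
move/eqP; rewrite -subr_eq0 quatN quatD => /eqP/quat_eq0[].
by do 4![move/eqP; rewrite subr_eq0 => /eqP ->].
Qed.

Lemma quat_surj (x : D) : exists a b c d, x = quatern a b c d.
Proof.
pose f (v : 'rV[K]_4) := quatern (v 0 0) (v 0 1) (v 0 2) (v 0 3).
have f_lin : linear f.
  by move=> k a b; rewrite /f quatZ quatD !mxE.
pose fL : {linear 'rV[K]_4 -> D} :=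
  HB.pack f (GRing.isLinear.Build K 'rV[K]_4 D *:%R f f_lin).
have ker0 : lker (linfun fL) == 0%VS.
  apply/lker0P => a b; rewrite !lfunE => /quat_inj[e0 e1 e2 e3].
  apply/rowP => j; case: j => [[|[|[|[|j]]]] jP] //.
  - by rewrite (_ : Ordinal _ = 0) //; apply: val_inj.
  - by rewrite (_ : Ordinal _ = 1) //; apply: val_inj.
  - by rewrite (_ : Ordinal _ = 2) //; apply: val_inj.
  - by rewrite (_ : Ordinal _ = 3) //; apply: val_inj.
have full : limg (linfun fL) = fullv.
  apply/eqP; rewrite eqEdim subvf limg_dim_eq ?(eqP ker0) ?capv0 //=.
  by rewrite D_dim dimvf dim_matrix.
have : x \in limg (linfun fL) by rewrite full memvf.
by case/memv_imgP => v _ ->; rewrite lfunE; do 4!eexists.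
Qed.

Lemma quat_conj a b c d : quatern a b c d * quatern a (- b) (- c) (- d) =
  (a ^+ 2 + b ^+ 2 - s * (c ^+ 2 + d ^+ 2))%:A.
Proof. by rewrite quatM quat_scalar; congr quatern; ring. Qed.

(* Skolem-Noether for elements with the same square. *)
Lemma skolem_noether (x y : D) (k : K) : x * x = k%:A -> y * y = k%:A ->
  (exists z, x * z != z * x) -> exists2 g, g != 0 & g * x = y * g.
Proof.
move=> xx yy [z xz].
(* Every $yt+tx$ intertwines [x] and [y], because their common square is a scalar; $t=1$ serves
   unless $y=-x$, where a [z] not commuting with [x] serves. *)
have comb t : (y * t + t * x) * x = y * (y * t + t * x).
  by rewrite mulrDl mulrDr -[t * x * x]mulrA xx (mulrA y y) yy mulr_algl mulr_algr addrC mulrA.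
have [xy0|xy0] := eqVneq (y + x) 0; last first.
  by exists (y * 1 + 1 * x); rewrite ?comb // mulr1 mul1r.
exists (y * z + z * x); last exact: comb.
move/eqP: xy0; rewrite addr_eq0 => /eqP ->; rewrite mulNr addrC subr_eq0 eq_sym //.
Qed.

End Quaternion.

(** * Residues modulo 3 and reduction of the Hasse invariant to degree two *)

Local Notation K := (padic prime3).

Lemma padic_natr_neq0 (p : prime_nat) k : (0 < k)%N -> k%:R != 0 :> padic p.
Proof.
move=> k0; rewrite -(rmorph_nat (@tofrac _)) tofrac_eq0; apply/eqP.
move/(congr1 (fun z : padic_int p => z k)); rewrite pcoord_nat pcoord0.
rewrite modn_small; last exact/ltn_expl/prime_gt1/prime_valP.
by move=> k00; rewrite k00 in k0.
Qed.

Lemma pint3_residue (d : K) : d \in pint ->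
  [|| d \in pnil, d - 1 \in pnil | d + 1 \in pnil].
Proof.
case/pintP => t ->; have -> : tofrac t - 1 = tofrac (t - 1) :> K by rewrite rmorphB rmorph1.
have -> : tofrac t + 1 = tofrac (t + 1) :> K by rewrite rmorphD rmorph1.
rewrite !pcoord1_pnil !pcoordD; have := pcoord_lt t 1.
by case: (t 1%N) => [|[|[|]]].
Qed.

(** $x^n$ is a scalar of some valuation $j$, and the invariant is $j/n$; hence $2j=n(2z+1)$, $n=2m$
    and $j=m(2z+1)$. The case $m>1$ is excluded by [no_split], applied to a multiple of $y^2$. *)
Lemma cyclic_degree_two (D : falgType (padic prime3)) :
    central_division D -> has_hasse_invariant D (1 / 2%:R) ->
  exists (w y : D) (e : padic_int prime3),
    [/\ \dim {:D} = 4%N, 8.-primitive_root w, y * w = w ^+ 3 * y,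
        e \is a GRing.unit & y ^+ 2 = (3%:R * tofrac e)%:A].
Proof.
move=> [ZD D_div] [n [w [x [k [n_gt0 D_dim w_prim [xU xw] [xk kI]]]]]].
have {}xw : x * w = w ^+ 3 * x by rewrite -xw divrK.
have M_gt0 := prim_order_gt0 w_prim.
have M0 : (3 ^ n).-1%:R != 0 :> K by exact: padic_natr_neq0.
have cw : GRing.comm (x ^+ n) w.
  have := cyc_conj xw n 1; rewrite mul1n expr1 /GRing.comm => ->.
  have -> : (3 ^ n = (3 ^ n).-1.+1)%N by rewrite prednK ?expn_gt0.
  by rewrite exprS (prim_expr_order w_prim) mulr1.
have cx : GRing.comm (x ^+ n) x by exact/commr_sym/commrX.
have [c xn] := cyc_commute_scalar (isT : 1 < 3)%N n_gt0 D_div M0 D_dim w_prim xU xw ZD cw cx.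
have c0 : c != 0.
  apply: contraTneq (unitrX n xU) => c0.
  by rewrite xn c0 scale0r unitr0.
have [j cj] := padic_val_exists c0.
(* Taking norms in $x^n=c$ gives $nk=n^2j$. *)
have kj : k = j * n%:Z.
  have := padic_valX n xk; rewrite -algebra_normX xn algebra_norm_scalar D_dim.
  move/padic_val_uniq/(_ (padic_valX (n ^ 2) cj)); rewrite -[k *+ _]mulr_natr -[j *+ _]mulr_natr => /eqP.
  by rewrite -mulnn natrM !natz mulrA (inj_eq (mulIf _)) ?eqz_nat ?gtn_eqF // => /eqP.
have [z jz] : exists z : int, j * 2 = n%:Z * (2 * z + 1).
  have /intrP[z kz] : k%:~R / (n ^ 2)%:R - 1 / 2%:R \is a Num.int := kI.
  have n0 : n%:~R != 0 :> rat by rewrite intr_eq0 eqz_nat -lt0n.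
  have E : (j * 2)%:~R = (n%:Z * (2 * z + 1))%:~R :> rat.
    rewrite !intrM [(_ + 1)%:~R]intrD intrM -kz kj natrX intrM pmulrn. 
    by field.
  by exists z; apply: intr_inj E.
have [m nm] : exists m, n = (2 * m)%N.
  by exists (absz (j - n%:Z * z)%R); move: jz; clear; nia.
have jm : j = m%:Z * (2 * z + 1) by move: jz; rewrite nm; clear; nia.
have [e eU cE] := cj.
(* This scaling brings the constant $y^n$ to $3^m$ times the unit [e]. *)
pose y := (3%:R ^ (- z)  : K) *: x.
have yw : y * w = w ^+ 3 * y by rewrite /y -scalerAl xw scalerAr.
have P0 : 3%:R != 0 :> K := padic_p_neq0 prime3.
have yn : y ^+ n = (3%:R ^+ m * tofrac e)%:A.
  rewrite exprZn xn scalerA cE; congr (_ *: _); rewrite mulrC -mulrA mulrC; congr (_ * _).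
  rewrite !exprnP exprz_exp -expfzDr //; congr (_ ^ _).
  by rewrite jm nm; clear; nia.
have [m0|m0] := posnP m; first by move: n_gt0; rewrite nm m0.
have [m1|m_gt1] := leqP m 1.
  have m1E : m = 1%N by lia.
  rewrite nm m1E muln1 in D_dim w_prim yn.
  by exists w, y, e; split.
have M9 : ((3 ^ n).-1 = (9 ^ m).-1)%N by rewrite nm expnM.
have wU : w \is a GRing.unit := w_unit D_div w_prim.
rewrite M9 in w_prim M_gt0.
exfalso; pose v : D := (3%:R^-1  : K) *: y ^+ 2.
have vw : v * w = w ^+ 9 * v.
  by have := cyc_conj yw 2 1; rewrite expr1 /v -scalerAl -scalerAr mul1n => ->.
have vm : v ^+ m = (tofrac e)%:A.
  by rewrite exprZn -exprM -nm yn scalerA mulrA -exprMn mulVf // expr1n mul1r.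
have eP : tofrac e \in pint by exact: pint_tofrac.
have odd9 l : exists h, (9 ^ l = (2 * h).+1)%N.
  by exists (9 ^ l)./2; rewrite -[LHS]odd_double_half oddX orbT mul2n.
(* The constant is $\pm 1$ modulo 3. To change its sign, [v] is multiplied by $w^4$, whose relative
   norm is $w^{4(1+9+\dots+9^{m-1})}=w^{(9^m-1)/2}=-1$. *)
have vmQ : exists v b, [/\ v * w = w ^+ 9 * v, v ^+ m = b%:A, b \in pint & b - 1 \in pnil].
  have := pint3_residue eP; rewrite (negPf (tofrac_unit eU)) /=.
  case/orP => e1; first by exists v, (tofrac e).
  exists (w ^+ 4 * v), (- tofrac e); split; rewrite -?opprD ?rpredN //.
    by rewrite -mulrA vw (mulrA (w ^+ 4)) (mulrA (w ^+ 9)) -!exprD.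
  have pow l : (w ^+ 4 * v) ^+ l = w ^+ ((9 ^ l).-1 %/ 2) * v ^+ l.
    elim: l => [|l IHl]; first by rewrite !expr0 mulr1.
    rewrite exprS IHl -mulrA (mulrA v).
    have := cyc_conj vw 1 ((9 ^ l).-1 %/ 2); rewrite !expr1 => ->.
    rewrite -(mulrA (w ^+ _) v) (mulrA (w ^+ 4)) -exprD -exprS; congr (_ ^+ _ * _).
    have [h hE] := odd9 l; rewrite expn1 expnS hE.
    have -> : (9 * (2 * h).+1).-1 = (2 * (4 + h * 9))%N by clear; lia.
    by rewrite /= !mulKn.
  rewrite pow vm mulr_algr scaleNr; suff -> : w ^+ ((9 ^ m).-1 %/ 2) = -1 by rewrite scalerN.
  have [h hE] := odd9 m; rewrite hE /= mulKn //; rewrite hE /= in w_prim.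
  have : (w ^+ h - 1) * (w ^+ h + 1) = 0.
    rewrite -subr_sqr_1 -exprM mulnC (prim_expr_order w_prim) subrr //.
  case/(div_mulr_eq0 D_div) => /eqP; last by rewrite addr_eq0 => /eqP.
  rewrite subr_eq0 -(prim_order_dvd w_prim) => /dvdn_leq; move: M_gt0; rewrite hE; clear; lia.
have [v' [b [v'w v'm bP b1]]] := vmQ.
exact: (no_split D_div w_prim m_gt1 v'w v'm bP b1).
Qed.

(** * Closure rules for congruences modulo 3, and squares modulo 3 *)

Section Closed.
Variable p : prime_nat.
Implicit Types a b : padic p.

Lemma pintD a b : a \in pint -> b \in pint -> a + b \in pint.
Proof. exact: rpredD. Qed.

Lemma pintN a : a \in pint -> - a \in pint.
Proof. by rewrite rpredN. Qed.

Lemma pintM a b : a \in pint -> b \in pint -> a * b \in pint.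
Proof. exact: rpredM. Qed.

Lemma pintX a n : a \in pint -> a ^+ n \in pint.
Proof. exact: rpredX. Qed.

Lemma pint_nat n : n%:R \in @pint p.
Proof. exact: rpred_nat. Qed.

Lemma pint0 : 0 \in @pint p.
Proof. exact: rpred0. Qed.

Lemma pint1 : 1 \in @pint p.
Proof. exact: rpred1. Qed.

Lemma pnilD a b : a \in pnil -> b \in pnil -> a + b \in pnil.
Proof. exact: rpredD. Qed.

Lemma pnilN a : a \in pnil -> - a \in pnil.
Proof. by rewrite rpredN. Qed.

Lemma pnil0 : 0 \in @pnil p.
Proof. exact: rpred0. Qed.

End Closed.

Ltac pint_tac := first [assumption | lazymatch goal with
  | |- is_true (_ + _ \in pint) => apply: pintD; pint_tac
  | |- is_true (- _ \in pint) => apply: pintN; pint_tac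
  | |- is_true (_ * _ \in pint) => apply: pintM; pint_tac
  | |- is_true (_ ^+ _ \in pint) => apply: pintX; pint_tac
  | |- is_true (_%:R \in pint) => exact: pint_nat
  | |- is_true (1 \in pint) => exact: pint1
  | |- is_true (0 \in pint) => exact: pint0
  | |- _ => apply: pnilW; assumption
  end].

Ltac pnil_tac := first [assumption | lazymatch goal with
  | |- is_true (_ + _ \in pnil) => apply: pnilD; pnil_tac
  | |- is_true (- _ \in pnil) => apply: pnilN; pnil_tac
  | |- is_true (_ * _ \in pnil) =>
      first [ apply: pnilMl; [by pint_tac | by pnil_tac]
            | apply: pnilMr; [by pnil_tac | by pint_tac]]
  | |- is_true (_ ^+ _ \in pnil) => rewrite expr2; pnil_tac
  | |- is_true (3%:R \in pnil) => exact: pnil_p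
  | |- is_true (0 \in pnil) => exact: pnil0
  end].

Lemma pnil3_nat n : (n%:R \in @pnil prime3) = (3 %| n)%N.
Proof. by rewrite -(rmorph_nat (@tofrac _)) pcoord1_pnil pcoord_nat expn1. Qed.

Lemma pnil3_sqr (a : K) : a \in pint -> a \notin pnil -> a ^+ 2 - 1 \in pnil.
Proof.
move=> aP /negPf aN; have := pint3_residue aP; rewrite aN /= subr_sqr_1 => /orP[h|h].
  by apply: pnilMr => //; pint_tac.
by apply: pnilMl => //; pint_tac.
Qed.

(** Nonzero squares are 1 modulo 3, and neither 1 nor 2 vanishes there. So $-1$ is not a square
    modulo 3, which makes $\mathbb{F}_3[i]$ a field. *)
Lemma pnil3_sum_sqr (a b : K) : a \in pint -> b \in pint ->
  a ^+ 2 + b ^+ 2 \in pnil -> a \in pnil /\ b \in pnil.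
Proof.
move=> aP bP abN; have aux (x y : K) : x \in pint -> y \in pint ->
    x ^+ 2 + y ^+ 2 \in pnil -> x \in pnil.
  move=> xP yP xyN; apply: contraT => xN; have x1 := pnil3_sqr xP xN.
  have [yN|yN] := boolP (y \in pnil).
    have : 1%:R \in @pnil prime3.
      rewrite (_ : 1%:R = x ^+ 2 + y ^+ 2 - (x ^+ 2 - 1) - y * y); last by ring.
      by pnil_tac.
    by rewrite pnil3_nat.
  have y1 := pnil3_sqr yP yN; have : 2%:R \in @pnil prime3.
    rewrite (_ : 2%:R = x ^+ 2 + y ^+ 2 - (x ^+ 2 - 1) - (y ^+ 2 - 1)); last by ring.
    by pnil_tac.
  by rewrite pnil3_nat.
by split; [exact: aux abN | apply: (aux b a); rewrite // addrC].
Qed.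

Lemma half_pint : 2%:R^-1 \in @pint prime3.
Proof. by apply: pint_inv; rewrite ?rpred_nat ?pnil3_nat. Qed.

(** Since $(S/c)^2=-3$, a frame displays both the unramified field $\mathbb{Q}_3(i)$ and the
    ramified field $\mathbb{Q}_3(S)$, which contains the cube roots of unity. The unit [c] stays
    free, to be matched with $\pm u$. *)
Record quaternion_frame (D : falgType K) (i S : D) (c : K) : Prop := {
  frame_i : i * i = - 1;
  frame_S : S * S = (- (3%:R * c ^+ 2))%:A;
  frame_Si : S * i = - (i * S);
  frame_dim : \dim {:D} = 4%N;
  frame_div : forall d : D, d != 0 -> d \is a GRing.unit;
  frame_c : c \in pint;
  frame_cN : c \notin pnil }.

(** * The maximal order, its maximal ideal and torsion near 1 *)

Section Order.
Variables (D : falgType K) (i S : D) (c : K).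
Local Notation s := (- (3%:R * c ^+ 2)).
Hypothesis F : quaternion_frame i S c.
Local Notation quat := (quatern i S).

Let ii := frame_i F.
Let SS := frame_S F.
Let Si := frame_Si F.
Let D_dim := frame_dim F.
Let D_div := frame_div F.
Let cP := frame_c F.
Let cN := frame_cN F.

Let two_neq0 : 2%:R != 0 :> K. Proof. exact: padic_natr_neq0. Qed.
Let three_neq0 : 3%:R != 0 :> K. Proof. exact: padic_natr_neq0. Qed.

Let c_neq0 : c != 0.
Proof. by apply: contraNneq cN => ->; exact: rpred0. Qed.

Let s_neq0 : s != 0.
Proof. by rewrite oppr_eq0 mulf_neq0 // expf_neq0. Qed.

Let sP : s \in pint. Proof. by pint_tac; rewrite ?rpred_nat. Qed.
Let sN : s \in pnil.
Proof. by rewrite rpredN pnilMr ?rpredX //; exact: pnil_p. Qed.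

(** The maximal order of [D], with residue field $\mathbb{F}_9=\mathbb{F}_3[i]$. *)
Definition order_int (x : D) := exists a b c d,
  [/\ x = quat a b c d, a \in pint, b \in pint, c \in pint & d \in pint].

(** The maximal ideal, generated by [S]: only the coordinates on 1 and $i$ are constrained. *)
Definition topnil (x : D) := exists a b c d,
  [/\ x = quat a b c d, a \in pnil, b \in pnil, c \in pint & d \in pint].

(** Three times the order, that is, the square of the maximal ideal. *)
Definition triple (x : D) := exists a b c d,
  [/\ x = quat a b c d, a \in pnil, b \in pnil, c \in pnil & d \in pnil].

Lemma topnilW x : topnil x -> order_int x.
Proof. by move=> [a [b [e [d [-> ? ? ? ?]]]]]; exists a, b, e, d; split=> //; exact: pnilW. Qed.

Lemma tripleW x : triple x -> topnil x.
Proof. by move=> [a [b [e [d [-> ? ? ? ?]]]]]; exists a, b, e, d; split=> //; exact: pnilW. Qed.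

Lemma order_intD x y : order_int x -> order_int y -> order_int (x + y).
Proof.
move=> [a [b [e [d [-> ? ? ? ?]]]]] [a' [b' [e' [d' [-> ? ? ? ?]]]]].
by rewrite quatD; do 4!eexists; split; [by []|..]; pint_tac.
Qed.

Lemma topnilD x y : topnil x -> topnil y -> topnil (x + y).
Proof.
move=> [a [b [e [d [-> ? ? ? ?]]]]] [a' [b' [e' [d' [-> ? ? ? ?]]]]].
by rewrite quatD; do 4!eexists; split; [by []|..]; first [pnil_tac | pint_tac].
Qed.

Lemma tripleD x y : triple x -> triple y -> triple (x + y).
Proof.
move=> [a [b [e [d [-> ? ? ? ?]]]]] [a' [b' [e' [d' [-> ? ? ? ?]]]]].
by rewrite quatD; do 4!eexists; split; [by []|..]; first [pnil_tac | pint_tac].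
Qed.

Lemma order_intZ k x : k \in pint -> order_int x -> order_int (k *: x).
Proof.
move=> kP [a [b [e [d [-> ? ? ? ?]]]]].
by rewrite quatZ; do 4!eexists; split; [by []|..]; pint_tac.
Qed.

Lemma tripleZ k x : k \in pnil -> order_int x -> triple (k *: x).
Proof.
move=> kP [a [b [e [d [-> ? ? ? ?]]]]].
by rewrite quatZ; do 4!eexists; split; [by []|..]; pnil_tac.
Qed.

Lemma tripleP x : triple x -> exists2 y, order_int y & x = 3%:R *: y.
Proof.
move=> [a [b [e [d [-> /pnilP[a' ? ->] /pnilP[b' ? ->] /pnilP[e' ? ->] /pnilP[d' ? ->]]]]]].
by exists (quat a' b' e' d'); [exists a', b', e', d' | rewrite quatZ].
Qed.

Lemma order_intN x : order_int x -> order_int (- x).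
Proof. by move=> xP; rewrite -scaleN1r; apply: order_intZ => //; pint_tac. Qed.

Lemma topnilN x : topnil x -> topnil (- x).
Proof.
move=> [a [b [e [d [-> ? ? ? ?]]]]].
by rewrite quatN; do 4!eexists; split; [by []|..]; first [pnil_tac | pint_tac].
Qed.

Lemma tripleN x : triple x -> triple (- x).
Proof.
move=> [a [b [e [d [-> ? ? ? ?]]]]].
by rewrite quatN; do 4!eexists; split; [by []|..]; pnil_tac.
Qed.

Lemma order_intM x y : order_int x -> order_int y -> order_int (x * y).
Proof.
move: (s) sP SS => t tP tt.
move=> [a [b [e [d [-> ? ? ? ?]]]]] [a' [b' [e' [d' [-> ? ? ? ?]]]]].
by rewrite (quatM ii tt Si); do 4!eexists; split; [by []|..]; pint_tac.
Qed.

Lemma topnilMl x y : order_int x -> topnil y -> topnil (x * y).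
Proof.
move: (s) sP sN SS => t tP tN tt.
move=> [a [b [e [d [-> ? ? ? ?]]]]] [a' [b' [e' [d' [-> ? ? ? ?]]]]].
by rewrite (quatM ii tt Si); do 4!eexists; split; [by []|..]; first [pnil_tac | pint_tac].
Qed.

Lemma topnilMr x y : topnil x -> order_int y -> topnil (x * y).
Proof.
move: (s) sP sN SS => t tP tN tt.
move=> [a [b [e [d [-> ? ? ? ?]]]]] [a' [b' [e' [d' [-> ? ? ? ?]]]]].
by rewrite (quatM ii tt Si); do 4!eexists; split; [by []|..]; first [pnil_tac | pint_tac].
Qed.

Lemma topnilM x y : topnil x -> topnil y -> triple (x * y).
Proof.
move: (s) sP sN SS => t tP tN tt.
move=> [a [b [e [d [-> ? ? ? ?]]]]] [a' [b' [e' [d' [-> ? ? ? ?]]]]].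
by rewrite (quatM ii tt Si); do 4!eexists; split; [by []|..]; first [pnil_tac | pint_tac].
Qed.

Lemma tripleMl x y : order_int x -> triple y -> triple (x * y).
Proof. by move=> xP /tripleP[z zP ->]; rewrite -scalerAr; apply: tripleZ (pnil_p _) (order_intM xP zP). Qed.

Lemma tripleMr x y : triple x -> order_int y -> triple (x * y).
Proof. by move=> /tripleP[z zP ->] yP; rewrite -scalerAl; apply: tripleZ (pnil_p _) (order_intM zP yP). Qed.

(** The residue field is commutative. *)
Lemma commutator_topnil x y : order_int x -> order_int y -> topnil (x * y - y * x).
Proof.
move: (s) sP sN SS => t tP tN tt.
move=> [a [b [e [d [-> ? ? ? ?]]]]] [a' [b' [e' [d' [-> ? ? ? ?]]]]].
rewrite !(quatM ii tt Si) quatN quatD; do 4!eexists; split; [by []|..]; try by pint_tac.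
  by rewrite (_ : _ - _ = 0); [exact: rpred0 | ring].
rewrite (_ : _ - _ = t * (2%:R * (d * e' - e * d'))); last by ring.
by apply: pnilMr => //; pint_tac.
Qed.

Lemma order_int1 : order_int 1.
Proof. by rewrite (quat_1 i S); do 4!eexists; split; [by []|..]; pint_tac. Qed.

Lemma order_intX x n : order_int x -> order_int (x ^+ n).
Proof.
move=> xP; elim: n => [|n IHn]; first exact: order_int1.
by rewrite exprS; exact: order_intM.
Qed.

Lemma not_topnil1 : ~ topnil 1.
Proof.
move=> [a [b [e [d [E aN _ _ _]]]]]; move: aN.
by move: E; rewrite {1}(quat_1 i S) => /(quat_inj ii SS Si two_neq0 s_neq0)[<- _ _ _]; rewrite pnil1.
Qed.

Lemma not_topnil_nat n : ~~ (3 %| n)%N -> ~ topnil n%:R.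
Proof.
move=> n3 [a [b [e [d [E aN _ _ _]]]]]; move: aN.
move: E; rewrite -(scaler_nat n 1) (quat_scalar i S).
by move/(quat_inj ii SS Si two_neq0 s_neq0) => [<- _ _ _]; rewrite pnil3_nat (negPf n3).
Qed.

Lemma pow_one_triple y n : triple (y - 1) -> triple (y ^+ n - 1).
Proof.
move=> y1; have yP : order_int y.
  by rewrite -(subrK 1 y); apply: order_intD order_int1; exact/topnilW/tripleW.
elim: n => [|n IHn]; first by rewrite subrr; do 4![exists 0]; split; rewrite ?rpred0 // /quat !scale0r !addr0.
rewrite (_ : _ - 1 = y * (y ^+ n - 1) + (y - 1)); last by rewrite exprS mulrBr mulr1 subrKA.
by apply: tripleD => //; exact: tripleMl.
Qed.

(* 1 + 3 O is torsion free. *)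
Lemma one_triple_torsion y n : (0 < n)%N -> triple (y - 1) -> y ^+ n = 1 -> y = 1.
Proof.
have [m] := ubnP n; elim: m n y => // m IHm n y nm n_gt0 y1 yn.
have yP : order_int y.
  by rewrite -(subrK 1 y); apply: order_intD order_int1; exact/topnilW/tripleW.
(* If $3\mid n$, put $x=y^{n/3}=1+3z$: then $1+x+x^2=3(1+3(z+z^2))$ is not 0, so $x=1$ and induction
   applies. *)
have [|n3] := boolP (3 %| n)%N.
  move=> /dvdnP[k nE]; rewrite {}nE in nm n_gt0 yn *.
  apply: (IHm k) => //; [by lia | by lia |].
  have := pow_one_triple k y1; set x := y ^+ k => x1.
  have x3 : x ^+ 3 = 1 by rewrite -exprM.
  have [z zP xE] := tripleP x1.
  have xz : x = 1 + z *+ 3 by rewrite -scaler_nat -xE addrC subrK.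
  have sumE : \sum_(j < 3) x ^+ j = (1 + (z + z * z) *+ 3) *+ 3.
    pose X : {poly K} := 'X; pose P := 1 + X *+ 3.
    have := erefl (horner_alg z (1 + P + P * P)).
    rewrite {2}(_ : 1 + P + P * P = (1 + (X + X * X) *+ 3) *+ 3); last by rewrite /P; ring.
    rewrite !(rmorphMn, rmorphD, rmorphM, rmorph1) /= !horner_algX -xz => <-.
    by rewrite !big_ord_recr big_ord0 /= add0r expr0 expr1 expr2.
  have := subrX1 x 3; rewrite x3 subrr sumE -(scaler_nat 3 (1 + (z + z * z) *+ 3)) -scalerAr => /esym/eqP.
  rewrite scaler_eq0 (negPf three_neq0) /= => /eqP/(div_mulr_eq0 D_div)[/eqP|z1].
    by rewrite subr_eq0 => /eqP.
  case: not_topnil1; rewrite -[1](addrK ((z + z * z) *+ 3)) z1 add0r; apply: topnilN.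
  apply: tripleW; rewrite -scaler_nat; apply: tripleZ (pnil_p _) _.
  by apply: order_intD => //; exact: order_intM.
(* If $3\nmid n$, the cofactor of $y-1$ in $y^n-1$ is $n\neq 0$ in the residue field. *)
have geom : topnil (\sum_(j < n) y ^+ j - n%:R).
  rewrite -[n in n%:R]card_ord -sumr_const -sumrB; apply: tripleW.
  elim/big_ind: _ => [|? ? ? ?|j _]; [|exact: tripleD|exact: pow_one_triple].
  by do 4![exists 0]; split; rewrite ?rpred0 // /quat !scale0r !addr0.
have := subrX1 y n; rewrite yn subrr => /esym/(div_mulr_eq0 D_div)[/eqP|g0].
  by rewrite subr_eq0 => /eqP.
case: (not_topnil_nat n3); move: geom; rewrite g0 add0r => /topnilN.
by rewrite opprK.
Qed.

(** For $y=1+z$ the difference $y^3-1=3z+3z^2+z^3$ is in 3 times the order, as $z^2$ is; so $y^3$ is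
    a torsion element of a torsion-free group. *)
Lemma one_topnil_torsion y n : (0 < n)%N -> topnil (y - 1) -> y ^+ n = 1 -> y ^+ 3 = 1.
Proof.
move=> n_gt0 y1 yn; apply: (one_triple_torsion n_gt0); last by rewrite exprAC yn expr1n.
set z := y - 1 in y1; have yz : y = 1 + z by rewrite addrC subrK.
have -> : y ^+ 3 - 1 = z *+ 3 + z * z *+ 3 + z * z * z.
  pose X : {poly K} := 'X.
  have := erefl (horner_alg z ((1 + X) ^+ 3 - 1)).
  rewrite {2}(_ : (1 + X) ^+ 3 - 1 = X *+ 3 + X * X *+ 3 + X * X * X); last by ring.
  by rewrite !(rmorphMn, rmorphB, rmorphD, rmorphXn, rmorphM, rmorph1) /= !horner_algX -yz.
have zP := topnilW y1.
apply: tripleD; last by apply: tripleMr => //; exact: topnilM.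
apply: tripleD; rewrite -scaler_nat; apply: tripleZ (pnil_p _) _ => //.
exact: order_intM.
Qed.

End Order.

Lemma cancel_powers (E : fieldType) (x y z : E) :
  y != 0 -> z != 0 -> x = z * ((y * z)^-1 * (x * y)).
Proof. by move=> y0 z0; field; rewrite y0 z0. Qed.

(** * Units of the order and the valuation of a nonzero element *)

Section OrderUnits.
Variables (D : falgType K) (i S : D) (c : K) (kappa : K).
Local Notation s := (- (3%:R * c ^+ 2)).
Hypothesis F : quaternion_frame i S c.
Hypothesis kappaE : kappa = s \/ kappa = - s.
Local Notation quat := (quatern i S).
Local Notation order_int := (order_int i S).
Local Notation topnil := (topnil i S).
Local Notation triple := (triple i S).

Let ii := frame_i F.
Let SS := frame_S F.
Let Si := frame_Si F.
Let D_dim := frame_dim F.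
Let D_div := frame_div F.
Let cP := frame_c F.
Let cN := frame_cN F.
Let two_neq0 : 2%:R != 0 :> K. Proof. exact: padic_natr_neq0. Qed.
Let three_neq0 : 3%:R != 0 :> K. Proof. exact: padic_natr_neq0. Qed.
Let c_neq0 : c != 0.
Proof. by apply: contraNneq cN => ->; exact: pnil0. Qed.

Lemma frame_s_neq0 : s != 0.
Proof. by rewrite oppr_eq0 mulf_neq0 // expf_neq0. Qed.
Let s_neq0 := frame_s_neq0.

Lemma frame_quatM a b e d a' b' e' d' : quat a b e d * quat a' b' e' d' =
  quat (a * a' - b * b' + s * (e * e' + d * d'))
       (a * b' + b * a' + s * (d * e' - e * d'))
       (a * e' + e * a' + d * b' - b * d')
       (a * d' + d * a' + b * e' - e * b').
Proof. exact: quatM. Qed.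

Lemma frame_inj a b e d a' b' e' d' : quat a b e d = quat a' b' e' d' ->
  [/\ a = a', b = b', e = e' & d = d'].
Proof. exact: (quat_inj ii SS Si two_neq0 s_neq0). Qed.

Lemma frame_surj x : exists a b e d, x = quat a b e d.
Proof. exact: (quat_surj ii SS Si two_neq0 D_dim s_neq0). Qed.

Lemma frame_unit (x : D) : x != 0 -> x \is a GRing.unit.
Proof. exact: D_div. Qed.

Lemma frame_s_pnil : s \in pnil.
Proof. by apply: pnilN; apply: pnilMr; [exact: pnil_p | pint_tac]. Qed.

Lemma kappa_neq0 : kappa != 0.
Proof. by case: kappaE => ->; [exact: s_neq0 | rewrite oppr_eq0 s_neq0]. Qed.

Lemma kappa_pnil : kappa \in pnil.
Proof. by have := frame_s_pnil; case: kappaE => -> // ?; apply: pnilN. Qed.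

Lemma kappa3 : exists2 v, v \in pint & v \notin pnil /\ kappa = 3%:R * v.
Proof.
have c2 : c ^+ 2 \notin pnil.
  by apply/negP; rewrite expr2 => /(pnil_mul cP cP)[]; rewrite (negPf cN).
case: kappaE => ->.
  by exists (- c ^+ 2); [pint_tac | rewrite rpredN c2 mulrN].
by exists (c ^+ 2); [pint_tac | rewrite c2 opprK].
Qed.

Definition order_unit (x : D) := [/\ x != 0, order_int x & order_int x^-1].

(** The inverse is the conjugate divided by the reduced norm, which is $a^2+b^2$ modulo 3, hence a
    unit by [pnil3_sum_sqr]. *)
Lemma order_unit_quat a b e d : a \in pint -> b \in pint -> e \in pint -> d \in pint ->
  (a \notin pnil) || (b \notin pnil) -> order_unit (quat a b e d).
Proof.
move=> aP bP eP dP abN; set x := quat a b e d.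
have xP : order_int x by exists a, b, e, d.
pose n := a ^+ 2 + b ^+ 2 - s * (e ^+ 2 + d ^+ 2).
have nP : n \in pint by rewrite /n; pint_tac.
have nN : n \notin pnil.
  apply: contraL abN => nN; rewrite -negb_and negbK.
  have [|-> ->//] := pnil3_sum_sqr aP bP.
  rewrite (_ : _ + _ = n + s * (e ^+ 2 + d ^+ 2)); last by rewrite /n; ring.
  by apply: pnilD => //; apply: pnilMr; [exact: frame_s_pnil | pint_tac].
have n0 : n != 0 by apply: contraNneq nN => ->; exact: pnil0.
have xx : x * (n^-1 *: quat a (- b) (- e) (- d)) = 1.
  by rewrite -scalerAr (quat_conj ii SS Si) -/n scalerA mulVf // scale1r.
have x0 : x != 0.
  by apply/eqP => x0; move: xx; rewrite x0 mul0r => /eqP; rewrite eq_sym oner_eq0.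
split=> //; rewrite -[x^-1]mulr1 -xx mulKr ?frame_unit // quatZ.
have nVP := pint_inv nP nN.
by do 4!eexists; split; [by []|..]; pint_tac.
Qed.

Lemma order_unit_not_topnil x : order_unit x -> ~ topnil x.
Proof.
move=> [x0 xP xVP] xN; apply: (not_topnil1 F); rewrite -(divrr (D_div x0)).
exact: (topnilMr F).
Qed.

Lemma order_unitP x : order_unit x -> exists a b e d,
  [/\ x = quat a b e d, [/\ a \in pint, b \in pint, e \in pint & d \in pint] &
      (a \notin pnil) || (b \notin pnil)].
Proof.
move=> xU; have [x0 [a [b [e [d [xE aP bP eP dP]]]]] _] := xU.
exists a, b, e, d; split=> //; rewrite -negb_and; apply/andP => -[aN bN].
by case: (order_unit_not_topnil xU); exists a, b, e, d.
Qed.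

Lemma order_unit1 : order_unit 1.
Proof. by split; rewrite ?oner_neq0 ?invr1 //; exact: order_int1. Qed.

Lemma order_unitV x : order_unit x -> order_unit x^-1.
Proof. by move=> [x0 xP xVP]; split; rewrite ?invrK // invr_eq0. Qed.

Lemma order_unitM x y : order_unit x -> order_unit y -> order_unit (x * y).
Proof.
move=> [x0 xP xVP] [y0 yP yVP]; have xyU : x * y \is a GRing.unit by rewrite unitrMl D_div.
split; [by apply: contraTneq xyU => ->; rewrite unitr0 | exact: (order_intM F)|].
by rewrite invrM ?D_div //; exact: (order_intM F).
Qed.

Lemma order_unitZ k x : k \in pint -> k \notin pnil -> order_unit x -> order_unit (k *: x).
Proof.
move=> kP kN [x0 xP xVP]; have k0 : k != 0 by apply: contraNneq kN => ->; exact: pnil0.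
have kU : k \is a GRing.unit by rewrite unitfE.
split; first by rewrite scaler_eq0 negb_or k0.
  exact: order_intZ.
by rewrite invrZ ?D_div //; apply: order_intZ => //; exact: pint_inv.
Qed.

Lemma order_unitN x : order_unit x -> order_unit (- x).
Proof.
by rewrite -scaleN1r; apply: order_unitZ; rewrite ?rpredN ?pnil1 ?pint1.
Qed.

Lemma order_unitX x n : order_unit x -> order_unit (x ^+ n).
Proof.
move=> xU; elim: n => [|n IHn]; first exact: order_unit1.
by rewrite exprS; exact: order_unitM.
Qed.

Lemma frame_S_neq0 : S != 0.
Proof.
apply: contraNneq s_neq0 => S0; move/eqP: SS.
by rewrite S0 mul0r eq_sym scaler_eq0 oner_eq0 orbF.
Qed.
Let SU := D_div frame_S_neq0.

Lemma conj_S_quat a b e d : S * quat a b e d = quat a (- b) e (- d) * S.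
Proof.
rewrite [X in X * _ = _](quat_S i S) [X in _ = _ * X](quat_S i S) !frame_quatM.
by congr quatern; ring.
Qed.

Lemma order_unit_conj_S x : order_unit x -> exists2 y, order_unit y & S * x = y * S.
Proof.
case/order_unitP => a [b [e [d [-> [aP bP eP dP] abN]]]].
exists (quat a (- b) e (- d)); last exact: conj_S_quat.
by apply: order_unit_quat; rewrite ?rpredN //; pint_tac.
Qed.

Lemma triple_kappa x k : (0 < k)%N -> order_int x -> triple (kappa ^+ k *: x).
Proof.
case: k => // k _ xP; apply: tripleZ => //; rewrite exprS.
by apply: pnilMr; [exact: kappa_pnil | apply: pintX; exact/pnilW/kappa_pnil].
Qed.

Lemma order_unit_kappa x (z : int) : order_unit x -> x = (kappa ^ z)%:A -> z = 0.
Proof.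
move=> xU xE; have [x0 xP xVP] := xU; have k0 := kappa_neq0.
case: z xE => [[//|n]|n]; first rewrite -exprnP => xE.
  case: (order_unit_not_topnil xU); apply: tripleW; rewrite xE.
  exact: triple_kappa (order_int1 i S).
rewrite NegzE -exprnN => xE; case: (order_unit_not_topnil (order_unitV xU)).
apply: tripleW; rewrite xE invrZ ?unitr1 ?unitfE ?invr_eq0 ?expf_neq0 // invrK invr1.
exact: triple_kappa (order_int1 i S).
Qed.

Lemma not_divisible (t : K) : t != 0 -> exists n, 3%:R ^- n * t \notin pint.
Proof.
case/padic_val_exists => k [e eU tE].
have [m mE] : exists m : nat, (absz k).+1%:Z = k + m.+1%:Z.
  by exists (absz ((absz k)%:Z - k)%R); lia.
exists (absz k).+1; apply/negP => /pintP[z zE]; have /negP := tofrac_unit eU; apply.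
have -> : tofrac e = 3%:R ^+ m.+1 * tofrac z.
  have e3 : 3%:R ^- (absz k).+1 = (3%:R ^ k * 3%:R ^+ m.+1)^-1 :> K.
    by congr (_^-1); rewrite (exprnP _ (absz k).+1) mE expfzDr.
  rewrite -zE tE e3; apply: cancel_powers; [exact: expfz_neq0 | exact: expf_neq0].
by rewrite exprS -mulrA; apply: pnilMr; [exact: pnil_p | apply: pintM; [apply: pintX; exact: pint_nat | exact: pint_tofrac]].
Qed.

(** Denominators are cleared, and the largest power of 3 dividing all four coordinates is taken
    out. *)
Lemma primitive_multiple a b e d : ~ [/\ a = 0, b = 0, e = 0 & d = 0] ->
  exists (z : int) a' b' e' d', [/\ quat a b e d = 3%:R ^ z *: quat a' b' e' d',
     [/\ a' \in pint, b' \in pint, e' \in pint & d' \in pint]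
   & ~~ [&& a' \in pnil, b' \in pnil, e' \in pnil & d' \in pnil]].
Proof.
move=> abed0.
have [q q0 qP] := common_denominator (fun j : 'I_4 => [:: a; b; e; d]`_j).
have [t [l [tU qE]]] := padic_int_val q0.
have scaleP (j : 'I_4) : 3%:R ^+ l * [:: a; b; e; d]`_j \in pint.
  have -> : 3%:R ^+ l * [:: a; b; e; d]`_j = (tofrac t)^-1 * (tofrac q * [:: a; b; e; d]`_j).
    have t0 : tofrac t != 0 :> K by apply: contraNneq (tofrac_unit tU) => ->; exact: pnil0.
    by rewrite qE rmorphM rmorphXn rmorph_nat /= -!mulrA mulKf.
  by apply: pintM; [apply: pint_inv (tofrac_unit tU); exact: pint_tofrac | exact: qP].
have [aP [bP [eP dP]]] : 3%:R ^+ l * a \in pint /\ 3%:R ^+ l * b \in pint /\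
    3%:R ^+ l * e \in pint /\ 3%:R ^+ l * d \in pint.
  by have := scaleP 0; have := scaleP 1; have := scaleP 2; have := scaleP 3.
pose P n := [&& 3%:R ^- n * (3%:R ^+ l * a) \in pint, 3%:R ^- n * (3%:R ^+ l * b) \in pint,
  3%:R ^- n * (3%:R ^+ l * e) \in pint & 3%:R ^- n * (3%:R ^+ l * d) \in pint].
have ex : exists n, ~~ P n.
  have l0 : 3%:R ^+ l != 0 :> K by rewrite expf_neq0.
  have nd (y : K) : y != 0 -> exists n, 3%:R ^- n * (3%:R ^+ l * y) \notin pint.
    by move=> y0; apply: (@not_divisible (3%:R ^+ l * y)); rewrite mulf_neq0.
  have [a0|/nd[n nP]] := eqVneq a 0; last by exists n; rewrite /P (negPf nP).
  have [b0|/nd[n nP]] := eqVneq b 0; last by exists n; rewrite /P (negPf nP) andbF.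
  have [e0|/nd[n nP]] := eqVneq e 0; last by exists n; rewrite /P (negPf nP) !andbF.
  have [d0|/nd[n nP]] := eqVneq d 0; last by exists n; rewrite /P (negPf nP) !andbF.
  by case: abed0.
case: (ex_minnP ex) => -[|n] nP nmin.
  by case/negP: nP; rewrite /P expr0 invr1 !mul1r aP bP eP dP.
have Pn : P n by apply: contraT => /nmin; rewrite ltnn.
have [aP' bP' eP' dP'] := and4P Pn.
have stepE (y : K) : 3%:R ^- n.+1 * y = 3%:R ^- n * y / 3%:R.
  by rewrite exprSr invfM mulrAC.
have scale (y : K) : y = 3%:R ^ (n%:Z - l%:Z) * (3%:R ^- n * (3%:R ^+ l * y)).
  rewrite expfzDr // -exprnP -exprnN mulrA -[_ * 3%:R ^- l * _]mulrAC.
  by rewrite divff ?expf_neq0 // mul1r mulKf ?expf_neq0.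
exists (n%:Z - l%:Z), (3%:R ^- n * (3%:R ^+ l * a)), (3%:R ^- n * (3%:R ^+ l * b)),
  (3%:R ^- n * (3%:R ^+ l * e)), (3%:R ^- n * (3%:R ^+ l * d)); split; last 1 first.
- apply: contra nP; rewrite /P => /and4P[a3 b3 e3 d3].
  by rewrite !stepE; apply/and4P.
- rewrite quatZ; congr quatern; exact: scale.
by split.
Qed.

(* The valuation of x is even or odd according to the alternative. *)
Lemma order_unit_rep x : x != 0 -> exists (z : int) x0, x = kappa ^ z *: x0 /\
  (order_unit x0 \/ exists2 y, order_unit y & x0 = y * S).
Proof.
move=> x_neq0; have [a [b [e [d xE]]]] := frame_surj x.
have abed0 : ~ [/\ a = 0, b = 0, e = 0 & d = 0].
  move=> [a0 b0 e0 d0]; move/eqP: x_neq0; apply.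
  by rewrite xE a0 b0 e0 d0 /quatern !scale0r !addr0.
have [z [a' [b' [e' [d' [qE [aP bP eP dP] abed]]]]]] := primitive_multiple abed0.
have [v vP [vN kE]] := kappa3.
have v0 : v != 0 by apply: contraNneq vN => ->; exact: pnil0.
have [vzP vzN] : v ^ (- z) \in pint /\ v ^ (- z) \notin pnil.
  have [e0 eU vE] := pint_unit vP vN.
  suff [f fU ->] : exists2 f, f \is a GRing.unit & v ^ (- z) = tofrac f.
    by rewrite pint_tofrac (tofrac_unit fU).
  case: (- z) => n; first by exists (e0 ^+ n); rewrite ?unitrX // vE -exprnP rmorphXn.
  exists (e0 ^- n.+1); first by rewrite unitrV unitrX.
  by rewrite NegzE -exprnN vE (rmorphV _ (unitrX _ eU)) rmorphXn.
have xE' : x = kappa ^ z *: (v ^ (- z) *: quat a' b' e' d').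
  by rewrite xE qE scalerA kE expfzMl -mulrA -expfzDr // subrr expr0z mulr1.
exists z, (v ^ (- z) *: quat a' b' e' d'); split=> //.
have [ab|ab] := boolP ((a' \notin pnil) || (b' \notin pnil)).
  by left; apply: order_unitZ => //; exact: order_unit_quat.
right; move: ab; rewrite -negb_and negbK => /andP[aN bN].
move: abed; rewrite aN bN /= negb_and => edN.
have ds (t : K) : t \in pnil -> t / s \in pint.
  case: kappaE => kE' tP.
    rewrite -kE' kE invfM mulrA; apply: pintM; [exact: tP | exact: pint_inv].
  rewrite -[s]opprK -kE' kE -mulrN invfM mulrA; apply: pintM; first exact: tP.
  by apply: pint_inv; [exact: pintN | rewrite rpredN].
(* When the coordinates on 1 and $i$ are divisible by 3, a factor [S] can be taken out on the right;
   $s$ is 3 times a unit. *)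
exists (v ^ (- z) *: quat e' d' (a' / s) (b' / s)).
  apply: order_unitZ => //; apply: order_unit_quat => //; exact: ds.
rewrite -scalerAl; congr (_ *: _).
rewrite [X in _ = _ * X](quat_S i S) frame_quatM.
by congr quatern; rewrite !(mulr0, mulr1, subr0, oppr0, addr0, add0r) // [RHS]mulrC divfK.
Qed.

End OrderUnits.

(** * Subgroups of $D^\times$ that are torsion modulo $\kappa$ *)

Section Saturated.
Variables (D : falgType K) (kappa : K).
Implicit Types (x y g : D) (P : D -> Prop).

(* The inverse image in the unit group of D of a torsion subgroup of its
   quotient by the powers of kappa. *)
Record saturated P : Prop := {
  sat_neq0 : forall x, P x -> x != 0;
  satM : forall x y, P x -> P y -> P (x * y);
  satV : forall x, P x -> P x^-1;
  sat_kappa : P (kappa%:A);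
  sat_torsion : forall x, P x -> exists n (z : int), (0 < n)%N /\ x ^+ n = (kappa ^ z)%:A }.

Definition conj_by g P : D -> Prop := fun x => P (g^-1 * x * g).

Hypothesis D_div : forall x, x != 0 -> x \is a GRing.unit.
Hypothesis kappa_neq0 : kappa != 0.

Lemma conj_exp g x n : g != 0 -> (g * x * g^-1) ^+ n = g * x ^+ n * g^-1.
Proof.
move=> /D_div gU; elim: n => [|n IHn]; first by rewrite !expr0 mulr1 divrr.
by rewrite !exprS IHn !mulrA divrK.
Qed.

Lemma conj_byK g P x : g != 0 -> P x -> conj_by g P (g * x * g^-1).
Proof. by move=> /D_div gU; rewrite /conj_by !mulrA mulVr // mul1r divrK. Qed.

Lemma saturated_conj g P : g != 0 -> saturated P -> saturated (conj_by g P).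
Proof.
move=> g0 PS; have gU := D_div g0; have gE x : x = g * (g^-1 * x * g) * g^-1.
  by rewrite !mulrA divrr // mul1r mulrK.
split; rewrite /conj_by.
- by move=> x /(sat_neq0 PS); apply: contraNneq => ->; rewrite mulr0 mul0r.
- by move=> x y Px Py; have := satM PS Px Py; rewrite !mulrA mulrK.
- move=> x Px; have x0 : x != 0.
    by apply: contraNneq (sat_neq0 PS Px) => ->; rewrite mulr0 mul0r.
  have := satV PS Px; rewrite invrM // ?unitrMl ?unitrV ?D_div //.
  by rewrite invrM ?unitrV ?D_div // invrK mulrA.
- by rewrite -scalerAr mulr1 -scalerAl mulVr //; exact: sat_kappa.
move=> x /(sat_torsion PS)[n [z [n0 xn]]]; exists n, z; split=> //.
by rewrite (gE x) conj_exp // xn -scalerAr mulr1 -scalerAl divrr.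
Qed.

Lemma sat_scale P (z : int) x : saturated P -> P x -> P (kappa ^ z *: x).
Proof.
move=> PS Px; have kx n y : P y -> P (kappa ^+ n *: y).
  move=> Py; elim: n => [|n IHn]; first by rewrite expr0 scale1r.
  by rewrite exprS -scalerA -[_ *: (_ *: _)]mulr_algl; apply: satM => //; exact: sat_kappa.
case: z => n; first exact: kx.
have := satV PS (kx n.+1 _ (satV PS Px)).
have xU := D_div (sat_neq0 PS Px).
by rewrite invrZ ?unitfE ?expf_neq0 ?unitrV // invrK NegzE -exprnN.
Qed.

Lemma sat_unscale P (z : int) x : saturated P -> P (kappa ^ z *: x) -> P x.
Proof.
move=> PS /(sat_scale (- z) PS); rewrite scalerA -expfzDr // addNr expr0z.
by rewrite scale1r.
Qed.

Lemma sat1 P : saturated P -> P 1.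
Proof.
move=> PS; apply: (@sat_unscale P 1) => //; rewrite expr1z; exact: sat_kappa.
Qed.

Lemma satX P x n : saturated P -> P x -> P (x ^+ n).
Proof.
move=> PS Px; elim: n => [|n IHn]; first exact: sat1.
by rewrite exprS; exact: satM.
Qed.

Lemma sqr_eq1 x : x * x = 1 -> x = 1 \/ x = - 1.
Proof.
move=> xx; have : (x - 1) * (x + 1) = 0 by rewrite -subr_sqr_1 expr2 xx subrr.
by case/(div_mulr_eq0 D_div) => /eqP; rewrite ?subr_eq0 ?addr_eq0 => /eqP; [left|right].
Qed.

End Saturated.

(** * The unramified subfield, eighth roots of unity and subgroups without 3-torsion *)

Section Classification.
Variables (D : falgType K) (i S : D) (c kappa rho : K).
Local Notation s := (- (3%:R * c ^+ 2)).
Hypothesis F : quaternion_frame i S c.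
Hypothesis kappaE : kappa = s \/ kappa = - s.
Hypotheses (rhoP : rho \in pint) (rho2 : rho ^+ 2 = - 2%:R).
Local Notation quat := (quatern i S).
Local Notation order_int := (order_int i S).
Local Notation topnil := (topnil i S).
Local Notation triple := (triple i S).
Local Notation order_unit := (order_unit i S).
Implicit Types (x y g t : D) (P : D -> Prop).

Let ii := frame_i F.
Let SS := frame_S F.
Let Si := frame_Si F.
Let D_dim := frame_dim F.
Let D_div := frame_div F.
Let cP := frame_c F.
Let cN := frame_cN F.
Let two_neq0 : 2%:R != 0 :> K. Proof. exact: padic_natr_neq0. Qed.
Let three_neq0 : 3%:R != 0 :> K. Proof. exact: padic_natr_neq0. Qed.
Let c_neq0 : c != 0.
Proof. by apply: contraNneq cN => ->; exact: pnil0. Qed.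
Let s_neq0 := frame_s_neq0 F.
Let k_neq0 := kappa_neq0 F kappaE.
Let SU : S \is a GRing.unit := D_div (frame_S_neq0 F).
Let rho_neq0 : rho != 0.
Proof. by apply: contraNneq two_neq0 => r0; rewrite -oppr_eq0 -rho2 r0 expr0n. Qed.

Let kappa_cases (Q : K -> Prop) : Q kappa -> Q s \/ Q (- s).
Proof. by case: kappaE => ->; [left|right]. Qed.

Lemma quat_mulr_i a b e d : quat a b e d * i = quat (- b) a d (- e).
Proof. by rewrite [X in _ * X = _](quat_i i S) (frame_quatM F); congr quatern; ring. Qed.

Lemma quat_mulr_S a b e d : quat a b e d * S = quat (s * e) (s * d) a b.
Proof. by rewrite [X in _ * X = _](quat_S i S) (frame_quatM F); congr quatern; ring. Qed.

Lemma half_eq0 (a : K) : a = - a -> a = 0.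
Proof.
move/eqP; rewrite -subr_eq0 opprK -mulr2n -mulr_natl mulf_eq0 (negPf two_neq0).
by move/eqP.
Qed.

Lemma comm_i_quat a b e d : quat a b e d * i = i * quat a b e d -> e = 0 /\ d = 0.
Proof.
rewrite quat_mulr_i (mulr_i_quat _ ii) => /(frame_inj F)[_ _ dE eE].
by split; apply: half_eq0.
Qed.

Lemma anticomm_i_quat a b e d : quat a b e d * i = - (i * quat a b e d) -> a = 0 /\ b = 0.
Proof.
rewrite quat_mulr_i (mulr_i_quat _ ii) quatN opprK => /(frame_inj F)[bE aE _ _].
by split; apply: half_eq0 => //; rewrite -{1}[b]opprK bE.
Qed.

(** This is $(1+i)/\sqrt{-2}$, a primitive eighth root of unity with square $-i$. *)
Definition root8 := quat rho^-1 rho^-1 0 0.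
Local Notation w := root8.

Lemma w2 : w * w = - i.
Proof.
rewrite /w (frame_quatM F) [RHS](_ : _ = quat 0 (- 1) 0 0); last first.
  by rewrite {1}(quat_i i S) quatN !oppr0.
have r2 : rho^-1 * rho^-1 = - 2%:R^-1 by rewrite -invfM -expr2 rho2 invrN.
congr quatern; rewrite ?(mulr0, mul0r, subr0, addr0, subrr) ?r2 //.
by rewrite -opprD -mulr2n -[_ *+ 2]mulr_natl mulfV.
Qed.

Lemma w4 : w ^+ 4 = - 1.
Proof. by rewrite (_ : 4 = 2 * 2)%N // exprM !expr2 w2 mulrNN ii. Qed.

Lemma w8 : w ^+ 8 = 1.
Proof. by rewrite (_ : 8 = 4 * 2)%N // exprM w4 expr2 mulrNN mulr1. Qed.

Lemma w_conj : w ^+ 3 = quat rho^-1 (- rho^-1) 0 0.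
Proof. by rewrite exprS expr2 w2 mulrN /w quat_mulr_i quatN opprK !oppr0. Qed.

Lemma S_w k : S * w ^+ k = w ^+ (3 * k) * S.
Proof.
rewrite exprM w_conj; elim: k => [|k IHk]; first by rewrite !expr0 mulr1 mul1r.
by rewrite exprSr mulrA IHk [in RHS]exprSr -!mulrA (conj_S_quat F) oppr0.
Qed.

Lemma wi : GRing.comm w i.
Proof. by rewrite -[i]opprK -w2; apply/commrN/commrM. Qed.

Lemma w_neq0 : w != 0.
Proof.
by apply/eqP => w0; move/eqP: w8; rewrite w0 expr0n eq_sym oner_eq0.
Qed.

(* Elements of the unramified quadratic subfield. *)
Lemma unramified_comm a b a' b' : GRing.comm (quat a b 0 0) (quat a' b' 0 0).
Proof. by rewrite /GRing.comm !(frame_quatM F); congr quatern; ring. Qed.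

(** The fourth roots of unity commuting with $i$ are $\pm 1$ and $\pm i$; if $x^4=-1$, then
    $(xw)^4=1$. *)
Lemma unramified_root8 a b : quat a b 0 0 ^+ 8 = 1 -> exists k, quat a b 0 0 = w ^+ k.
Proof.
set x := quat a b 0 0 => x8; have xw : GRing.comm x w by exact: unramified_comm.
have xi : GRing.comm x i.
  by rewrite -[i]opprK -w2; apply/commrN/commrM.
have root4 y : GRing.comm y i -> y ^+ 4 = 1 -> exists k, y = w ^+ k.
  move=> yi y4; have : (y * y) * (y * y) = 1 by rewrite -!expr2 -exprM.
  case/(sqr_eq1 D_div) => [/(sqr_eq1 D_div)[->|->]|yy].
  - by exists 0%N; rewrite expr0.
  - by exists 4%N; rewrite w4.
  have : (y - i) * (y + i) = 0 by rewrite mulrBl !mulrDr yy ii yi [- 1 + _]addrC subrr.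
  case/(div_mulr_eq0 D_div) => /eqP; rewrite ?subr_eq0 ?addr_eq0 => /eqP ->.
    by exists 6%N; rewrite (_ : 6 = 4 + 2)%N // exprD w4 expr2 w2 mulrNN mul1r.
  by exists 2%N; rewrite expr2 w2.
have : (x ^+ 4) * (x ^+ 4) = 1 by rewrite -exprD.
case/(sqr_eq1 D_div) => [|x4]; first exact: root4.
have [k xk] : exists k, x * w = w ^+ k.
  apply: root4; first by apply/commr_sym/commrM; apply/commr_sym => //; exact: wi.
  by rewrite exprMn_comm // x4 w4 mulrNN mulr1.
exists (k + 7)%N; rewrite exprD -xk -mulrA -exprS w8 mulr1 //.
Qed.

Lemma topnil_exp x y n : order_int x -> order_int y -> topnil (x - y) ->
  topnil (x ^+ n - y ^+ n).
Proof.
move=> xP yP xy; elim: n => [|n IHn].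
  by rewrite subrr; do 4![exists 0]; rewrite /quatern !scale0r !addr0; split; rewrite ?pint0 ?pnil0.
rewrite !exprS -(subrKA (y * x ^+ n)) -mulrBl -mulrBr; apply: topnilD.
  by apply: (topnilMr F) => //; exact: (order_intX F).
exact: (topnilMl F).
Qed.

(** The group $\mathbb{F}_9^\times$ has order 8. *)
Lemma unit_pow8 x : order_unit x -> topnil (x ^+ 8 - 1).
Proof.
case/(order_unitP F) => a [b [e [d [-> [aP bP eP dP] abN]]]].
rewrite -(subrKA (quat a b 0 0 ^+ 8)); apply: topnilD.
  apply: topnil_exp; [by exists a, b, e, d | by exists a, b, 0, 0; rewrite pint0 |].
  exists 0, 0, e, d; split; rewrite ?pnil0 //.
  by rewrite quatN quatD !subrr !subr0.
(* $A+Bi$ is $(a+bi)^4$; modulo 3 it is $\pm 1$. *)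
pose A := (a ^+ 2 - b ^+ 2) ^+ 2 - 4%:R * (a * b) ^+ 2.
pose B := 4%:R * (a * b * (a ^+ 2 - b ^+ 2)).
have -> : quat a b 0 0 ^+ 8 = quat (A ^+ 2 - B ^+ 2) (2%:R * (A * B)) 0 0.
  have sqr p q : quat p q 0 0 ^+ 2 = quat (p ^+ 2 - q ^+ 2) (2%:R * (p * q)) 0 0.
    by rewrite expr2 (frame_quatM F); congr quatern; ring.
  rewrite (_ : 8 = 2 * 2 * 2)%N // !exprM !sqr.
  by congr quatern; rewrite /A /B; ring.
have AP : A \in pint by rewrite /A; pint_tac.
have [AN BN] : (A - 1) * (A + 1) \in pnil /\ B \in pnil.
  have [aN|aN] := boolP (a \in pnil).
    have bN : b \notin pnil by move: abN; rewrite aN.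
    have b1 := pnil3_sqr bP bN; split; last by rewrite /B; pnil_tac.
    apply: pnilMr; last by pint_tac.
    rewrite (_ : A - 1 = a * (a ^+ 3 - 6%:R * a * b ^+ 2) + (b ^+ 2 - 1) * (b ^+ 2 + 1)).
      by apply: pnilD; apply: pnilMr => //; pint_tac.
    by rewrite /A; ring.
  have a1 := pnil3_sqr aP aN; have [bN|bN] := boolP (b \in pnil).
    split; last by rewrite /B; pnil_tac.
    apply: pnilMr; last by pint_tac.
    rewrite (_ : A - 1 = b * (b ^+ 3 - 6%:R * b * a ^+ 2) + (a ^+ 2 - 1) * (a ^+ 2 + 1)).
      by apply: pnilD; apply: pnilMr => //; pint_tac.
    by rewrite /A; ring.
  have b1 := pnil3_sqr bP bN.
  have ab : a ^+ 2 - b ^+ 2 \in pnil.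
    by rewrite (_ : _ - _ = (a ^+ 2 - 1) - (b ^+ 2 - 1)); [pnil_tac | ring].
  split; last first.
    by rewrite /B; apply: pnilMl; [pint_tac|]; apply: pnilMl => //; pint_tac.
  apply: pnilMl; first by pint_tac.
  rewrite (_ : A + 1 = (a ^+ 2 - b ^+ 2) * (a ^+ 2 - b ^+ 2) - 4%:R * (a ^+ 2 * (b ^+ 2 - 1))
     - 4%:R * (a ^+ 2 - 1) - 3%:R); last by rewrite /A; ring.
  apply: pnilD; last by apply: pnilN; exact: pnil_p.
  apply: pnilD; last by apply: pnilN; apply: pnilMl => //; exact: pint_nat.
  apply: pnilD; first by apply: pnilMr => //; pint_tac.
  by apply: pnilN; apply: pnilMl; [exact: pint_nat | apply: pnilMl => //; pint_tac].
exists (A ^+ 2 - B ^+ 2 - 1), (2%:R * (A * B)), 0, 0.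
rewrite (quat_1 i S) quatN quatD !oppr0 !addr0 pint0; split=> //.
  rewrite (_ : _ - 1 = (A - 1) * (A + 1) - B * B); last by ring.
  by apply: pnilD => //; apply: pnilN; apply: pnilMr => //; exact: pnilW.
by apply: pnilMl; [exact: pint_nat | exact: pnilMl].
Qed.

Lemma unit_commutator x y : order_unit x -> order_unit y ->
  topnil (x * y * x^-1 * y^-1 - 1).
Proof.
move=> [x0 xP xVP] [y0 yP yVP].
have -> : x * y * x^-1 * y^-1 - 1 = (x * y - y * x) * (x^-1 * y^-1).
  by rewrite mulrBl !mulrA mulrK ?D_div // divrr ?D_div.
apply: (topnilMr F); [exact: (commutator_topnil F) | exact: (order_intM F)].
Qed.

Lemma order_unit_i : order_unit i.
Proof.
rewrite [X in order_unit X](quat_i i S); apply: (order_unit_quat F); rewrite ?pint0 ?pint1 //.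
by rewrite pnil1 orbT.
Qed.

(** The elements [y * S] with [y] a unit represent, up to powers of $\kappa$, the elements of odd
    valuation. *)
Lemma odd_quat y : order_unit y -> exists a b e d,
  [/\ y = quat a b e d, y * S = quat (s * e) (s * d) a b &
      [/\ a \in pint, b \in pint & (a \notin pnil) || (b \notin pnil)]].
Proof.
case/(order_unitP F) => a [b [e [d [-> [aP bP eP dP] abN]]]].
by exists a, b, e, d; rewrite quat_mulr_S.
Qed.

Lemma odd_not_comm_i y : order_unit y -> ~ GRing.comm (y * S) i.
Proof.
case/odd_quat => a [b [e [d [_ -> [_ _ abN]]]]] /comm_i_quat[a0 b0].
by move: abN; rewrite a0 b0 pnil0.
Qed.

Lemma odd_anticomm_i y : order_unit y -> y * S * i = - (i * (y * S)) -> exists a b,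
  [/\ y = quat a b 0 0, y * S = quat 0 0 a b & (a ^+ 2 + b ^+ 2 \in pint) && (a ^+ 2 + b ^+ 2 \notin pnil)].
Proof.
case/odd_quat => a [b [e [d [-> -> [aP bP abN]]]]] /anticomm_i_quat[se sd].
have e0 : e = 0 by apply: (mulfI s_neq0); rewrite mulr0.
have d0 : d = 0 by apply: (mulfI s_neq0); rewrite mulr0.
exists a, b; rewrite e0 d0 mulr0; split=> //; apply/andP; split; first by pint_tac.
by apply: contraL abN => /(pnil3_sum_sqr aP bP)[-> ->].
Qed.

Lemma odd_sqr y : order_unit y -> exists2 y', order_unit y' & (y * S) * (y * S) = s *: y'.
Proof.
move=> yU; have [y' y'U SyE] := order_unit_conj_S F yU; exists (y * y').
  exact: (order_unitM F).
by rewrite -mulrA (mulrA S) SyE -mulrA SS mulr_algr -scalerAr.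
Qed.

Lemma odd_ratio y y' : order_unit y -> order_unit y' ->
  order_unit ((y * S) * (y' * S)^-1).
Proof.
move=> yU y'U; have [y'0 _ _] := y'U.
rewrite invrM ?D_div ?(frame_S_neq0 F) // mulrA mulrK //.
by apply: (order_unitM F) => //; exact: order_unitV.
Qed.

Lemma scalar_root8 (n : K) : n \in pint -> n ^+ 8 = 1 -> n = 1 \/ n = - 1.
Proof.
move=> nP; have no_i (m : K) : m \in pint -> m ^+ 2 != - 1.
  move=> mP; apply/eqP => m2; have : m ^+ 2 + 1 ^+ 2 \in pnil.
    by rewrite m2 expr1n addNr pnil0.
  by move/(pnil3_sum_sqr mP (pint1 _)) => [_]; rewrite pnil1.
rewrite (_ : 8 = 2 * 2 * 2)%N // !exprM => /eqP.
rewrite sqrf_eq1 => /orP[|]; last by rewrite (negPf (no_i _ _)) // pintX.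
rewrite sqrf_eq1 => /orP[|]; last by rewrite (negPf (no_i _ _)).
by rewrite sqrf_eq1 => /orP[/eqP|/eqP]; [left|right].
Qed.

(** A torsion element has valuation 0. If $x=\kappa^z yS$, then $x^4$ is a unit times
    $\kappa^{4z+2}$, and $4z+2$ is never 0. *)
Lemma torsion_order_unit x n : (0 < n)%N -> x ^+ n = 1 -> order_unit x.
Proof.
move=> n0 xn; have x0 : x != 0.
  by apply/eqP => x0; move/eqP: xn; rewrite x0 expr0n gtn_eqF // eq_sym oner_eq0.
have [z [x1 [xE [x1U|[y yU x1E]]]]] := order_unit_rep F kappaE x0.
  suff z0 : z = 0 by move: xE; rewrite z0 expr0z scale1r => ->.
  have x1n : x1 ^+ n = (kappa ^ (- (z * n)))%:A.
    have -> : x1 = kappa ^ (- z) *: x by rewrite xE scalerA -expfzDr // addNr expr0z scale1r.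
    by rewrite exprZn xn exprnP exprz_exp mulNr.
  have := order_unit_kappa F kappaE (order_unitX F n x1U) x1n.
  by move/eqP; rewrite oppr_eq0 mulf_eq0 eqz_nat (gtn_eqF n0) orbF => /eqP.
have [y' y'U yyE] := odd_sqr yU.
have x2 : x ^+ 2 = kappa ^ (z + z) *: (s *: y').
  by rewrite xE exprZn expr2 -expfzDr // -yyE -x1E expr2.
have x4 : x ^+ 4 = kappa ^ (z + z + (z + z) + 2%:Z) *: (y' * y').
  rewrite (_ : 4 = 2 * 2)%N // exprM x2 expr2 -!(scalerAl, scalerAr) !scalerA.
  congr (_ *: _); rewrite !expfzDr // -exprnP.
  have -> : kappa ^+ 2 = s * s by case: kappaE => ->; rewrite expr2 ?mulrNN.
  ring.
have yn : (y' * y') ^+ n = (kappa ^ (- ((z + z + (z + z) + 2%:Z) * n)))%:A.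
  set k := _ + 2%:Z in x4 *.
  have -> : y' * y' = kappa ^ (- k) *: x ^+ 4.
    by rewrite x4 scalerA -expfzDr // addNr expr0z scale1r.
  by rewrite exprZn exprAC xn expr1n exprnP exprz_exp mulNr.
have := order_unit_kappa F kappaE (order_unitX F n (order_unitM F y'U y'U)) yn.
by move/eqP; rewrite oppr_eq0 mulf_eq0 eqz_nat (gtn_eqF n0) orbF => /eqP; clear; lia.
Qed.

Section SaturatedUnits.
Variable P : D -> Prop.
Hypothesis PS : saturated kappa P.

Lemma sat_unit_torsion x : P x -> order_unit x -> exists2 n, (0 < n)%N & x ^+ n = 1.
Proof.
move=> /(sat_torsion PS)[n [z [n0 xn]]] xU; exists n => //.
have z0 := order_unit_kappa F kappaE (order_unitX F n xU) xn.
by rewrite xn z0 expr0z scale1r.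
Qed.

Lemma sat_topnil_cube x : P x -> order_unit x -> topnil (x - 1) -> x ^+ 3 = 1.
Proof.
move=> Px xU x1; have [n n0 xn] := sat_unit_torsion Px xU.
exact: (one_topnil_torsion F n0 x1 xn).
Qed.

Lemma sat_rep x : P x -> exists z x0, [/\ x = kappa ^ z *: x0, P x0 &
  (order_unit x0 \/ exists2 y, order_unit y & x0 = y * S)].
Proof.
move=> Px; have [z [x0 [xE x0P]]] := order_unit_rep F kappaE (sat_neq0 PS Px).
exists z, x0; split=> //; rewrite xE in Px; exact: (sat_unscale D_div k_neq0 PS Px).
Qed.

Hypothesis no_order3 : forall x, P x -> x ^+ 3 = 1 -> x = 1.

Lemma sat_unit_pow8 x : P x -> order_unit x -> x ^+ 8 = 1.
Proof.
move=> Px xU; apply: no_order3; first exact: (satX D_div k_neq0).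
apply: sat_topnil_cube; [exact: (satX D_div k_neq0) | exact: (order_unitX F) | exact: unit_pow8].
Qed.

(** A commutator of units is torsion and 1 modulo the maximal ideal, so its cube is 1, and elements
    of order 3 are excluded. *)
Lemma sat_unit_comm x y : P x -> P y -> order_unit x -> order_unit y -> GRing.comm x y.
Proof.
move=> Px Py xU yU; have [x0 _ _] := xU; have [y0 _ _] := yU.
have Pxy : P (x * y * x^-1 * y^-1).
  exact: (satM PS (satM PS (satM PS Px Py) (satV PS Px)) (satV PS Py)).
have xyU : order_unit (x * y * x^-1 * y^-1).
  have M := order_unitM F; have V := @order_unitV D i S.
  exact: (M _ _ (M _ _ (M _ _ xU yU) (V _ xU)) (V _ yU)).
have /no_order3 E := sat_topnil_cube Pxy xyU (unit_commutator xU yU).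
have := E Pxy => /(congr1 (fun z => z * y * x)).
by rewrite !divrK ?D_div // mul1r.
Qed.

End SaturatedUnits.

End Classification.

(** * Conjugating a subgroup without 3-torsion into the semidihedral one *)

Section Conjugacy.
Variables (D : falgType K) (i S : D) (c kappa rho : K).
Local Notation s := (- (3%:R * c ^+ 2)).
Hypothesis F : quaternion_frame i S c.
Hypothesis kappaE : kappa = s \/ kappa = - s.
Hypothesis rho2 : rho ^+ 2 = - 2%:R.
Local Notation quat := (quatern i S).
Local Notation topnil := (topnil i S).
Local Notation order_unit := (order_unit i S).
Local Notation w := (root8 i S rho).
Implicit Types (x y g t : D) (P : D -> Prop).

Let ii := frame_i F.
Let SS := frame_S F.
Let Si := frame_Si F.
Let D_div := frame_div F.
Let s_neq0 := frame_s_neq0 F.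
Let k_neq0 := kappa_neq0 F kappaE.
Let SU : S \is a GRing.unit := D_div (frame_S_neq0 F).
Let two_neq0 : 2%:R != 0 :> K. Proof. exact: padic_natr_neq0. Qed.

(** The preimage in $D^\times$ of the semidihedral group of order 16. *)
Definition sd16_cover x := exists (z : int) k,
  x = kappa ^ z *: w ^+ k \/ x = kappa ^ z *: (w ^+ k * S).

Lemma sd16_coverZ (z : int) x : sd16_cover x -> sd16_cover (kappa ^ z *: x).
Proof.
by move=> [z' [k [->|->]]]; exists (z + z'), k; [left|right]; rewrite scalerA expfzDr.
Qed.

Lemma w_unit0 : w \is a GRing.unit.
Proof. exact/D_div/(w_neq0 F rho2). Qed.

(* Hilbert 90 for the unramified quadratic extension. *)
Lemma unramified_hilbert90 a b : a ^+ 2 + b ^+ 2 = 1 :> K ->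
  exists a' b', quat a' b' 0 0 != 0 /\
    quat a' b' 0 0 * quat a b 0 0 = quat a' (- b') 0 0.
Proof.
(* The usual resolvent $1+\bar{x}$ for $x=a+bi$, replaced by $i$ when it vanishes, that is, when
   $x=-1$. *)
move=> ab1; have [a1|a1] := eqVneq (1 + a) 0.
  have aE : a = -1 by apply/eqP; rewrite -addr_eq0 addrC a1.
  have b0 : b = 0.
    by apply/eqP; rewrite -sqrf_eq0; apply/eqP/(addrI (a ^+ 2)); rewrite ab1 aE sqrrN expr1n addr0.
  exists 0, 1; rewrite -(quat_i i S); split.
    by apply/eqP => i0; move/eqP: ii; rewrite i0 mul0r eq_sym oppr_eq0 oner_eq0.
  by rewrite (mulr_i_quat _ ii) aE b0 oppr0.
exists (1 + a), (- b); split.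
  apply/eqP; rewrite (_ : 0 = quat 0 0 0 0); last by rewrite /quatern !scale0r !addr0.
  by move/(frame_inj F) => [/eqP]; rewrite (negPf a1).
rewrite (frame_quatM F); congr quatern; rewrite ?(mulr0, mul0r, subr0, addr0) //.
  by rewrite mulrDl mul1r mulNr opprK -!expr2 -addrA ab1 addrC.
by ring.
Qed.

(* Every odd element anticommuting with i is conjugate to S or w S. *)
Lemma odd_conj t y : order_unit y -> t = y * S -> t * i = - (i * t) ->
    (exists n, n \in [:: 1; - 1] /\ t * t = (n * s)%:A) ->
  exists g k, [/\ g != 0, GRing.comm g w & g * t = w ^+ k * S * g].
Proof.
move=> yU tE ti [n [nP tt]]; rewrite tE in ti tt *.
have [a [b [yE ySE _]]] := odd_anticomm_i F yU ti.
have nE : n = a ^+ 2 + b ^+ 2.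
  move: tt; rewrite ySE (frame_quatM F) (quat_scalar i S) => /(frame_inj F)[E _ _ _].
  by apply: (mulIf s_neq0); rewrite -E; ring.
have conjS a' b' : quat a' (- b') 0 0 * S = S * quat a' b' 0 0.
  by rewrite (conj_S_quat F) oppr0.
move: nP; rewrite !inE => /orP[/eqP n1|/eqP n1].
  have [|a' [b' [g0 gE]]] := @unramified_hilbert90 a b; first by rewrite -nE.
  exists (quat a' b' 0 0), 0%N; split=> //; first exact: (unramified_comm F).
  by rewrite yE mulrA gE conjS expr0 mul1r.
(* Here $a+bi$ has norm $-1$, like [w], so it is [w] times an element of norm 1. *)
pose r := rho^-1; have r2 : r * r = - 2%:R^-1 by rewrite -invfM -expr2 rho2 invrN.
have lE : quat a b 0 0 = w * quat (- (r * a + r * b)) (- (r * b - r * a)) 0 0.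
  have rr e : e = - (2%:R * (r * r)) * e by rewrite r2 mulrN opprK mulfV // mul1r.
  rewrite /root8 -/r (frame_quatM F) {1}(rr a) {1}(rr b); congr quatern; ring.
have [|a' [b' [g0 gE]]] :=
    @unramified_hilbert90 (- (r * a + r * b)) (- (r * b - r * a)).
  transitivity (2%:R * (r * r) * (a ^+ 2 + b ^+ 2)); first by ring.
  by rewrite r2 -nE n1 mulrN1 mulrN opprK mulfV.
have gw : GRing.comm (quat a' b' 0 0) w by exact: (unramified_comm F).
exists (quat a' b' 0 0), 1%N; split=> //.
by rewrite yE lE !mulrA gw -(mulrA w) gE expr1 -!mulrA conjS.
Qed.

Section NoOrder3.
Variable P : D -> Prop.
Hypothesis PS : saturated kappa P.
Hypothesis no_order3 : forall x, P x -> x ^+ 3 = 1 -> x = 1.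

Lemma kappa_s_cases z : P (s *: z) -> P z \/ P (- z).
Proof.
move=> Psz; have E : kappa *: z = s *: z \/ kappa *: (- z) = s *: z.
  by case: kappaE => ->; [left | right; rewrite scalerN scaleNr opprK].
case: E => E; [left | right];
by apply: (sat_unscale D_div k_neq0 PS (z := 1)); rewrite expr1z E.
Qed.

Lemma conj_cover g : g != 0 ->
    (forall x, P x -> order_unit x -> sd16_cover (g * x * g^-1)) ->
    (forall y, order_unit y -> P (y * S) -> sd16_cover (g * (y * S) * g^-1)) ->
  forall x, P x -> sd16_cover (g * x * g^-1).
Proof.
move=> g0 gU gS x Px; have [z [x0 [-> Px0 x0E]]] := sat_rep F kappaE PS Px.
rewrite -scalerAr -scalerAl; apply: sd16_coverZ.
by case: x0E => [|[y yU x0E]]; [exact: gU | rewrite x0E; apply: gS => //; rewrite -x0E].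
Qed.

(** Units of [P] commute with $i$, hence are powers of [w]. For an odd [t] in [P], $tit^{-1}$ is $i$
    or $-i$, and the sign $+$ is impossible in odd valuation; [odd_conj] carries [t] to [S] or [wS]
    without moving [w]. Any other odd element is [t] times a unit of [P]. *)
Lemma sd16_case_i : P i ->
  exists2 g, g != 0 & forall x, P x -> sd16_cover (g * x * g^-1).
Proof.
move=> Pi; have inW x : P x -> order_unit x -> exists k, x = w ^+ k.
  move=> Px xU; have xi := sat_unit_comm F kappaE PS no_order3 Px Pi xU (order_unit_i F).
  have x8 := sat_unit_pow8 F kappaE PS no_order3 Px xU.
  have [a [b [e [d [xE _ _]]]]] := order_unitP F xU; rewrite xE in xi x8 *.
  by have [e0 d0] := comm_i_quat F xi; rewrite e0 d0 in x8 *; exact: (unramified_root8 F rho2).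
case: (pselect (exists2 y, order_unit y & P (y * S))) => [[y yU Pt]|noS]; last first.
  exists 1; rewrite ?oner_neq0 //; apply: conj_cover; rewrite ?oner_neq0 //.
    by move=> x Px /(inW x Px)[k ->]; exists 0, k; left; rewrite mul1r invr1 mulr1 expr0z scale1r.
  by move=> y yU Py; case: noS; exists y.
have [t tE] : exists t, t = y * S by exists (y * S).
rewrite -tE in Pt; have t0 := sat_neq0 PS Pt; have tU := D_div t0.
have ratio y' : order_unit y' -> order_unit (y' * S * t^-1).
  by move=> y'U; rewrite tE; exact: (odd_ratio F).
have tiP : P (t * i * t^-1) by apply: (satM PS (satM PS Pt Pi) (satV PS Pt)).
have titi : (t * i * t^-1) * (t * i * t^-1) = - 1.
  by rewrite !mulrA divrK // -(mulrA t) ii mulrN1 mulNr divrr.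
have tiU : order_unit (t * i * t^-1).
  apply: (@torsion_order_unit _ _ _ _ _ F kappaE _ 4) => //.
  by rewrite (_ : 4 = 2 * 2)%N // exprM !expr2 titi mulrNN mulr1.
have tic := sat_unit_comm F kappaE PS no_order3 tiP Pi tiU (order_unit_i F).
have ti : t * i = - (i * t).
  have : (t * i * t^-1 - i) * (t * i * t^-1 + i) = 0.
    by rewrite mulrBl !mulrDr titi ii tic [- 1 + _]addrC subrr.
  case/(div_mulr_eq0 D_div) => /eqP; rewrite ?subr_eq0 ?addr_eq0 => /eqP tiE.
    case: (odd_not_comm_i F yU); rewrite /GRing.comm -tE -[in RHS]tiE divrK //.
  by rewrite -mulNr -tiE divrK.
(* $t^2=ns$, where $n$ or $-n$ is a scalar unit in [P], hence $n$ is an eighth root of unity in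
   $\mathbb{Z}_3$. *)
have nP : exists n, n \in [:: 1; - 1] /\ t * t = (n * s)%:A.
  have [a [b [_ ySE /andP[nP nN]]]] : exists a b, [/\ y = quat a b 0 0, y * S = quat 0 0 a b
      & (a ^+ 2 + b ^+ 2 \in pint) && (a ^+ 2 + b ^+ 2 \notin pnil)].
    by apply: (odd_anticomm_i F yU); rewrite -tE.
  have tt : t * t = s *: ((a ^+ 2 + b ^+ 2)%:A).
    by rewrite tE ySE (frame_quatM F) scalerA (quat_scalar i S); congr quatern; ring.
  exists (a ^+ 2 + b ^+ 2); split; last by rewrite tt scalerA mulrC.
  have nU : order_unit (a ^+ 2 + b ^+ 2)%:A.
    by apply: (order_unitZ F) => //; exact: (order_unit1 i S).
  suff : ((a ^+ 2 + b ^+ 2)%:A : D) ^+ 8 = 1.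
    rewrite exprZn expr1n => /eqP; rewrite -subr_eq0 -[X in _ - X]scale1r -scalerBl.
    rewrite scaler_eq0 oner_eq0 orbF subr_eq0 => /eqP /(scalar_root8 nP)[->|->];
    by rewrite !inE eqxx ?orbT.
  have := satM PS Pt Pt; rewrite tt => /kappa_s_cases[Pn|Pn].
    exact: (sat_unit_pow8 F kappaE PS no_order3).
  have := sat_unit_pow8 F kappaE PS no_order3 Pn (order_unitN F nU).
  by rewrite exprNn -signr_odd mul1r.
have [g [k [g0 gw gt]]] := odd_conj yU tE ti nP.
have gU := D_div g0.
have gwk l : g * w ^+ l * g^-1 = w ^+ l.
  by have /(_ l) := commrX _ gw; rewrite /GRing.comm => ->; rewrite mulrK.
exists g => //; apply: conj_cover => // [x Px xU|y' y'U Py'].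
  by have [l ->] := inW x Px xU; exists 0, l; left; rewrite gwk expr0z scale1r.
have [l yyE] := inW _ (satM PS Py' (satV PS Pt)) (ratio y' y'U).
exists 0, (l + k)%N; right; rewrite expr0z scale1r.
have -> : y' * S = w ^+ l * t by rewrite -yyE divrK.
rewrite mulrA; have -> : g * w ^+ l = w ^+ l * g by rewrite -{2}(gwk l) divrK.
by rewrite -(mulrA _ g) gt (mulrA (w ^+ l)) mulrK // (mulrA (w ^+ l)) exprD.
Qed.

(** The units of [P] are now $\pm 1$, so an odd element has square $\pm s$, which is also the square
    of [S] or of [wS]; Skolem-Noether conjugates one into the other. *)
Lemma sd16_case_no_i : (forall x, P x -> x * x <> - 1) ->
  exists2 g, g != 0 & forall x, P x -> sd16_cover (g * x * g^-1).
Proof.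
move=> noi; have pm1 x : P x -> order_unit x -> x = 1 \/ x = - 1.
  move=> Px xU; have x8 := sat_unit_pow8 F kappaE PS no_order3 Px xU.
  have : (x ^+ 4) * (x ^+ 4) = 1 by rewrite -exprD.
  case/(sqr_eq1 D_div) => x4; last first.
    case: (noi (x ^+ 2)); first exact: (satX D_div k_neq0).
    by rewrite -exprD.
  have : (x ^+ 2) * (x ^+ 2) = 1 by rewrite -exprD.
  case/(sqr_eq1 D_div); rewrite expr2; first exact: (sqr_eq1 D_div).
  by move/(noi x Px).
have cov1 x : x = 1 \/ x = - 1 -> sd16_cover x.
  case=> ->; first by exists 0, 0%N; left; rewrite expr0z expr0 scale1r.
  by exists 0, 4%N; left; rewrite expr0z scale1r (w4 F rho2).
case: (pselect (exists2 y, order_unit y & P (y * S))) => [[y yU Pt]|noS]; last first.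
  exists 1; rewrite ?oner_neq0 //; apply: conj_cover; rewrite ?oner_neq0 //.
    by move=> x Px /(pm1 x Px) x1; rewrite mul1r invr1 mulr1; exact: cov1.
  by move=> y yU Py; case: noS; exists y.
have [t tE] : exists t, t = y * S by exists (y * S).
rewrite -tE in Pt; have t0 := sat_neq0 PS Pt; have tU := D_div t0.
have ratio y' : order_unit y' -> order_unit (y' * S * t^-1).
  by move=> y'U; rewrite tE; exact: (odd_ratio F).
have [y' y'U tt] := odd_sqr F yU; rewrite -tE in tt.
have [k [n [ttn wSn]]] : exists k n, t * t = n%:A /\ (w ^+ k * S) * (w ^+ k * S) = n%:A.
  have y'1 : y' = 1 \/ y' = - 1.
    have := satM PS Pt Pt; rewrite tt => /kappa_s_cases[Py'|Py']; first exact: pm1.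
    case: (pm1 _ Py' (order_unitN F y'U)) => E; [right|left].
      by rewrite -E opprK.
    by apply: oppr_inj.
  case: y'1 => y'E; rewrite y'E in tt.
    by exists 0%N, s; rewrite expr0 mul1r.
  exists 1%N, (- s); split; first by rewrite tt scalerN -scaleNr.
  rewrite mulrA -(mulrA _ S) (S_w F rho2) mulrA -exprD -mulrA SS.
  by rewrite -[(1 + 3 * 1)%N]/4%N (w4 F rho2) mulN1r -scaleNr.
have [g g0 gt] : exists2 g, g != 0 & g * t = w ^+ k * S * g.
  apply: (skolem_noether ttn wSn); exists i; apply/eqP.
  by rewrite tE; exact: (odd_not_comm_i F yU).
have gU := D_div g0.
have gpm x : x = 1 \/ x = - 1 -> g * x * g^-1 = x.
  by case=> ->; rewrite ?mulrN ?mulNr mulr1 divrr.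
exists g => //; apply: conj_cover => // [x Px xU|y2 y2U Py2].
  by have x1 := pm1 x Px xU; rewrite gpm //; exact: cov1.
have x1 := pm1 _ (satM PS Py2 (satV PS Pt)) (ratio y2 y2U).
have -> : y2 * S = (y2 * S * t^-1) * t by rewrite divrK.
have gtS : g * t * g^-1 = w ^+ k * S by rewrite gt mulrK.
case: x1 => ->; first by rewrite mul1r gtS; exists 0, k; right; rewrite expr0z scale1r.
rewrite mulN1r mulrN mulNr gtS; exists 0, (4 + k)%N; right.
by rewrite expr0z scale1r exprD (w4 F rho2) mulN1r mulNr.
Qed.

End NoOrder3.

Theorem sd16_case P : saturated kappa P ->
    (forall x, P x -> x ^+ 3 = 1 -> x = 1) ->
  exists2 g, g != 0 & forall x, P x -> sd16_cover (g * x * g^-1).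
Proof.
move=> PS no3; case: (pselect (exists2 x, P x & x * x = - 1)) => [[j Pj jj]|noj]; last first.
  by apply: sd16_case_no_i => // x Px xx; case: noj; exists x.
have [g g0 gj] : exists2 g, g != 0 & g * j = i * g.
  apply: (@skolem_noether _ _ _ _ (- 1)); rewrite ?scaleN1r //.
  have jU : order_unit j.
    apply: (@torsion_order_unit _ _ _ _ _ F kappaE j 4) => //.
    by rewrite (_ : 4 = 2 * 2)%N // exprM !expr2 jj mulrNN mulr1.
  have [a [b [e [d [jE [aP _ _ _] _]]]]] := order_unitP F jU.
  (* A central [j] would be an element of $\mathbb{Z}_3$ with square $-1$. *)
  apply: contrapT => jc; have {}jc z : j * z = z * j.
    by apply/eqP/negPn/negP => jz; apply: jc; exists z.
  have [e0 d0] : e = 0 /\ d = 0.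
    by apply: (comm_i_quat F (a := a) (b := b)); rewrite -jE; exact: jc.
  have := jc S; rewrite jE e0 d0 (quat_mulr_S F) (mulr_S_quat SS Si).
  move/(frame_inj F) => [_ _ _ bE]; have b0 : b = 0 by apply: half_eq0.
  move: jj; rewrite jE e0 d0 b0 (frame_quatM F) (quat_1 i S) quatN => /(frame_inj F)[aa _ _ _].
  have [|_] := pnil3_sum_sqr aP (pint1 _); last by rewrite pnil1.
  have -> : a ^+ 2 + 1 ^+ 2 = 0; last exact: pnil0.
  by transitivity (- 1 + 1 : K); [rewrite -aa; ring | rewrite addNr].
have gU := D_div g0.
have jE : g * j * g^-1 = i by rewrite gj mulrK.
have [||h h0 hP] := sd16_case_i (saturated_conj D_div g0 PS).
- move=> x Px x3; have gV0 : g^-1 != 0 by rewrite invr_eq0.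
  have := conj_exp D_div x 3 gV0; rewrite invrK x3 mulr1 mulVr // => /(no3 _ Px).
  by move/(congr1 (fun z => g * z * g^-1)); rewrite !mulrA divrr // mul1r mulrK // mulr1 divrr.
- by rewrite -jE; exact: (conj_byK D_div).
exists (h * g); first by apply/eqP => /(div_mulr_eq0 D_div)[/eqP|/eqP]; apply/negP.
move=> x Px; have := hP _ (conj_byK D_div g0 Px).
by rewrite invrM ?D_div // !mulrA.
Qed.

End Conjugacy.

(** * The ramified subfield $\mathbb{Q}_3(S)$ and cube roots of unity *)

Section Ramified.
Variables (D : falgType K) (i S : D) (c kappa : K).
Local Notation s := (- (3%:R * c ^+ 2)).
Hypothesis F : quaternion_frame i S c.
Hypothesis kappaE : kappa = s \/ kappa = - s.
Local Notation quat := (quatern i S).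
Local Notation topnil := (topnil i S).
Local Notation order_unit := (order_unit i S).
Implicit Types (x y g t f : D) (P : D -> Prop).

Let ii := frame_i F.
Let SS := frame_S F.
Let Si := frame_Si F.
Let D_div := frame_div F.
Let cP := frame_c F.
Let cN := frame_cN F.
Let s_neq0 := frame_s_neq0 F.
Let k_neq0 := kappa_neq0 F kappaE.
Let SU : S \is a GRing.unit := D_div (frame_S_neq0 F).
Let two_neq0 : 2%:R != 0 :> K. Proof. exact: padic_natr_neq0. Qed.
Let three_neq0 : 3%:R != 0 :> K. Proof. exact: padic_natr_neq0. Qed.
Let c_neq0 : c != 0.
Proof. by apply: contraNneq cN => ->; exact: pnil0. Qed.
Let half : 2%:R^-1 + 2%:R^-1 = 1 :> K.
Proof. rewrite -[X in X + _ = _]mul1r -[X in _ + X = _]mul1r -mulrDl. by rewrite mulfV. Qed.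

(** This is $(-1+S/c)/2$ with $(S/c)^2=-3$, a primitive cube root of unity. *)
Definition root3 := quat (- 2%:R^-1) 0 (2%:R * c)^-1 0.
Local Notation zeta := root3.

Lemma ramified_comm a b a' b' : GRing.comm (quat a 0 b 0) (quat a' 0 b' 0).
Proof. by rewrite /GRing.comm !(frame_quatM F); congr quatern; ring. Qed.

Let ce : c * (2%:R * c)^-1 = 2%:R^-1.
Proof. by rewrite invfM mulrCA mulfV // mulr1. Qed.

Lemma zeta_S : S = c *: (zeta *+ 2 + 1).
Proof.
rewrite -[zeta *+ 2]scaler_nat (quat_1 i S) !quatZ quatD quatZ [LHS](quat_S i S).
congr quatern; rewrite ?(mulr0, addr0) //; last by rewrite mulrCA ce mulfV.
by rewrite mulrN mulfV // addNr mulr0.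
Qed.

Lemma zeta_sqr : zeta * zeta = - 1 - zeta.
Proof.
rewrite /zeta (frame_quatM F) (quat_1 i S) !quatN quatD; move: (2%:R^-1) half ce => h hh ch.
set e := _^-1 in ch *; congr quatern; try ring.
  transitivity (h * h - 3%:R * ((c * e) * (c * e))); first by ring.
  rewrite ch; transitivity (- ((h + h) * h)); first by ring.
  by rewrite hh mul1r -[in RHS]hh; ring.
transitivity (- ((h + h) * e)); first by ring.
by rewrite hh; ring.
Qed.

Lemma zeta3 : zeta ^+ 3 = 1.
Proof.
rewrite !exprS expr0 mulr1 zeta_sqr mulrBr mulrN1 zeta_sqr opprB.
by rewrite opprK [zeta + 1]addrC addrCA addNr addr0.
Qed.

Lemma zeta_scalar_comm x : GRing.comm x zeta -> GRing.comm x S.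
Proof.
by move=> xz; rewrite [X in GRing.comm _ X]zeta_S; apply: commrZ; apply: commrD; [exact: commrMn | exact: commr1].
Qed.

Lemma order_unit_zeta : order_unit zeta.
Proof.
have two_pint : 2%:R^-1 \in @pint prime3 := half_pint.
apply: (order_unit_quat F); rewrite ?pint0 ?invfM //; try by pint_tac.
  by apply: pintM => //; exact: pint_inv.
rewrite rpredN; apply/orP; left; apply: contraFN (pnil1 prime3) => hN.
by rewrite -half; exact: pnilD.
Qed.

Lemma zeta_neq1 : zeta != 1.
Proof.
apply/eqP; rewrite [RHS](quat_1 i S) => /(frame_inj F)[/eqP + _ _ _].
rewrite -subr_eq0 -opprD oppr_eq0 => /eqP E.
have : 3%:R = 0 :> K; last by apply/eqP.
have -> : 3%:R = 2%:R * (2%:R^-1 + 1) :> K by rewrite mulrDr mulfV //; ring.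
by rewrite E mulr0.
Qed.

Lemma i_zeta : i * zeta = zeta ^+ 2 * i.
Proof.
rewrite expr2 zeta_sqr /zeta (quat_1 i S) !quatN quatD (mulr_i_quat _ ii) (quat_mulr_i F).
congr quatern; rewrite ?(oppr0, addr0, sub0r, opprK) //.
by rewrite -{2}half; ring.
Qed.

Lemma S_i : S * i = i ^+ 3 * S.
Proof. by rewrite Si !exprS expr0 mulr1 ii mulrN1 mulNr. Qed.

Lemma S_zeta : GRing.comm S zeta.
Proof. by rewrite [X in GRing.comm X _](quat_S i S); exact: ramified_comm. Qed.

(** The preimage in $D^\times$ of the subgroup of order 24. *)
Definition c3_cover x := exists (z : int) k l e, x = kappa ^ z *: (zeta ^+ k * i ^+ l * S ^+ e).

Lemma c3_coverZ (z : int) x : c3_cover x -> c3_cover (kappa ^ z *: x).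
Proof. by move=> [z' [k [l [e ->]]]]; exists (z + z'), k, l, e; rewrite scalerA expfzDr. Qed.

Lemma c3_coverM x y : c3_cover x -> c3_cover y -> c3_cover (x * y).
Proof.
move=> [z [k [l [e ->]]]] [z' [k' [l' [e' ->]]]].
exists (z + z'), (k + k' * 2 ^ l)%N, (l + l' * 3 ^ e)%N, (e + e')%N.
rewrite -scalerAl -scalerAr scalerA -expfzDr //; congr (_ *: _).
have Se m : S ^+ e * zeta ^+ m = zeta ^+ m * S ^+ e.
  by apply/commrX/commr_sym/commrX/commr_sym/S_zeta.
have mul4 (p q r p' q' r' u v : D) : r * p' = p' * r -> q * p' = u * q -> r * q' = v * r ->
    p * q * r * (p' * q' * r') = (p * u) * (q * v) * (r * r').
  move=> rp qp rq; rewrite !mulrA -(mulrA (p * q)) rp !mulrA -(mulrA p q) qp !mulrA.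
  by rewrite -(mulrA _ r q') rq !mulrA.
rewrite (mul4 _ _ _ _ _ _ (zeta ^+ (k' * 2 ^ l)) (i ^+ (l' * 3 ^ e))) -?exprD //.
  exact: (cyc_conj i_zeta).
exact: (cyc_conj S_i).
Qed.

Lemma c3_cover_neg x : c3_cover x -> c3_cover (- x).
Proof.
rewrite -mulN1r => xC; apply: c3_coverM => //; exists 0, 0%N, 2%N, 0%N.
by rewrite expr0z scale1r !expr0 mul1r mulr1 expr2 ii.
Qed.

Lemma c3_cover_zeta k : c3_cover (zeta ^+ k).
Proof. by exists 0, k, 0%N, 0%N; rewrite expr0z scale1r !expr0 !mulr1. Qed.

Lemma c3_cover_i : c3_cover i.
Proof. by exists 0, 0%N, 1%N, 0%N; rewrite expr0z scale1r !expr0 mul1r mulr1. Qed.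

Lemma c3_cover_S : c3_cover S.
Proof. by exists 0, 0%N, 0%N, 1%N; rewrite expr0z scale1r !expr0 !mul1r. Qed.

Lemma comm_S_quat a b e d : quat a b e d * S = S * quat a b e d -> b = 0 /\ d = 0.
Proof.
rewrite (quat_mulr_S F) (mulr_S_quat SS Si) => /(frame_inj F)[_ dE _ bE].
have b0 : b = 0 by exact: half_eq0.
split=> //; apply: (mulfI s_neq0); rewrite mulr0; apply: half_eq0.
by rewrite {1}dE mulNr.
Qed.

Lemma anticomm_S_quat a b e d : quat a b e d * S = - (S * quat a b e d) -> a = 0 /\ e = 0.
Proof.
rewrite (quat_mulr_S F) (mulr_S_quat SS Si) quatN => /(frame_inj F)[eE _ aE _].
split; first exact: half_eq0.
by apply: (mulfI s_neq0); rewrite mulr0; apply: half_eq0.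
Qed.

Lemma cube_root_sqr x : x ^+ 3 = 1 -> x != 1 -> x * x + x + 1 = 0.
Proof.
move=> x3 x1; have : (x - 1) * (x * x + x + 1) = 0.
  have -> : x * x + x + 1 = \sum_(j < 3) x ^+ j.
    by rewrite !big_ord_recr big_ord0 /= add0r expr0 expr1 expr2 [RHS]addrC [1 + x]addrC addrA.
  by rewrite -subrX1 x3 subrr.
by case/(div_mulr_eq0 D_div) => // /eqP; rewrite subr_eq0 (negPf x1).
Qed.

(** In $x^2+x+1=0$ the coordinates other than the first are $(2a+1)b$, $(2a+1)e$ and $(2a+1)d$. If
    $2a+1\neq 0$, then $x$ is a scalar and $(2a+1)^2=-3$, which the parity of valuations forbids; if
    $2a+1=0$, the first coordinate gives the second equation. *)
Lemma cube_root_trace a b e d : a \in pint -> quat a b e d ^+ 3 = 1 ->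
  quat a b e d != 1 -> a = - 2%:R^-1 /\ (b ^+ 2 - s * (e ^+ 2 + d ^+ 2) = 3%:R / 4%:R).
Proof.
move=> aP x3 x1; have := cube_root_sqr x3 x1.
rewrite (frame_quatM F) (quat_1 i S) !quatD => /(quat_eq0 ii SS Si two_neq0 s_neq0)[E0 E1 E2 E3].
have aE : a = - 2%:R^-1.
  have [a0|a0] := eqVneq (2%:R * a + 1) 0.
    by apply: (mulfI two_neq0); rewrite mulrN mulfV //; apply/eqP; rewrite -addr_eq0 a0.
  have b0 : b = 0 by apply: (mulfI a0); rewrite mulr0 -E1; ring.
  have e0 : e = 0 by apply: (mulfI a0); rewrite mulr0 -E2; ring.
  have d0 : d = 0 by apply: (mulfI a0); rewrite mulr0 -E3; ring.
  rewrite b0 e0 d0 in E0; exfalso.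
  have a3 : (2%:R * a + 1) ^+ 2 = - 3%:R.
    transitivity (4%:R * (a * a - 0 * 0 + s * (0 * 0 + 0 * 0) + a + 1) - 3%:R); first by ring.
    by rewrite E0 mulr0 add0r.
  have : 2%:R * a + 1 \in pnil.
    have tP : 2%:R * a + 1 \in pint by pint_tac.
    have := pnilN (pnil_p prime3); rewrite -[X in - X]/(3%:R) -a3 expr2.
    by case/(pnil_mul tP tP).
  case/pnilP => t tP tE; have {}tE : 2%:R * a + 1 = 3%:R * t := tE.
  have : 1 \in @pnil prime3; last by rewrite pnil1.
  have -> : 1 = 3%:R * - (t * t) :> K.
    apply: (mulfI three_neq0); rewrite mulr1 -[LHS]opprK -a3 tE; ring.
  by apply: pnilMr; [exact: pnil_p | pint_tac].
split=> //; have four : 4%:R != 0 :> K by exact: padic_natr_neq0.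
apply: (mulIf four); rewrite mulfVK //.
transitivity (4%:R * a * a + 4%:R * a + 4%:R - 4%:R * (a * a - b * b + s * (e * e + d * d) + a + 1)).
  by ring.
rewrite E0 mulr0 subr0 aE; transitivity (2%:R * 2%:R^-1 * (2%:R * 2%:R^-1) - 2%:R * (2%:R * 2%:R^-1) + 4%:R : K).
  by ring.
by rewrite mulfV //; ring.
Qed.

End Ramified.

(** * Subgroups containing $\zeta$: elements of order 3 and elements commuting with $S$ *)

Section RamifiedCase.
Variables (D : falgType K) (i S : D) (c kappa rho : K).
Local Notation s := (- (3%:R * c ^+ 2)).
Hypothesis F : quaternion_frame i S c.
Hypothesis kappaE : kappa = s \/ kappa = - s.
Local Notation quat := (quatern i S).
Local Notation topnil := (topnil i S).
Local Notation triple := (triple i S).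
Local Notation order_unit := (order_unit i S).
Local Notation zeta := (root3 i S c).
Local Notation c3_cover := (c3_cover i S c kappa).
Implicit Types (x y g t f : D) (P : D -> Prop).

Let ii := frame_i F.
Let SS := frame_S F.
Let Si := frame_Si F.
Let D_div := frame_div F.
Let s_neq0 := frame_s_neq0 F.
Let k_neq0 := kappa_neq0 F kappaE.
Let SU : S \is a GRing.unit := D_div (frame_S_neq0 F).
Let two_neq0 : 2%:R != 0 :> K. Proof. exact: padic_natr_neq0. Qed.
Let three_neq0 : 3%:R != 0 :> K. Proof. exact: padic_natr_neq0. Qed.

(** The group $1+3\mathbb{Z}_3$ is torsion-free, so a root of unity is determined by its residue. *)
Lemma scalar_torsion (n : K) m : n \in pint -> (0 < m)%N -> n ^+ m = 1 -> n = 1 \/ n = - 1.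
Proof.
move=> nP m0 nm.
have one (k : K) l : (0 < l)%N -> k ^+ l = 1 -> k - 1 \in pnil -> k = 1.
  move=> l0 kl k1; have : (k%:A : D) = 1.
    apply: (one_triple_torsion F l0); last by rewrite exprZn kl scale1r expr1n.
    exists (k - 1), 0, 0, 0; split; rewrite ?pnil0 //.
    by rewrite (quat_scalar i S) (quat_1 i S) quatN quatD !subr0.
  by rewrite (quat_scalar i S) [RHS](quat_1 i S) => /(frame_inj F)[].
case/or3P: (pint3_residue nP) => h; [|by left; exact: (one n m)|].
  have : n ^+ m \in pnil by case: (m) m0 => // l _; rewrite exprS; apply: pnilMr => //; exact: pintX.
  by rewrite nm pnil1.
right; apply: oppr_inj; rewrite opprK; apply: (one (- n) (2 * m)%N); first by rewrite muln_gt0.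
  by rewrite exprM sqrrN -exprM mulnC exprM nm expr1n.
by rewrite -opprD; exact: pnilN.
Qed.

Lemma ramified_cube_root f : GRing.comm f zeta -> f ^+ 3 = 1 ->
  exists k, f = zeta ^+ k.
Proof.
move=> fz f3; have [->|f1] := eqVneq f 1; first by exists 0%N; rewrite expr0.
have ff := cube_root_sqr F f3 f1; have zz := cube_root_sqr F (zeta3 F) (zeta_neq1 F).
have : (f - zeta) * (f + zeta + 1) = 0.
  transitivity (f * f + f + 1 - (zeta * zeta + zeta + 1)); last by rewrite ff zz subrr.
  move: (zeta) fz => z fz; rewrite mulrBl !mulrDr !mulr1 -fz (addrAC _ (f * z)) -(addrA (f * z)).
  by rewrite addrKA [X in _ = _ - X]addrC addrKA.
case/(div_mulr_eq0 D_div) => /eqP; first by rewrite subr_eq0 => /eqP ->; exists 1%N; rewrite expr1.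
rewrite -addrA addr_eq0 opprD => /eqP ->; exists 2%N.
by rewrite expr2 (zeta_sqr F) addrC.
Qed.

(** The residue field of $\mathbb{Q}_3(S)$ is $\mathbb{F}_3$, so up to sign the element is 1 modulo
    the maximal ideal and its cube is 1. *)
Lemma ramified_unit_root a e n : order_unit (quat a 0 e 0) -> (0 < n)%N ->
  quat a 0 e 0 ^+ n = 1 -> exists k, quat a 0 e 0 = zeta ^+ k \/ quat a 0 e 0 = - zeta ^+ k.
Proof.
move=> fU n0 fn; have [a' [b' [e' [d' [E [aP _ eP _] abN]]]]] := order_unitP F fU.
have [aE bE eE _] := frame_inj F E; rewrite -aE -bE -eE pnil0 orbF in aP eP abN.
have root (a1 e1 : K) m : (0 < m)%N -> e1 \in pint -> a1 - 1 \in pnil ->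
    quat a1 0 e1 0 ^+ m = 1 -> exists k, quat a1 0 e1 0 = zeta ^+ k.
  move=> m0 e1P a1N fm; apply: ramified_cube_root; first exact: (ramified_comm F).
  apply: (one_topnil_torsion F m0 _ fm).
  exists (a1 - 1), 0, e1, 0; split; rewrite ?pnil0 ?pint0 //.
  by rewrite (quat_1 i S) quatN quatD !subr0.
have := pint3_residue aP; rewrite (negPf abN) /= => /orP[a1|a1].
  by have [k ->] := root a e n n0 eP a1 fn; exists k; left.
have fE : quat a 0 e 0 = - quat (- a) 0 (- e) 0 by rewrite quatN !opprK oppr0.
have n2 : (0 < 2 * n)%N by rewrite muln_gt0.
have a1N : - a - 1 \in pnil by rewrite -opprD; exact: pnilN.
have fn2 : quat (- a) 0 (- e) 0 ^+ (2 * n) = 1.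
  by rewrite exprM -sqrrN -fE -exprM mulnC exprM fn expr1n.
have [k kE] := root _ _ _ n2 (pintN eP) a1N fn2.
by exists k; right; rewrite fE kE.
Qed.

Section WithZeta.
Variable P : D -> Prop.
Hypothesis PS : saturated kappa P.
Hypothesis Pz : P zeta.

(** Elements of order 3 are 1 modulo the maximal ideal, so $\zeta x$ and $\zeta x^2$ have cube 1 as
    well. If neither is 1, then $\zeta$, $\zeta x$ and $\zeta x^2$ all have scalar part $-1/2$,
    although their sum $\zeta(1+x+x^2)$ is 0. *)
Lemma sat_cube_root x : P x -> x ^+ 3 = 1 -> x != 1 -> x = zeta \/ x = zeta ^+ 2.
Proof.
move=> Px x3 x1; have z3 := zeta3 F.
have xU : order_unit x by apply: (torsion_order_unit F kappaE _ x3).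
have zU := order_unit_zeta F.
have near1 y : order_unit y -> y ^+ 3 = 1 -> y != 1 -> topnil (y - 1).
  move=> yU y3 y1; have [a [b [e [d [yE [aP bP eP dP] _]]]]] := order_unitP F yU.
  rewrite yE in y3 y1 *; have [aE bed] := cube_root_trace F aP y3 y1.
  exists (a - 1), b, e, d; split=> //.
  - by rewrite (quat_1 i S) quatN quatD !subr0.
  - rewrite aE (_ : _ - 1 = 3%:R * - 2%:R^-1).
      by apply: pnilMr; [exact: pnil_p | apply: pintN; exact: half_pint].
    apply: (mulfI two_neq0); rewrite mulrBr !(mulrN, mulr1) mulrCA mulfV // mulr1; ring.
  suff [] : b \in pnil /\ (0 : K) \in pnil by [].
  apply: (pnil3_sum_sqr bP (pint0 _)).
  rewrite (_ : _ + _ = 3%:R * (4%:R^-1) + s * (e ^+ 2 + d ^+ 2)); last by rewrite -bed; ring.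
  apply: pnilD; last by apply: pnilMr; [exact: frame_s_pnil F | pint_tac].
  apply: pnilMr; first exact: pnil_p.
  by apply: pint_inv; rewrite ?pint_nat ?pnil3_nat.
have zx1 y : order_unit y -> P y -> topnil (y - 1) -> (zeta * y) ^+ 3 = 1.
  move=> yU Py y1; apply: (sat_topnil_cube F kappaE PS (satM PS Pz Py) (order_unitM F zU yU)).
  have -> : zeta * y - 1 = zeta * (y - 1) + (zeta - 1) by rewrite mulrBr mulr1 subrKA.
  apply: topnilD; last exact: (near1 _ zU z3 (zeta_neq1 F)).
  by apply: (topnilMl F) => //; case: zU.
have xN := near1 x xU x3 x1.
have xxU := order_unitM F xU xU; have Pxx := satM PS Px Px.
have xxN : topnil (x * x - 1).
  rewrite (_ : _ - 1 = x * (x - 1) + (x - 1)); last by rewrite mulrBr mulr1 subrKA.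
  by apply: topnilD => //; apply: (topnilMl F) => //; case: xU.
have u1 := zx1 _ xU Px xN; have u2 := zx1 _ xxU Pxx xxN.
have [zxE|zx] := eqVneq (zeta * x) 1.
  by right; rewrite -[x]mul1r -z3 exprSr -mulrA zxE mulr1.
have [zxxE|zxx] := eqVneq (zeta * (x * x)) 1.
  left; have <- : x ^+ 4 = x by rewrite exprS x3 mulr1.
  have xxE : x * x = zeta ^+ 2 by rewrite -[x * x]mul1r -z3 exprSr -mulrA zxxE mulr1.
  by rewrite (_ : 4 = 2 * 2)%N // exprM !expr2 xxE -exprD exprS z3 mulr1.
exfalso.
have trace y : order_unit y -> y ^+ 3 = 1 -> y != 1 -> exists b e d, y = quat (- 2%:R^-1) b e d.
  move=> yU y3 y1; have [a [b [e [d [yE [aP _ _ _] _]]]]] := order_unitP F yU.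
  rewrite yE in y3 y1 *; have [-> _] := cube_root_trace F aP y3 y1.
  by exists b, e, d.
have [b1 [e1 [d1 E1]]] := trace _ (order_unitM F zU xU) u1 zx.
have [b2 [e2 [d2 E2]]] := trace _ (order_unitM F zU xxU) u2 zxx.
have : zeta * x + zeta * (x * x) + zeta = 0.
  rewrite -mulrDr -{2}[zeta]mulr1 -mulrDr [x + _]addrC (cube_root_sqr F x3 x1) mulr0 //.
rewrite E1 E2 /root3 !quatD => /(quat_eq0 ii SS Si two_neq0 s_neq0)[E _ _ _].
have : 3%:R = 0 :> K; last by apply/eqP.
rewrite -[RHS]oppr0 -[in RHS](mulr0 2%:R) -E !(mulrDr, mulrN) mulfV //; ring.
Qed.

(** Such [f] lie in $\mathbb{Q}_3(S)$. A unit is some $\pm\zeta^k$. In odd valuation, $f=yS$ up to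
    $\kappa$ with $y^2=\pm\zeta^k$; then $y\zeta^k$ has square $\pm 1$, and $-1$ is not a square in
    the residue field $\mathbb{F}_3$. *)
Lemma sat_comm_S f : P f -> GRing.comm f S -> c3_cover f.
Proof.
move=> Pf fS; have [z [f0 [fE Pf0 f0E]]] := sat_rep F kappaE PS Pf.
have f0S : GRing.comm f0 S.
  have -> : f0 = kappa ^ (- z) *: f by rewrite fE scalerA -expfzDr // addNr expr0z scale1r.
  exact/commr_sym/commrZ/commr_sym.
rewrite fE; apply: c3_coverZ => //.
have cover_pm y k : y = zeta ^+ k \/ y = - zeta ^+ k -> c3_cover y.
  by case=> ->; [exact: c3_cover_zeta | apply: (c3_cover_neg F) => //; exact: c3_cover_zeta].
case: f0E => [f0U|[y yU yE]].
  have [n n0 fn] := sat_unit_torsion F kappaE PS Pf0 f0U.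
  have [a [b [e [d [E _ _]]]]] := order_unitP F f0U; rewrite E in f0S f0U fn *.
  have [b0 d0] := comm_S_quat F f0S; rewrite b0 d0 in f0U fn *.
  have [k kE] := ramified_unit_root f0U n0 fn; exact: cover_pm kE.
have yS : GRing.comm y S.
  by apply: (mulIr SU); rewrite -[RHS]mulrA -yE; exact: f0S.
have [a [b [e [d [E [aP _ _ _] abN]]]]] := order_unitP F yU.
have [b0 d0] : b = 0 /\ d = 0 by apply: (comm_S_quat F (a := a) (e := e)); rewrite -E.
rewrite b0 pnil0 orbF in abN; rewrite b0 d0 in E.
have ffE : f0 * f0 = s *: (y * y).
  by rewrite yE mulrA -(mulrA y S y) -yS mulrA -(mulrA (y * y)) SS mulr_algr.
have [k yyE] : exists k, y * y = zeta ^+ k \/ y * y = - zeta ^+ k.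
  have yyU := order_unitM F yU yU.
  have yyq : exists a' e', y * y = quat a' 0 e' 0.
    by rewrite E (frame_quatM F); do 2!eexists; congr quatern; ring.
  have [a' [e' yyq']] := yyq.
  have [n n0 yyn] : exists2 n, (0 < n)%N & (y * y) ^+ n = 1.
    have := satM PS Pf0 Pf0; rewrite ffE => /(kappa_s_cases F kappaE PS)[Py|Py].
      exact: (sat_unit_torsion F kappaE PS).
    have [n n0 yn] := sat_unit_torsion F kappaE PS Py (order_unitN F yyU).
    exists (2 * n)%N; first by rewrite muln_gt0.
    by rewrite exprM -sqrrN -exprM mulnC exprM yn expr1n.
  by rewrite yyq' in yyU yyn *; exact: (ramified_unit_root yyU n0 yyn).
have yz : GRing.comm y zeta by rewrite E; exact: (ramified_comm F).
pose g := y * zeta ^+ k.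
have gg : g * g = 1 \/ g * g = - 1.
  have -> : g * g = (y * y) * zeta ^+ (k + k).
    rewrite /g mulrA -(mulrA y) -(commrX k yz) mulrA -mulrA -exprD //.
  have z3k : zeta ^+ k * zeta ^+ (k + k) = 1.
    rewrite -exprD (_ : k + (k + k) = 3 * k)%N; last by lia.
    by rewrite exprM (zeta3 F) expr1n.
  by case: yyE => ->; [left | right; rewrite mulNr]; rewrite z3k.
have g1 : g = 1 \/ g = - 1.
  case: gg => [|gg]; first exact: (sqr_eq1 D_div).
  have gU : order_unit g by apply: (order_unitM F) => //; apply: (order_unitX F); exact: (order_unit_zeta F).
  have [a1 [b1 [e1 [d1 [gE [a1P _ e1P _] a1N]]]]] := order_unitP F gU.
  have gS : GRing.comm g S.
    apply/commr_sym/commrM; first exact/commr_sym.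
    by apply/commrX; exact: (S_zeta F).
  have [b10 d10] : b1 = 0 /\ d1 = 0 by apply: (comm_S_quat F (a := a1) (e := e1)); rewrite -gE.
  move: gg; rewrite gE b10 d10 (frame_quatM F) (quat_1 i S) quatN => /(frame_inj F)[aa _ _ _].
  exfalso; have [|_] := pnil3_sum_sqr a1P (pint1 _); last by rewrite pnil1.
  rewrite (_ : _ + _ = (a1 * a1 - 0 * 0 + s * (e1 * e1 + 0 * 0)) + 1 - s * e1 ^+ 2); last by ring.
  rewrite aa addNr sub0r; apply: pnilN; apply: pnilMr; [exact: frame_s_pnil F | pint_tac].
have yE' : y = g * zeta ^+ (2 * k).
  rewrite /g -mulrA -exprD (_ : k + 2 * k = 3 * k)%N; last by lia.
  by rewrite exprM (zeta3 F) expr1n mulr1.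
rewrite yE; apply: (c3_coverM F kappaE); last exact: c3_cover_S.
apply: (cover_pm _ (2 * k)%N); rewrite yE'.
by case: g1 => ->; [left; rewrite mul1r | right; rewrite mulN1r].
Qed.

(* Hilbert 90 for the ramified quadratic extension. *)
Lemma ramified_hilbert90 a e : a ^+ 2 - s * e ^+ 2 = 1 :> K ->
  exists a' e', quat a' 0 e' 0 != 0 /\
    quat a' 0 e' 0 * quat a 0 e 0 = quat a' 0 (- e') 0.
Proof.
move=> ab1; have [a1|a1] := eqVneq (1 + a) 0.
  have aE : a = -1 by apply/eqP; rewrite -addr_eq0 addrC a1.
  have e0 : e = 0.
    apply/eqP; rewrite -sqrf_eq0; apply/eqP/(mulfI s_neq0).
    by apply: oppr_inj; apply: (addrI (a ^+ 2)); rewrite ab1 aE mulr0 sqrrN expr1n subr0.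
  exists 0, 1; rewrite -(quat_S i S); split; first exact: (frame_S_neq0 F).
  by rewrite (mulr_S_quat SS Si) aE e0 !mulr0 oppr0.
exists (1 + a), (- e); split.
  apply/eqP; rewrite (_ : 0 = quat 0 0 0 0); last by rewrite /quatern !scale0r !addr0.
  by move/(frame_inj F) => [/eqP]; rewrite (negPf a1).
rewrite (frame_quatM F); congr quatern; try ring.
transitivity (a + (a ^+ 2 - s * e ^+ 2)); first by ring.
by rewrite ab1 addrC.
Qed.

End WithZeta.
End RamifiedCase.

(** * Conjugating any saturated subgroup into one of the two models *)

Section FiniteSubgroupClassification.
Variables (D : falgType K) (i S : D) (c kappa rho : K).
Local Notation s := (- (3%:R * c ^+ 2)).
Hypothesis F : quaternion_frame i S c.
Hypothesis kappaE : kappa = s \/ kappa = - s.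
Hypothesis rho2 : rho ^+ 2 = - 2%:R.
Local Notation quat := (quatern i S).
Local Notation order_unit := (order_unit i S).
Local Notation zeta := (root3 i S c).
Local Notation c3_cover := (c3_cover i S c kappa).
Local Notation sd16_cover := (sd16_cover i S kappa rho).
Implicit Types (x y g t f : D) (P : D -> Prop).

Let ii := frame_i F.
Let SS := frame_S F.
Let Si := frame_Si F.
Let D_div := frame_div F.
Let s_neq0 := frame_s_neq0 F.
Let k_neq0 := kappa_neq0 F kappaE.
Let SU : S \is a GRing.unit := D_div (frame_S_neq0 F).
Let two_neq0 : 2%:R != 0 :> K. Proof. exact: padic_natr_neq0. Qed.
Let three_neq0 : 3%:R != 0 :> K. Proof. exact: padic_natr_neq0. Qed.

Lemma norm_torsion_eq1 b d n : b \in pint -> d \in pint -> (0 < n)%N ->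
  (b ^+ 2 - s * d ^+ 2) ^+ n = 1 -> b ^+ 2 - s * d ^+ 2 = 1.
Proof.
move=> bP dP n0 Nn; have [|//|N1] := scalar_torsion F _ n0 Nn.
  by have := frame_s_pnil F => /pnilW sP; pint_tac.
exfalso; have [|_] := pnil3_sum_sqr bP (pint1 _); last by rewrite pnil1.
rewrite (_ : _ + _ = (b ^+ 2 - s * d ^+ 2) + 1 + s * d ^+ 2); last by ring.
by rewrite N1 addNr add0r; apply: pnilMr; [exact: frame_s_pnil F | pint_tac].
Qed.

(** $bi+d\,iS=(b-dS)i$, and Hilbert 90 in $\mathbb{Q}_3(S)$ applies to $b-dS$, of norm 1. *)
Lemma ramified_conj b d : b ^+ 2 - s * d ^+ 2 = 1 -> exists g,
  [/\ g != 0, GRing.comm g S, (forall a e, GRing.comm g (quat a 0 e 0)) & g * quat 0 b 0 d = i * g].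
Proof.
move=> bd1; have [|a' [e' [g0 gE]]] := ramified_hilbert90 F (a := b) (e := - d).
  by rewrite sqrrN.
exists (quat a' 0 e' 0); split=> //.
- by rewrite [X in GRing.comm _ X](quat_S i S); exact: (ramified_comm F).
- by move=> a e; exact: (ramified_comm F).
have -> : quat 0 b 0 d = quat b 0 (- d) 0 * i by rewrite (quat_mulr_i F) opprK oppr0.
by rewrite mulrA gE (quat_mulr_i F) (mulr_i_quat _ ii) opprK oppr0.
Qed.

Section WithZeta.
Variable P : D -> Prop.
Hypothesis PS : saturated kappa P.
Hypothesis Pz : P zeta.

(** By [sat_cube_root], conjugation by [x] fixes or inverts $\zeta$, hence fixes or negates
    $S=c(2\zeta+1)$. *)
Lemma sat_comm_or_anticomm x : P x -> GRing.comm x S \/ x * S = - (S * x).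
Proof.
move=> Px; have xU := D_div (sat_neq0 PS Px).
have := sat_cube_root F kappaE PS Pz (satM PS (satM PS Px Pz) (satV PS Px)).
rewrite (conj_exp D_div _ _ (sat_neq0 PS Px)) (zeta3 F) mulr1 divrr // => /(_ erefl)[].
- apply: contraNneq (zeta_neq1 F) => E; apply/eqP.
  by rewrite -[LHS](mulKr xU) -[x * zeta](divrK xU) E mul1r mulVr.
- move=> E; left; apply: (zeta_scalar_comm F); rewrite /GRing.comm.
  by rewrite -{2}E divrK.
move=> E; right; have xz : x * zeta = (- 1 - zeta) * x.
  by rewrite -(zeta_sqr F) -expr2 -E divrK.
rewrite [X in x * X](zeta_S F) [X in - (X * x)](zeta_S F) -scalerAr -scalerAl -scalerN.
congr (_ *: _); rewrite mulrDr mulrDl mulrnAr xz mulr1 mul1r mulrBl mulN1r mulrnAl.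
by rewrite mulrnBl mulNrn [RHS]opprD (mulr2n x) opprD addrAC subrK addrC.
Qed.

(** Only one anticommuting [f] has to be normalised: an element [g] of $\mathbb{Q}_3(S)$ carries it
    to $i$ or $iS$ and fixes the elements commuting with [S], and any other anticommuting element is
    one of these times [f]. *)
Lemma ramified_case : exists2 g, g != 0 & forall x, P x -> c3_cover (g * x * g^-1).
Proof.
case: (pselect (exists2 f, P f & f * S = - (S * f))) => [[f1 Pf1 f1S]|noanti]; last first.
  exists 1; rewrite ?oner_neq0 // => x Px; rewrite mul1r invr1 mulr1.
  apply: (sat_comm_S F kappaE PS Px).
  by case: (sat_comm_or_anticomm Px) => // xS; case: noanti; exists x.
have [z [f [f1E Pf fE]]] := sat_rep F kappaE PS Pf1.
have fS : f * S = - (S * f).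
  have -> : f = kappa ^ (- z) *: f1 by rewrite f1E scalerA -expfzDr // addNr expr0z scale1r.
  by rewrite -scalerAl -scalerAr f1S scalerN.
have f_unit := D_div (sat_neq0 PS Pf).
have sq b d : quat 0 b 0 d * quat 0 b 0 d = (- (b ^+ 2 - s * d ^+ 2))%:A.
  by rewrite (frame_quatM F) (quat_scalar i S); congr quatern; ring.
suff [g [g0 gC gf]] : exists g, [/\ g != 0,
    (forall a e, GRing.comm g (quat a 0 e 0)) & c3_cover (g * f * g^-1)].
  have gU := D_div g0.
  have fix_comm x : P x -> GRing.comm x S -> g * x * g^-1 = x.
    move=> Px xS; have [a [b [e [d xE]]]] := frame_surj F x; rewrite xE in xS *.
    by have [-> ->] := comm_S_quat F xS; rewrite gC mulrK.
  exists g => // x Px; case: (sat_comm_or_anticomm Px) => xS.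
    by rewrite fix_comm //; exact: (sat_comm_S F kappaE PS).
  have Pxf := satM PS Px (satV PS Pf).
  have fVS : f^-1 * S = - (S * f^-1).
    by apply: (mulrI f_unit); apply: (mulIr f_unit); rewrite mulVKr // mulrN mulNr mulrA fS !mulNr opprK divrK.
  have xfS : GRing.comm (x * f^-1) S.
    by rewrite /GRing.comm -mulrA fVS mulrN (mulrA x) xS mulNr opprK mulrA.
  have -> : g * x * g^-1 = (x * f^-1) * (g * f * g^-1).
    by rewrite -(fix_comm _ Pxf xfS) !mulrA divrK // divrK.
  by apply: (c3_coverM F kappaE) => //; exact: (sat_comm_S F kappaE PS).
case: fE => [fU|[y yU fE]].
  have [a [b [e [d [E [aP bP eP dP] _]]]]] := order_unitP F fU.
  have [a0 e0] : a = 0 /\ e = 0 by apply: (anticomm_S_quat F (b := b) (d := d)); rewrite -E.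
  have [n n0 fn] := sat_unit_torsion F kappaE PS Pf fU.
  have N1 : b ^+ 2 - s * d ^+ 2 = 1.
    apply: (@norm_torsion_eq1 b d (2 * n)) => //; first by rewrite muln_gt0.
    have : ((- (b ^+ 2 - s * d ^+ 2))%:A : D) ^+ n = 1.
      have fq : f = quat 0 b 0 d by rewrite E a0 e0.
      by rewrite -sq -fq -expr2 -exprM mulnC exprM fn expr1n.
    rewrite exprZn expr1n => Nn.
    have {}Nn : (- (b ^+ 2 - s * d ^+ 2)) ^+ n = 1.
      by move: Nn; rewrite (quat_scalar i S) [RHS](quat_1 i S) => /(frame_inj F)[].
    by rewrite exprM -sqrrN -exprM mulnC exprM Nn expr1n.
  have [g [g0 gS gC gE]] := ramified_conj N1.
  exists g; split=> //; rewrite E a0 e0 gE mulrK ?D_div //; exact: c3_cover_i.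
have yS : y * S = - (S * y).
  by apply: (mulIr SU); rewrite mulNr -[S * y * S]mulrA -fE; exact: fS.
have [a [b [e [d [E [aP bP eP dP] abN]]]]] := order_unitP F yU.
have [a0 e0] : a = 0 /\ e = 0 by apply: (anticomm_S_quat F (b := b) (d := d)); rewrite -E.
rewrite a0 e0 pnil0 /= in E abN.
have ffE : f * f = s *: (b ^+ 2 - s * d ^+ 2)%:A.
  rewrite fE mulrA -(mulrA y S y) -[S * y]opprK -yS mulrN mulNr mulrA -(mulrA (y * y)) SS mulr_algr.
  by rewrite E sq (scaleNr (b ^+ 2 - s * d ^+ 2)) scalerN opprK.
have sP := pnilW (frame_s_pnil F).
have nP : b ^+ 2 - s * d ^+ 2 \in pint by pint_tac.
have nN : b ^+ 2 - s * d ^+ 2 \notin pnil.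
  apply: contra abN => nN.
  suff [] : b \in pnil /\ (0 : K) \in pnil by [].
  apply: (pnil3_sum_sqr bP (pint0 _)).
  rewrite (_ : _ + _ = (b ^+ 2 - s * d ^+ 2) + s * d ^+ 2); last by ring.
  by apply: pnilD => //; apply: pnilMr; [exact: frame_s_pnil F | pint_tac].
have nU : order_unit (b ^+ 2 - s * d ^+ 2)%:A by apply: (order_unitZ F) => //; exact: (order_unit1 i S).
have N1 : b ^+ 2 - s * d ^+ 2 = 1.
  have scal (k : K) n : (k%:A : D) ^+ n = 1 -> k ^+ n = 1.
    by rewrite exprZn expr1n (quat_scalar i S) [RHS](quat_1 i S) => /(frame_inj F)[].
  have := satM PS Pf Pf; rewrite ffE => /(kappa_s_cases F kappaE PS)[Pn|Pn].
    have [n n0 /scal Nn] := sat_unit_torsion F kappaE PS Pn nU.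
    exact: norm_torsion_eq1 Nn.
  have [n n0] := sat_unit_torsion F kappaE PS Pn (order_unitN F nU).
  rewrite -scaleNr => /scal Nn; apply: (@norm_torsion_eq1 b d (2 * n)) => //.
    by rewrite muln_gt0.
  by rewrite exprM -sqrrN -exprM mulnC exprM Nn expr1n.
have [g [g0 gS gC gE]] := ramified_conj N1.
exists g; split=> //; rewrite fE E mulrA gE -(mulrA i g S) gS mulrA mulrK ?D_div //.
by apply: (c3_coverM F kappaE); [exact: c3_cover_i | exact: c3_cover_S].
Qed.

End WithZeta.

Theorem finite_subgroup_cover P : saturated kappa P -> exists2 g, g != 0 &
  (forall x, P x -> sd16_cover (g * x * g^-1)) \/ (forall x, P x -> c3_cover (g * x * g^-1)).
Proof.
move=> PS; case: (pselect (exists x, [/\ P x, x ^+ 3 = 1 & x != 1])) => [[x [Px x3 x1]]|no3]; last first.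
  have [|g g0 gP] := sd16_case F kappaE rho2 PS; last by exists g => //; left.
  by move=> x Px x3; apply/eqP/negPn/negP => x1; apply: no3; exists x.
have sqr3 y : y * y + y + 1 = 0 -> (y *+ 2 + 1) * (y *+ 2 + 1) = (- 3%:R)%:A.
  move=> y0; pose X : {poly K} := 'X.
  have := erefl (horner_alg y ((X *+ 2 + 1) * (X *+ 2 + 1))).
  rewrite {2}(_ : (X *+ 2 + 1) * (X *+ 2 + 1) = (X * X + X + 1) *+ 4 - 1 *+ 3); last by ring.
  rewrite !(rmorphMn, rmorphB, rmorphD, rmorphM, rmorph1) /= !horner_algX y0 mul0rn sub0r => ->.
  by rewrite scaleNr scaler_nat.
have xx := cube_root_sqr F x3 x1.
have zz := cube_root_sqr F (zeta3 F) (zeta_neq1 F).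
(* Skolem-Noether is applied to the square roots $2x+1$ and $2\zeta+1$ of $-3$. *)
have [g g0 gth] : exists2 g, g != 0 & g * (x *+ 2 + 1) = (zeta *+ 2 + 1) * g.
  apply: (skolem_noether (sqr3 _ xx) (sqr3 _ zz)).
  apply: contrapT => thc.
  have xc y : x * y = y * x.
    have {thc} thc : (x *+ 2 + 1) * y = y * (x *+ 2 + 1).
      by apply/eqP/negPn/negP => h; apply: thc; exists y.
    move: thc; rewrite mulrDl mulrDr mul1r mulr1 => /addIr; rewrite mulrnAl mulrnAr.
    by rewrite -!scaler_nat => /(scalerI two_neq0).
  have xU : order_unit x by exact: (torsion_order_unit F kappaE _ x3).
  have [a [b [e [d [E [aP _ _ _] _]]]]] := order_unitP F xU.
  have [e0 d0] : e = 0 /\ d = 0 by apply: (comm_i_quat F (a := a) (b := b)); rewrite -E xc.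
  have [b0 _] : b = 0 /\ d = 0 by apply: (comm_S_quat F (a := a) (e := e)); rewrite -E xc.
  rewrite E in x3 x1; have [_] := cube_root_trace F aP x3 x1.
  rewrite b0 e0 d0 expr0n /= addr0 mulr0 subr0 => /esym/eqP.
  have four : 4%:R != 0 :> K by exact: padic_natr_neq0.
  by rewrite mulf_eq0 invr_eq0 (negPf four) (negPf three_neq0).
have gU := D_div g0.
have gx : g * x * g^-1 = zeta.
  move: gth; rewrite mulrDl mulrDr mul1r mulr1 => /addIr; rewrite mulrnAl mulrnAr.
  by rewrite -!scaler_nat => /(scalerI two_neq0) ->; rewrite mulrK.
have [|h h0 hP] := ramified_case (saturated_conj D_div g0 PS).
  by rewrite -gx; exact: (conj_byK D_div).
exists (h * g); first by apply/eqP => /(div_mulr_eq0 D_div)[/eqP|/eqP]; apply/negP.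
right=> y Py; have := hP _ (conj_byK D_div g0 Py).
by rewrite invrM ?D_div // !mulrA.
Qed.

End FiniteSubgroupClassification.

(** * Sums of two squares and existence of a quaternion frame *)

Lemma half_sum_sqr (E : fieldType) (x t : E) : 2%:R != 0 :> E -> x ^+ 2 = 2%:R * t ->
  (x / 2%:R) ^+ 2 + (x / 2%:R) ^+ 2 = t.
Proof. move=> n2; rewrite expr_div_n => ->; rewrite -mulrDl; apply: (canLR (mulfK (expf_neq0 2 n2))); ring. Qed.

(** A unit congruent to 1 is a square. If $z\equiv 2$, then $2z\equiv 1$ is a square $r^2$ and
    $z=2(r/2)^2$. *)
Lemma pint3_sum_two_squares (n : K) : n \in pint -> n \notin pnil ->
  exists a b, a ^+ 2 + b ^+ 2 = n.
Proof.
case/pintP => z ->; rewrite pcoord1_pnil => z1.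
have sq (t : padic_int prime3) : t 1%N = 1%N -> exists r, r ^+ 2 = t.
  move=> t1; have /pcoord_eq0P[d dE] : (t - 1) 1%N = 0%N.
    have := pcoordD (t - 1) 1 1; rewrite subrK t1; have := pcoord_lt (t - 1) 1.
    by case: ((t - 1) 1%N) => [|[|[|]]].
  have [|r [r' [rE _]]] := @padic3_sqrt t d; last by exists r.
  by rewrite -[LHS](subrK 1) dE addrC expr1.
have [z11|z12] : z 1%N = 1%N \/ z 1%N = 2.
- by move: z1; have := pcoord_lt z 1; case: (z 1%N) => [|[|[|]]] // _ _; [left|right].
- have [r rE] := sq z z11; exists (tofrac r), 0.
  by rewrite expr0n addr0 -rmorphXn /= rE.
have [|r rE] := sq (2%:R * z); first by rewrite pcoordM (pcoord_nat _ 2 1) z12.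
have two_neq0 : 2%:R != 0 :> K by exact: padic_natr_neq0.
have rE' : tofrac r ^+ 2 = 2%:R * tofrac z by rewrite -rmorphXn /= rE rmorphM rmorph_nat.
exists (tofrac r / 2%:R), (tofrac r / 2%:R).
exact: half_sum_sqr.
Qed.

(** Take $i=w^2$ and $S=(a+bi)y$ with $y^2=3e$. As [y] anticommutes with $i$, $S^2=(a^2+b^2)y^2$, so
    $a^2+b^2$ has to be the unit $-c^2/e$. *)
Lemma quaternion_frame_exists (D : falgType K) (c : K) :
  central_division D -> has_hasse_invariant D (1 / 2%:R) ->
  c \in pint -> c \notin pnil -> exists i S : D, quaternion_frame i S c.
Proof.
move=> DC Dinv cP cN; have D_div := DC.2.
have [w [y [e [dimD wprim yw eU y2]]]] := cyclic_degree_two DC Dinv.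
have eN := tofrac_unit eU.
have e0 : tofrac e != 0 by apply: contraNneq eN => ->; exact: pnil0.
have [a [b abE]] : exists a b, a ^+ 2 + b ^+ 2 = - (c ^+ 2 / tofrac e).
  apply: pint3_sum_two_squares.
    by apply/pintN/pintM; [exact: pintX | apply: pint_inv (pint_tofrac _) eN].
  apply: contra cN => nP; suff /(pnil_mul cP cP)[] : c * c \in pnil by [].
  rewrite (_ : c * c = - (c ^+ 2 / tofrac e) * - tofrac e).
    by apply: pnilMr nP _; apply/pintN/pint_tofrac.
  by rewrite mulrNN divfK.
pose i := w ^+ 2; have ii : i * i = -1.
  have [] := sqr_eq1 D_div (_ : i * i * (i * i) = 1).
  - by rewrite -!exprD (prim_expr_order wprim).
  - by rewrite -exprD => w4; have := prim_order_dvd wprim 4; rewrite w4 eqxx.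
  - by [].
have yi : y * i = - (i * y).
  rewrite /i expr2 mulrA yw -mulrA yw mulrA -exprD (_ : (3 + 3 = 2 + (2 + 2))%N) // !exprD.
  by rewrite -/i ii mulrN1 mulNr.
exists i, ((a%:A + b *: i) * y); split => //.
- transitivity ((a ^+ 2 + b ^+ 2) *: y ^+ 2).
    have yl : y * (a%:A + b *: i) = (a%:A - b *: i) * y.
      by rewrite mulrDr mulrBl mulr_algr -scalerAr yi mulr_algl scalerN scalerAl.
    set l := _ + _ in yl *; set l' := _ - _ in yl *.
    rewrite (mulrA (l * y)) -(mulrA l y) yl (mulrA l) -(mulrA (l * l')) -expr2.
    rewrite -mulr_algl; congr (_ * _); rewrite {yl}/l {}/l'.
    have comm_i : b *: i * a%:A = a%:A * (b *: i) by rewrite mulr_algl mulr_algr.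
    rewrite mulrDl !mulrBr comm_i addrA subrK.
    by rewrite mulr_algl scalerA -scalerAl -scalerAr ii scalerA scalerN opprK -scalerDl -!expr2.
  rewrite y2 abE scalerA; congr (_ *: _).
  by rewrite mulNr -mulrA [_^-1 * _]mulrCA mulVf ?mulr1 1?mulrC.
- have il : i * (a%:A + b *: i) = (a%:A + b *: i) * i.
    by rewrite mulrDl mulrDr mulr_algr mulr_algl -scalerAr -scalerAl.
  by rewrite -mulrA yi mulrN mulrA -il mulrA.
Qed.

(** * Classes of elements of $D^\times$ modulo powers of $\kappa=3u$ *)

Section UnitClass.
Variables (D : falgType K) (u : units (padic_int prime3)).
Hypothesis D_div : forall x : D, x != 0 -> x \is a GRing.unit.
Local Notation G := (units_mod_pu D u).
Local Notation kappa := (pu_scalar u).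
Implicit Types x y : D.

(** Total on [D], with the class of 1 as default value at non-units, so that computations take place
    in the algebra. *)
Definition unit_class x : G := quot_pi _ (insubd (units_one D) x).

Lemma pu_scalar_neq0 : kappa != 0.
Proof. by have := pu_subproof D u; apply: contraTneq => ->; rewrite scale0r unitr0. Qed.

Lemma unit_of_neq0 x : x != 0 -> unit_val (insubd (units_one D) x) = x.
Proof. by move=> x0; exact: (insubdK (units_one D) (D_div x0)). Qed.

Lemma unit_classM x y : x != 0 -> y != 0 ->
  unit_class (x * y) = (unit_class x * unit_class y)%g.
Proof.
move=> x0 y0; rewrite /unit_class [RHS]quot_mul_pi; congr (quot_pi _ _).
have xy0 : x * y != 0 by apply: contraTneq (D_div x0) => xy; apply: contraNN y0 => xU; rewrite -(mulKr xU y) xy mulr0.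
by apply: val_inj; rewrite /= !unit_of_neq0.
Qed.

Lemma unit_class1 : unit_class 1 = 1%g.
Proof. by congr (quot_pi _ _); apply: val_inj; rewrite /= unit_of_neq0 ?oner_neq0. Qed.

Lemma unit_val_puX n : unit_val (pu D u ^+ n)%g = (kappa ^+ n)%:A.
Proof.
elim: n => [|n IHn]; first by rewrite expg0 expr0 scale1r.
by rewrite expgS /= IHn exprS mulr_algl scalerA.
Qed.

Lemma unit_val_puV n : unit_val (pu D u ^- n)%g = (kappa ^- n)%:A.
Proof.
rewrite /= unit_val_puX; apply: (mulrI (x := (kappa ^+ n)%:A)).
  by rewrite -unit_val_puX unit_valP.
rewrite divrr -?unit_val_puX ?unit_valP // unit_val_puX mulr_algl scalerA divff ?scale1r //.
by rewrite expf_neq0 // pu_scalar_neq0.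
Qed.

Lemma unit_class_eqP x y : x != 0 -> y != 0 ->
  unit_class x = unit_class y <-> exists z : int, y = kappa ^ z *: x.
Proof.
move=> x0 y0; have xU := D_div x0.
have cyc (n : units D) : ((insubd (units_one D) x)^-1 * insubd (units_one D) y)%g = n <->
    y = x * unit_val n.
  split=> [<-|yE]; first by rewrite /= !unit_of_neq0 // mulVKr.
  by apply: val_inj; rewrite /= !unit_of_neq0 // yE mulKr.
apply: (iff_trans (quot_piP _ _ _)); split=> [[n [Hn|Hn]]|[[n|n] yE]].
- by exists (Posz n); rewrite ((cyc _).1 Hn) unit_val_puX mulr_algr.
- by exists (- Posz n); rewrite ((cyc _).1 Hn) unit_val_puV mulr_algr -exprnN.
- by exists n; left; apply/(cyc _).2; rewrite yE unit_val_puX mulr_algr.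
- by exists n.+1; right; apply/(cyc _).2; rewrite yE unit_val_puV mulr_algr.
Qed.

Lemma unit_class_surj (a : G) : exists2 x, x != 0 & a = unit_class x.
Proof.
exists (unit_val (qrepr a)); first by apply: contraTneq (unit_valP (qrepr a)) => ->; rewrite unitr0.
by rewrite -[LHS]quot_reprK; congr (quot_pi _ _); apply: val_inj; rewrite /= insubdK // unit_valP.
Qed.

Lemma unit_neq0 x : x \is a GRing.unit -> x != 0.
Proof. by apply: contraTneq => ->; rewrite unitr0. Qed.

Lemma unit_classX x n : x != 0 -> unit_class (x ^+ n) = (unit_class x ^+ n)%g.
Proof.
move=> x0; elim: n => [|n IHn]; first exact: unit_class1.
by rewrite exprS expgS unit_classM ?IHn //; apply/unit_neq0/unitrX/D_div.
Qed.

Lemma unit_classV x : x != 0 -> unit_class x^-1 = (unit_class x)^-1%g.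
Proof.
move=> x0; have xU := D_div x0; apply: (mulgI (unit_class x)).
by rewrite -unit_classM ?divrr ?mulgV ?unit_class1 //; apply: unit_neq0; rewrite unitrV.
Qed.

Lemma unit_classZ (z : int) x : x != 0 -> unit_class (kappa ^ z *: x) = unit_class x.
Proof.
move=> x0; apply/esym/unit_class_eqP => //; last by exists z.
by rewrite scaler_eq0 negb_or x0 expfz_neq0 ?pu_scalar_neq0.
Qed.

Lemma unit_class_eq1 x : x != 0 -> unit_class x = 1%g <-> exists z : int, x = (kappa ^ z)%:A.
Proof.
by move=> x0; rewrite -unit_class1 -(unit_class_eqP (oner_neq0 _) x0); split=> ->.
Qed.

Lemma saturated_preimage (F : set G) : finite_subgroup F ->
  saturated kappa (fun x => x != 0 /\ F (unit_class x)).
Proof.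
move=> finF; have [gT [f [fM _ fF]]] := finite_subgroup_fingroup finF.
have [[F1 FM FV] _] := finF; split.
- by move=> x [].
- move=> x y [x0 Fx] [y0 Fy]; split; last by rewrite unit_classM //; exact: FM.
  by apply: unit_neq0; rewrite unitrMl ?D_div.
- move=> x [x0 Fx]; split; first by apply: unit_neq0; rewrite unitrV D_div.
  by rewrite unit_classV //; exact: FV.
- split; first by apply/unit_neq0/pu_subproof.
  by rewrite -(expr1z kappa) unit_classZ ?oner_neq0 // unit_class1.
move=> x [x0]; rewrite -fF => -[t _ ft].
have xt0 : x ^+ #[t]%g != 0 by apply/unit_neq0/unitrX/D_div.
have [z zE] : exists z : int, x ^+ #[t]%g = (kappa ^ z)%:A.
  apply/(unit_class_eq1 xt0).1.
  by rewrite unit_classX // -ft -(gmorphX fM) expg_order (gmorph1 fM).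
by exists #[t]%g, z; rewrite order_gt0.
Qed.

End UnitClass.

(** * The two maximal finite subgroups *)

Section MaximalSubgroups.
Variables (D : falgType K) (u : units (padic_int prime3)) (i S : D) (c rho : K).
Local Notation s := (- (3%:R * c ^+ 2)).
Local Notation kappa := (pu_scalar u).
Hypothesis F : quaternion_frame i S c.
Hypothesis kappaE : kappa = s \/ kappa = - s.
Hypothesis rho2 : rho ^+ 2 = - 2%:R.
Local Notation w := (root8 i S rho).
Local Notation zeta := (root3 i S c).
Local Notation G := (units_mod_pu D u).
Let D_div := frame_div F.
Local Notation cl := (@unit_class D u).
Let w0 : w != 0 := w_neq0 F rho2.
Let S0 : S != 0 := frame_S_neq0 F.
Let i0 : i != 0. Proof. by have [] := order_unit_i F. Qed.
Let zeta0 : zeta != 0. Proof. by have [] := order_unit_zeta F. Qed.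

Lemma unit_class_order_unit x : order_unit i S x -> cl x = 1%g -> x = 1.
Proof.
move=> xU; have [x0 _ _] := xU; case/(unit_class_eq1 u D_div x0) => z xz.
by rewrite xz (order_unit_kappa F kappaE xU xz) expr0z scale1r.
Qed.

Lemma unit_class_N1 : cl (-1) <> 1%g.
Proof.
move/(unit_class_order_unit (order_unitN F (order_unit1 i S))) => /eqP.
rewrite eq_sym -addr_eq0 -{1 2}(scale1r (1 : D)) -scalerDl scaler_eq0 oner_eq0 orbF.
by apply/negP; exact: (@padic_natr_neq0 _ 2).
Qed.

(** The semidihedral presentation needs an involution: [S] has square $\kappa$ if $\kappa=s$, and
    $(wS)^2=w^4S^2=-s$ serves if $\kappa=-s$. *)
Lemma sd16_generator : exists T m,
  [/\ T != 0, T * T = kappa%:A, T * w = w ^+ 3 * T & S = w ^+ m * T].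
Proof.
have Sw := S_w F rho2 1; rewrite expr1 muln1 in Sw.
case: kappaE => kE.
  by exists S, 0; rewrite expr0 mul1r kE (frame_S F).
exists (w * S), 7; split.
- by apply: unit_neq0; rewrite unitrMl ?D_div.
- rewrite -mulrA (mulrA S) Sw -mulrA (frame_S F) mulr_algr -scalerAr -exprS (w4 F rho2) kE.
  by rewrite scalerN [in RHS]scaleNr.
- by rewrite -mulrA Sw (mulrA w (w ^+ 3)) (mulrA (w ^+ 3) w) -exprS -exprSr.
- by rewrite mulrA -exprSr (w8 F rho2) mul1r.
Qed.

Lemma isomorphic_sd16 : exists2 F1 : set G, isomorphic_to 'SD_16 F1 &
  forall x, x != 0 -> sd16_cover i S kappa rho x -> F1 (cl x).
Proof.
have [T [m [T0 TT Tw SE]]] := sd16_generator.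
have wX0 k : w ^+ k != 0 by apply/unit_neq0/unitrX/D_div.
exists (words2 (cl w) (cl T)).
  apply: semidihedral16_subgroup.
  - by rewrite -unit_classX // (w8 F rho2) unit_class1.
  - by rewrite -unit_classX // (w4 F rho2); exact: unit_class_N1.
  - by rewrite -unit_classX // expr2 TT -(expr1z kappa) unit_classZ ?oner_neq0 // unit_class1.
  by rewrite -unit_classX // -!unit_classM ?Tw ?wX0.
have wS k : w ^+ k * S = w ^+ (k + m) * T by rewrite [X in _ * X]SE mulrA -exprD.
move=> x _ [z [k [->|->]]].
  by exists k, 0%N; rewrite unit_classZ ?wX0 // unit_classX // mulg1.
have wT0 : w ^+ (k + m) * T != 0 by apply: unit_neq0; rewrite unitrMl ?D_div ?wX0.
by exists (k + m)%N, 1%N; rewrite wS unit_classZ // unit_classM ?wX0 // unit_classX.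
Qed.

Lemma isomorphic_c3_sdprod (hT : finGroupType) b : #|hT| = 8 ->
    (forall (gT : finGroupType) (x y : gT), (x ^+ 4 = 1 -> x ^+ 2 != 1 ->
       y ^+ 2 = x ^+ (2 * b) -> x ^ y = x^-1 -> <[x]> <*> <[y]> \isog [set: hT])%g) ->
    cl (S * S) = (cl i ^+ (2 * b))%g ->
  exists F2 : set G, [/\ isomorphic_to_C3_sdprod hT F2,
    exists2 gT : finGroupType, #|gT| = 24 & isomorphic_to gT F2 &
    forall x, x != 0 -> c3_cover i S c kappa x -> F2 (cl x)].
Proof.
move=> hT8 hT_isog SS.
have [] := @C3_sdprod_subgroup G hT (cl zeta) (cl i) (cl S) b hT_isog hT8.
- by rewrite -unit_classX // zeta3 // unit_class1.
- by move/(unit_class_order_unit (order_unit_zeta F))/eqP; apply/negP/zeta_neq1.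
- by rewrite -unit_classX // (exprM i 2 2) !expr2 (frame_i F) mulrNN mulr1 unit_class1.
- by rewrite -unit_classX // expr2 (frame_i F); exact: unit_class_N1.
- by rewrite -unit_classX.
- by rewrite -unit_classX // -!unit_classM ?(i_zeta F) ?expf_neq0 //; apply/unit_neq0/unitrX/D_div.
- by rewrite -unit_classX // -!unit_classM ?(S_i F) //; apply/unit_neq0/unitrX/D_div.
- by rewrite /commute -!unit_classM // (S_zeta F).
move=> iso2 card2; exists (words3 (cl zeta) (cl i) (cl S)); split=> //.
move=> x _ [z [j [k [l ->]]]]; exists j, k, l.
have zj : zeta ^+ j != 0 by apply/unit_neq0/unitrX/D_div.
have ik : i ^+ k != 0 by apply/unit_neq0/unitrX/D_div.
have Sl : S ^+ l != 0 by apply/unit_neq0/unitrX/D_div.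
have zi : zeta ^+ j * i ^+ k != 0 by apply: unit_neq0; rewrite unitrMl ?D_div.
have zS : zeta ^+ j * i ^+ k * S ^+ l != 0 by apply: unit_neq0; rewrite unitrMl ?D_div.
by rewrite unit_classZ // !unit_classM // !unit_classX.
Qed.

Lemma max_finite_classes_frame (P Q : set G -> Prop) (F1 F2 : set G) (gT hT : finGroupType) :
    isomorphic_to gT F1 -> isomorphic_to hT F2 -> P F1 -> Q F2 -> #|gT| = 16 -> #|hT| = 24 ->
    (forall x, x != 0 -> sd16_cover i S kappa rho x -> F1 (cl x)) ->
    (forall x, x != 0 -> c3_cover i S c kappa x -> F2 (cl x)) ->
  max_finite_classes P Q.
Proof.
move=> iso1 iso2 P1 Q2 card1 card2 cover1 cover2.
apply: (max_finite_classes_of_cover iso1 iso2 P1 Q2); rewrite ?card1 ?card2 //.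
move=> H finH; have satH := saturated_preimage D_div finH.
have [g g0 cov] := finite_subgroup_cover F kappaE rho2 satH.
have gV0 : g^-1 != 0 by apply: unit_neq0; rewrite unitrV D_div.
have conj x : x != 0 -> g * x * g^-1 != 0 /\ cl x = (cl (g * x * g^-1)%R ^ cl g)%g.
  move=> x0; have gx0 : g * x != 0 by apply: unit_neq0; rewrite unitrMl ?D_div.
  split; first by apply: unit_neq0; rewrite unitrMl ?D_div.
  by rewrite !unit_classM // unit_classV // conjgE mulgKV mulKg.
exists (cl g); case: cov => cov; [left|right] => a Ha;
  have [x x0 aE] := unit_class_surj a; have [gx0 clx] := conj x x0;
  rewrite aE clx; exists (cl (g * x * g^-1)) => //; [apply: cover1|apply: cover2] => //;
  by apply: cov; rewrite -aE.
Qed.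

End MaximalSubgroups.

(** * Square roots of units and the two congruence cases *)

Lemma padic3_sqrt_unit (v v' : padic_int prime3) :
  v = 1 + 3%:R * v' -> exists c : K, [/\ c \in pint, c \notin pnil & c ^+ 2 = tofrac v].
Proof.
move=> vE; have [r [r' [rr rE]]] := padic3_sqrt vE; exists (tofrac r).
split; [exact: pint_tofrac| |by rewrite -rmorphXn /= rr].
rewrite pcoord1_pnil rE pcoordD pcoordM (pcoord_nat _ 3 1) modnn mul0n mod0n addn0.
by rewrite (pcoord_nat _ 1 1).
Qed.

Lemma padic3_sqrt_m2 : exists rho : K, rho ^+ 2 = - 2%:R.
Proof.
have [|rho [_ _ rhoE]] := @padic3_sqrt_unit (- 2%:R) (-1); first by ring.
by exists rho; rewrite rhoE rmorphN rmorph_nat.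
Qed.

Theorem theorem4p28 (D : falgType (padic prime3)) (u : units (padic_int prime3))
    (D_central : central_division D)
    (D_inv : has_hasse_invariant D (1 / 2%:R)) :
  (padic_eqmod (unit_val u) 1 ->
     max_finite_classes (G := units_mod_pu D u)
       (isomorphic_to 'SD_16) (isomorphic_to_C3_sdprod 'Q_8)) /\
  (padic_eqmod (unit_val u) (-1) ->
     max_finite_classes (G := units_mod_pu D u)
       (isomorphic_to 'SD_16) (isomorphic_to_C3_sdprod 'D_8)).
Proof.
have [rho rho2] := padic3_sqrt_m2; have D_div := D_central.2.
have cardSD : #|semidihedral_gtype 16| = 16 by have /= := @card_semidihedral 4 isT; rewrite cardsT.
have kE c : c ^+ 2 = tofrac (unit_val u) -> pu_scalar u = 3%:R * c ^+ 2.
  by move=> ->; rewrite /pu_scalar rmorphM rmorph_nat.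
split=> -[v vE].
(* With $c^2=u$ one has $S^2=-\kappa$, whose class is that of $-1=i^2$: the quaternion relation. *)
- have [|c [cP cN cc]] := @padic3_sqrt_unit (unit_val u) v; first by rewrite -vE addrC subrK.
  have [i [S F]] := quaternion_frame_exists D_central D_inv cP cN.
  have kappaE : pu_scalar u = - (3%:R * c ^+ 2) \/ pu_scalar u = - - (3%:R * c ^+ 2).
    by right; rewrite opprK (kE _ cc).
  have [F1 iso1 cov1] := isomorphic_sd16 F kappaE rho2.
  have [|gT x y||F2 [iso2 [gT card2 isoF2] cov2]] := isomorphic_c3_sdprod F kappaE (hT := quaternion_gtype 8) (b := 1%N).
  + by have /= := @card_quaternion 3 isT; rewrite cardsT.
  + exact: quaternion8_isog.
  + have N1 : -1 != 0 :> D by rewrite oppr_eq0 oner_neq0.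
    rewrite (frame_S F) scaleNr -(kE _ cc) -scalerN -(expr1z (pu_scalar u)) unit_classZ //.
    by rewrite -(frame_i F) -expr2 unit_classX //; have [] := order_unit_i F.
  exact: (max_finite_classes_frame F kappaE rho2 iso1 isoF2 iso1 iso2).
(* With $c^2=-u$ one has $S^2=\kappa$, whose class is trivial: the dihedral relation. *)
- have [|c [cP cN cc]] := @padic3_sqrt_unit (- unit_val u) (- v).
    by rewrite mulrN -vE; ring.
  have [i [S F]] := quaternion_frame_exists D_central D_inv cP cN.
  have kE' : pu_scalar u = - (3%:R * c ^+ 2).
    by rewrite cc /pu_scalar rmorphM rmorph_nat rmorphN mulrN opprK.
  have kappaE : pu_scalar u = - (3%:R * c ^+ 2) \/ pu_scalar u = - - (3%:R * c ^+ 2) by left.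
  have [F1 iso1 cov1] := isomorphic_sd16 F kappaE rho2.
  have [|gT x y||F2 [iso2 [gT card2 isoF2] cov2]] := isomorphic_c3_sdprod F kappaE (hT := dihedral_gtype 8) (b := 0).
  + by have /= := @card_2dihedral 3 isT; rewrite cardsT.
  + exact: dihedral8_isog.
  + rewrite (frame_S F) -kE' -(expr1z (pu_scalar u)) unit_classZ ?oner_neq0 //.
    exact: unit_class1.
  exact: (max_finite_classes_frame F kappaE rho2 iso1 isoF2 iso1 iso2).
Qed.
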